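(* Let $k\ge0$ be an integer or half-integer, let $\mu$ be a $k$-FC measure, and let $\alpha,\beta\in\mathbb{Z}_+$ with $\alpha+\beta=2k$. Then the sesquilinear form in $\mathcal{F}^2(\mathbb{C})$ $$F(f,g)=F_{\mu,\alpha,\beta}(f,g)=(\boldsymbol{\partial}^\alpha\overline{\boldsymbol{\partial}}^{\beta}\mu,\,f\bar g)$$ is bounded in $\mathcal{F}^2(\mathbb{C})$, and $$|F(f,g)|\le C\,\big(\varpi_\alpha(\mu)\,\varpi_\beta(\mu)\big)^{1/2}\|f\|_{\mathcal{F}^2}\|g\|_{\mathcal{F}^2},\qquad f,g\in\mathcal{F}^2(\mathbb{C}),$$ with an absolute constant $C$.
   Context: $\mathcal{F}^2(\mathbb{C})$ is the Fock space of entire functions $f$ with $\|f\|_{\mathcal{F}^2}^2=\int_{\mathbb{C}}|f(z)|^2\,\omega(z)\,dV(z)<\infty$, where $\omega(z)=\pi^{-1}e^{-|z|^2}$ and $dV$ is Lebesgue measure on $\mathbb{C}=\mathbb{R}^2$. $\mathbb{Z}_+=\{0,1,2,\dots\}$. Measures are complex-valued Borel measures on $\mathbb{C}$ that are locally finite (possibly of infinite total variation); $|\mu|$ denotes the variation of $\mu$. For an integer $k\ge0$, $\mu$ is called a $k$-FC measure (Fock-Carleson measure for derivatives of order $k$) if there is a constant $\varpi_k(\mu)<\infty$ such that $$\int_{\mathbb{C}}|f^{(k)}(z)|^2e^{-|z|^2}\,d|\mu|(z)\le\varpi_k(\mu)\|f\|_{\mathcal{F}^2}^2\quad\text{for all }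 f\in\mathcal{F}^2(\mathbb{C}).$$ For integer $j\ge 0$, $\varpi_j(\mu)\in[0,\infty]$ denotes the least constant for which this inequality holds with $k=j$ ($\varpi_j(\mu)=\infty$ if there is none). For half-integer $k\ge0$, $\mu$ is called a $k$-FC measure if $\sup_{z\in\mathbb{C}}|\mu|(B(z,\sqrt2))(1+|z|^2)^k<\infty$, where $B(z,r)$ is the disk of radius $r$ centered at $z$. The coderivative of a distribution $\Phi$ is $\boldsymbol{\partial}\Phi=\omega^{-1}\partial(\omega\Phi)$ (and similarly $\overline{\boldsymbol{\partial}}\Phi=\omega^{-1}\overline{\partial}(\omega\Phi)$), where $\partial=\partial/\partial z$, $\overline\partial=\partial/\partial\overline z$. The action of $\boldsymbol{\partial}^\alpha\overline{\boldsymbol{\partial}}^{\beta}\mu$ on $f\bar g$, for $f,g\in\mathcal{F}^2(\mathbb{C})$, is defined by $$(\boldsymbol{\partial}^\alpha\overline{\boldsymbol{\partial}}^{\beta}\mu,f\bar g)=(-1)^{\alpha+\beta}(\omega\mu,\partial^\alpha\overline{\partial}^\beta(f\bar g))=(-1)^{\alpha+\beta}\int_{\mathbb{C}}f^{(\alpha)}(z)\overline{g^{(\beta)}(z)}\,\omega(z)\,d\mu(z).$$ *)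

(* Defs.v *)
From HB Require Import structures.
From mathcomp Require Import all_boot all_order all_algebra.
From mathcomp Require Import all_classical all_reals all_analysis.
From mathcomp Require Export complex.
Set Implicit Arguments.
Unset Strict Implicit.
Unset Printing Implicit Defensive.
Import Order.TTheory GRing.Theory Num.Theory.
Import numFieldNormedType.Exports.

Local Open Scope classical_set_scope.
Local Open Scope ring_scope.
Local Open Scope complex_scope.

(* The plane carries two types: R[i] for the complex structure, and R * R for
   the Borel sigma-algebra and Lebesgue measure. *)
Definition toC (R : realType) (p : R * R) : R[i] := p.1 +i* p.2.

Definition cabs (R : realType) (z : R[i]) : R := ComplexField.Normc.normc z.

(* The topology of R[i] is the norm topology of the field R[i]; the alias
   R[i]^o makes the library find it. Derivatives below are complex. *)
Definition entire (R : realType) (f : R[i] -> R[i]) : Prop :=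
  forall z : R[i], derivable (f : R[i]^o -> R[i]^o) z 1.

Definition cderiv (R : realType) (n : nat) (f : R[i] -> R[i]) : R[i] -> R[i] :=
  derive1n n (f : R[i]^o -> R[i]^o).

Definition fock_weight (R : realType) (z : R[i]) : R :=
  pi^-1 * expR (- cabs z ^+ 2).

Definition fock_norm2 (R : realType) (f : R[i] -> R[i]) : \bar R :=
  (\int[@lebesgue_measure R \x @lebesgue_measure R]_p
     (cabs (f (toC p)) ^+ 2 * fock_weight (toC p))%:E)%E.

Definition fock (R : realType) (f : R[i] -> R[i]) : Prop :=
  entire f /\ (fock_norm2 f < +oo)%E.

Definition fock_norm (R : realType) (f : R[i] -> R[i]) : R :=
  Num.sqrt (fine (fock_norm2 f)).

Definition bounded_borel (R : realType) (A : set (R * R)) : Prop :=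
  measurable A /\ bounded_set A.

(* The total variation of mu on A is the supremum of the sums of |mu (E i)|
   over finite families of disjoint bounded Borel subsets of A. *)
Definition cvariation (R : realType) (mu : set (R * R) -> R[i])
    (A : set (R * R)) : \bar R :=
  ereal_sup [set x : \bar R | exists (n : nat) (E : nat -> set (R * R)),
    [/\ forall i, bounded_borel (E i) /\ E i `<=` A,
        trivIset setT E &
        x = (\sum_(i < n) cabs (mu (E i)))%:E]].

(* A locally finite complex measure need not be defined on unbounded sets: it
   is a countably additive function of bounded Borel sets, and its values on
   other sets are irrelevant. *)
Record lf_complex_measure (R : realType) := LfComplexMeasure {
  cmeas :> set (R * R) -> R[i] ;
  cmeas_sigma_additive : forall E : nat -> set (R * R),
    (forall i, measurable (E i)) -> trivIset setT E ->
    bounded_set (\bigcup_i E i) ->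
    (fun n => (\sum_(i < n) cmeas (E i) : R[i]^o)) @ \oo
      --> (cmeas (\bigcup_i E i) : R[i]^o) ;
  cmeas_locally_finite : forall A : set (R * R),
    bounded_borel A -> (cvariation cmeas A < +oo)%E
}.

(* The positive part, in the Jordan decomposition, of a locally finite real
   measure nu. *)
Definition jordan_part (R : realType) (nu : set (R * R) -> R)
    (A : set (R * R)) : \bar R :=
  ereal_sup [set (nu B)%:E | B in [set B | bounded_borel B /\ B `<=` A]].

Definition real_integral (R : realType) (nu : set (R * R) -> R)
    (h : R * R -> R) : R :=
  let nuN := fun A => - nu A in
  fine (\int[jordan_part nu]_p (h p)%:E)%E -
  fine (\int[jordan_part nuN]_p (h p)%:E)%E.

Definition cintegrable (R : realType) (mu : lf_complex_measure R)
    (h : R * R -> R[i]) : Prop :=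
  integrable (cvariation mu) setT (fun p => (complex.Re (h p))%:E) /\
  integrable (cvariation mu) setT (fun p => (complex.Im (h p))%:E).

Definition cintegral (R : realType) (mu : lf_complex_measure R)
    (h : R * R -> R[i]) : R[i] :=
  let mr := fun A => complex.Re (mu A) in
  let mi := fun A => complex.Im (mu A) in
  let hr := fun p => complex.Re (h p) in
  let hi := fun p => complex.Im (h p) in
  (real_integral mr hr - real_integral mi hi) +i*
  (real_integral mr hi + real_integral mi hr).

Definition FC_bound (R : realType) (mu : lf_complex_measure R)
    (j : nat) (c : R) : Prop :=
  forall f : R[i] -> R[i], fock f ->
  (\int[cvariation mu]_p
     (cabs (cderiv j f (toC p)) ^+ 2 * expR (- cabs (toC p) ^+ 2))%:E
   <= c%:E * fock_norm2 f)%E.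

(* +oo when no constant is admissible. *)
Definition FC_const (R : realType) (j : nat) (mu : lf_complex_measure R) :
    \bar R :=
  ereal_inf [set c%:E | c in [set c : R | 0 <= c /\ FC_bound mu j c]].

Definition disk (R : realType) (z : R[i]) (r : R) : set (R * R) :=
  [set p | cabs (toC p - z) < r].

Definition FC_measure (R : realType) (k : R) (mu : lf_complex_measure R) :
    Prop :=
  (exists2 j : nat, k = j%:R & exists c : R, FC_bound mu j c) \/
  (exists2 j : nat, k = j%:R + 2^-1 &
    (ereal_sup [set cvariation mu (disk z (Num.sqrt 2))
                    * ((1 + cabs z ^+ 2) `^ k)%:E | z in [set: R[i]]]
     < +oo)%E).

Definition coder_integrand (R : realType) (a b : nat) (f g : R[i] -> R[i])
    (p : R * R) : R[i] :=
  cderiv a f (toC p) * (cderiv b g (toC p))^* * (fock_weight (toC p))%:C.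

Definition coder_form (R : realType) (mu : lf_complex_measure R) (a b : nat)
    (f g : R[i] -> R[i]) : R[i] :=
  (-1) ^+ (a + b) * cintegral mu (coder_integrand a b f g).

Definition fock_sesquilinear (R : realType)
    (F : (R[i] -> R[i]) -> (R[i] -> R[i]) -> R[i]) : Prop :=
  (forall (c : R[i]) (f1 f2 g : R[i] -> R[i]), fock f1 -> fock f2 -> fock g ->
     F (fun z => c * f1 z + f2 z) g = c * F f1 g + F f2 g) /\
  (forall (c : R[i]) (f g1 g2 : R[i] -> R[i]), fock f -> fock g1 -> fock g2 ->
     F f (fun z => c * g1 z + g2 z) = c^* * F f g1 + F f g2).

Definition fock_bounded (R : realType)
    (F : (R[i] -> R[i]) -> (R[i] -> R[i]) -> R[i]) : Prop :=
  exists M : R, forall f g : R[i] -> R[i], fock f -> fock g ->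
    cabs (F f g) <= M * fock_norm f * fock_norm g.

(* Main.v *)
From HB Require Import structures.
Require Import Defs.
From mathcomp Require Import all_boot all_order all_algebra.
From mathcomp Require Import all_classical all_reals all_analysis.
From mathcomp Require Import measurable_realfun ring lra.
Set Implicit Arguments.
Unset Strict Implicit.
Unset Printing Implicit Defensive.
Import Order.TTheory GRing.Theory Num.Theory.
Import numFieldNormedType.Exports.

Local Open Scope classical_set_scope.
Local Open Scope ring_scope.
Local Open Scope complex_scope.

(** Why the theorem holds.

    Write m(z) = 1 + |z|^2 and w for the Gaussian weight.  For every t > 0 and
    every weight r > 0, the inequality of the two means gives
      |f^(a)| |g^(b)| w <= (t r |f^(a)|^2 w + (t r)^-1 |g^(b)|^2 w) / 2,
    and optimising over t turns this into a weighted Cauchy-Schwarz bound for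
    the form ([coder_form_cauchy_schwarz]).  Take r = m^(k - a).  Since
    a + b = 2 k, its inverse is m^(k - b), so boundedness of the form reduces
    to one estimate, to be applied with n = a and with n = b:
      int m^(k - n) |f^(n)|^2 w d|mu| <= C ||f||^2   ([weighted_deriv_bound]).
    Neither a nor b has to be equal to k: a k-FC measure need not be an a-FC
    measure, and only the balance of the two weights makes the form bounded.

    This estimate combines two facts by Tonelli's theorem
    ([carleson_tonelli]).

    The first one is local: |f^(n)(z)|^2 w(z) is at most C m(z)^n times the
    mass of |f|^2 w on the unit box centred at z ([cderiv_pointwise]).  For
    n = 0 it is the mean value property of the entire function
    u |-> (f(u) exp (- z^* (u - z)))^2, whose modulus near z is |f|^2 w / w(z)
    up to a bounded factor ([fock_pointwise]).  Higher derivatives follow by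
    Cauchy's estimate on a disk of radius about 1 / (1 + |z|), on which w
    changes by a bounded factor only; this is where m(z)^n comes from.

    The second one is the disk condition: |mu| (B (z, sqrt 2)) m(z)^k is
    bounded ([FC_measure_disk]).  It is the definition when k is a
    half-integer.  When k is an integer and |z| >= 1, it follows by testing
    the Carleson inequality on the normalised reproducing kernel at z, whose
    k-th derivative is z^*^k times the kernel ([FC_disk]); for |z| < 1, local
    finiteness of mu is enough.

    The function theory is derived from complex differentiability alone, by
    contours that are squares.  In the coordinates u = e^s (1 + i t), the sides
    of the squares centred at 0 are the lines of constant s, and Goursat's
    bisection argument shows that the integral of G(u) du / u along one side
    does not depend on the size of the square as soon as G(i u) = G(u)
    ([square_mean]).  For G(u) = sum_k f(z + i^k u) this is a mean value
    property; averaged over the sizes of the squares it becomes an area mean in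
    Cartesian coordinates ([box_mean]).  For
    G(u) = sum_k i^-k f(z + i^k u) / u it expresses f'(z) by an integral, which
    yields Cauchy's estimate ([deriv_bound]) and the differentiability of f'
    ([deriv_cdifferentiable]).

    The last inequality of the theorem is the same Cauchy-Schwarz bound with
    r = 1; the constant 8 is the cost of cutting the integral against mu into
    real and imaginary parts and then into Jordan parts.  The degenerate values
    of the constants are treated apart.  If one of them is 0, the reproducing
    kernel at 1 shows that |mu| = 0, because the integrand in the Carleson
    inequality is positive everywhere ([FC_const0]).  If one of them is +oo and
    none is 0, the right-hand side is +oo unless f or g has norm 0, and in that
    case boundedness shows that the form vanishes. *)

(** * Complex differentiability in epsilon-delta form *)

Section CabsBasics.
Context {R : realType}.
Implicit Types z w : R[i].

Lemma cabsM z w : cabs (z * w) = cabs z * cabs w.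
Proof. exact: ComplexField.Normc.normcM. Qed.

Lemma cabsD z w : cabs (z + w) <= cabs z + cabs w.
Proof. exact: (@le_normcD R). Qed.

Lemma cabsN z : cabs (- z) = cabs z.
Proof. exact: (@normcN R). Qed.

Lemma cabsBC z w : cabs (z - w) = cabs (w - z).
Proof. by rewrite -cabsN opprB. Qed.

Lemma cabs0 : cabs (0 : R[i]) = 0.
Proof. exact: ComplexField.Normc.normc0. Qed.

Lemma cabs1 : cabs (1 : R[i]) = 1.
Proof. exact: ComplexField.Normc.normc1. Qed.

Lemma cabsV z : cabs z^-1 = (cabs z)^-1.
Proof. exact: ComplexField.Normc.normcV. Qed.

Lemma cabs_ge0 z : 0 <= cabs z.
Proof. by case: z => a b; rewrite /cabs /= sqrtr_ge0. Qed.

Lemma cabs_eq0 z : (cabs z == 0) = (z == 0).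
Proof.
apply/eqP/eqP => [|->]; last exact: cabs0.
exact: ComplexField.Normc.eq0_normc.
Qed.

Lemma cabs_gt0 z : (0 < cabs z) = (z != 0).
Proof. by rewrite lt_def cabs_ge0 andbT cabs_eq0. Qed.

Lemma cabs_sqr z : cabs z ^+ 2 = complex.Re z ^+ 2 + complex.Im z ^+ 2.
Proof. by case: z => a b; rewrite /cabs /= sqr_sqrtr// addr_ge0// sqr_ge0. Qed.

Lemma cabsX z n : cabs (z ^+ n) = cabs z ^+ n.
Proof. by elim: n => [|n IH]; rewrite ?expr0 ?cabs1// !exprS cabsM IH. Qed.

Lemma cabs_real (x : R) : cabs x%:C = `|x|.
Proof. by rewrite /cabs /= expr0n/= addr0 sqrtr_sqr. Qed.

Lemma cabs_conj z : cabs z^* = cabs z.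
Proof. by case: z => a b; rewrite /cabs /= sqrrN. Qed.

Lemma cabs_i : cabs ('i : R[i]) = 1.
Proof. by rewrite /cabs /= expr0n/= expr1n add0r sqrtr1. Qed.

Lemma cabs_Re z : `|complex.Re z| <= cabs z.
Proof.
rewrite -(ler_pXn2r (n := 2))// ?nnegrE ?cabs_ge0// cabs_sqr real_normK ?num_real//.
by rewrite lerDl sqr_ge0.
Qed.

Lemma cabs_Im z : `|complex.Im z| <= cabs z.
Proof.
rewrite -(ler_pXn2r (n := 2))// ?nnegrE ?cabs_ge0// cabs_sqr real_normK ?num_real//.
by rewrite lerDr sqr_ge0.
Qed.

Lemma cabs_leD z : cabs z <= `|complex.Re z| + `|complex.Im z|.
Proof.
rewrite {1}(complexE z); apply: (le_trans (cabsD _ _)).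
by rewrite cabsM cabs_i mul1r !cabs_real.
Qed.

Lemma normC_cabs z : `|z| = (cabs z)%:C.
Proof. by case: z. Qed.

(** The triangle inequality in the form in which a known value at w bounds
    an unknown value at z. *)
Lemma cabs_ler_dist z w : cabs z <= cabs w + cabs (z - w).
Proof. by rewrite -{1}(subrK w z) addrC; apply: le_trans (cabsD _ _) _; rewrite addrC. Qed.

(** Real radii and real errors keep the estimates below inside the ordered
    field; [cdiffP] identifies this notion with the derivative of the normed
    space R[i]^o. *)
Definition cdiff (f : R[i] -> R[i]) (z d : R[i]) := forall e : R, 0 < e ->
  exists2 r : R, 0 < r & forall h, cabs h < r ->
    cabs (f (z + h) - f z - h * d) <= e * cabs h.

Lemma cdiffP f z d :
  cdiff f z d <-> is_derive (z : R[i]^o) 1 (f : R[i]^o -> R[i]^o) d.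
Proof.
split.
- move=> fd.
  have H : h^-1 *: ((f (h *: (1 : R[i]^o) + z) : R[i]^o) - f z) @[h --> (0:R[i]^o)^'] --> (d : R[i]^o).
    apply/cvgrPdist_le => e e0.
    have [eI eR] : complex.Im e = 0 /\ 0 < complex.Re e.
      by move: e0; case: e => a b; rewrite ltcE/= => /andP[/eqP -> ->].
    have [r r0 Hr] := fd _ eR.
    rewrite near_withinE; near=> h => h0.
    rewrite -normrN opprB.
    have -> : h^-1 *: ((f (h *: (1 : R[i]^o) + z) : R[i]^o) - f z) - d
      = h^-1 * (f (z + h) - f z - h * d).
      rewrite /GRing.scale/= mulr1 (addrC h) [RHS]mulrBr mulrA mulVf// mul1r; congr (_ * _ - _).
    rewrite normC_cabs.
    have -> : e = (complex.Re e)%:C by move: eI; case: (e) => a b /= ->.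
    rewrite lecR cabsM cabsV ler_pdivrMl ?cabs_gt0// [cabs h * _]mulrC.
    apply: Hr.
    have : `|h| < r%:C.
      near: h. 
      by exists r%:C; [rewrite /= ltcR| move=> x /=; rewrite sub0r normrN].
    by rewrite normC_cabs ltcR.
  by split; [apply/cvg_ex; exists d|apply: cvg_lim].
- move=> [dv dE] e e0.
  move/cvgrPdist_le : (dv) => /(_ e%:C); rewrite ltcR => /(_ e0).
  rewrite near_withinE => -[r /= r0 Hr].
  have [rI rR] : complex.Im r = 0 /\ 0 < complex.Re r.
    by move: r0; case: (r) => a b; rewrite ltcE/= => /andP[/eqP -> ->].
  exists (complex.Re r) => // h hr.
  have [->|h0] := eqVneq h 0.
    by rewrite addr0 mul0r !subrr cabs0 mulr0.
  have := Hr h; rewrite /ball_/= sub0r normrN normC_cabs.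
  have -> : r = (complex.Re r)%:C by move: rI; case: (r) => a b /= ->.
  rewrite ltcR => /(_ hr h0).
  rewrite -normrN opprB.
  move: dE; rewrite /derive => ->.
  have -> : h^-1 *: ((f (h *: (1 : R[i]^o) + z) : R[i]^o) - f z) - d
      = h^-1 * (f (z + h) - f z - h * d).
      rewrite /GRing.scale/= mulr1 (addrC h) [RHS]mulrBr mulrA mulVf// mul1r; congr (_ * _ - _).
  by rewrite normC_cabs lecR cabsM cabsV ler_pdivrMl ?cabs_gt0// [cabs h * _]mulrC.
Unshelve. all: by end_near.
Qed.

End CabsBasics.

Section CdiffRules.
Context {R : realType}.
Implicit Types (z w d : R[i]) (f g : R[i] -> R[i]).

Lemma cdiff_derive f z d : cdiff f z d -> cderiv 1 f z = d.
Proof. by move/cdiffP => [_ <-]; rewrite /cderiv /= derive1E. Qed.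

Lemma entireP f : entire f <-> forall z, cdiff f z (cderiv 1 f z).
Proof.
split=> [ef z|ef z].
  by apply/cdiffP; split; [exact: ef|rewrite /cderiv /= derive1E].
by have /cdiffP[] := ef z.
Qed.

Lemma entire_cdiff f (d : R[i] -> R[i]) : (forall z, cdiff f z (d z)) ->
  entire f /\ cderiv 1 f = d.
Proof.
move=> fd; split; last by apply/funext => z; exact: cdiff_derive.
by move=> z; have /cdiffP[] := fd z.
Qed.

Lemma cderivS n f : cderiv n.+1 f = cderiv 1 (cderiv n f).
Proof. by []. Qed.

Lemma cdiff_cst (c z : R[i]) : cdiff (fun=> c) z 0.
Proof.
move=> e e0; exists 1 => // h _; rewrite mulr0 !subrr cabs0.
by rewrite mulr_ge0 ?cabs_ge0// ltW.
Qed.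

Lemma cdiffD f g z df dg : cdiff f z df -> cdiff g z dg ->
  cdiff (fun w => f w + g w) z (df + dg).
Proof. by move=> /cdiffP fd /cdiffP gd; apply/cdiffP; exact: is_deriveD. Qed.

Lemma cdiffM f g z df dg : cdiff f z df -> cdiff g z dg ->
  cdiff (fun w => f w * g w) z (f z * dg + g z * df).
Proof. by move=> /cdiffP fd /cdiffP gd; apply/cdiffP; exact: is_deriveM. Qed.

Lemma cdiffZ f z c df : cdiff f z df -> cdiff (fun w => c * f w) z (c * df).
Proof.
move=> fd; have := cdiffM (cdiff_cst c z) fd.
by rewrite mulr0 addr0.
Qed.

Lemma cdiff_affine f (a b z d : R[i]) : cdiff f (a + b * z) d ->
  cdiff (fun w => f (a + b * w)) z (b * d).
Proof.
move=> fd e e0.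
have b1 : 0 < cabs b + 1 by rewrite ltr_wpDl// cabs_ge0.
have [r r0 Hr] := fd (e / (cabs b + 1)) (divr_gt0 e0 b1).
exists (r / (cabs b + 1)); first exact: divr_gt0.
move=> h hr.
have -> : a + b * (z + h) = a + b * z + b * h by ring.
have -> : h * (b * d) = b * h * d by ring.
have bh : cabs (b * h) <= (cabs b + 1) * cabs h.
  by rewrite cabsM ler_wpM2r ?cabs_ge0// lerDl.
apply: (le_trans (Hr (b * h) _)).
  apply: (le_lt_trans bh); rewrite mulrC -ltr_pdivlMr//.
rewrite mulrAC ler_pdivrMr// -mulrA; apply: ler_wpM2l; first exact: ltW.
by rewrite [leRHS]mulrC.
Qed.

Lemma cdiff_id z : cdiff (fun w => w) z 1.
Proof.
move=> e e0; exists 1 => // h _.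
by rewrite mulr1 (addrC z) addrK subrr cabs0 mulr_ge0 ?cabs_ge0// ltW.
Qed.

Lemma cdiff_inv z : z != 0 -> cdiff (fun w => w^-1) z (- z^-1 ^+ 2).
Proof.
move=> z0 e e0.
have cz : 0 < cabs z by rewrite cabs_gt0.
exists (Num.min (cabs z / 2) (e * cabs z ^+ 3 / 2)).
  rewrite lt_min !divr_gt0// mulr_gt0// exprn_gt0//.
move=> h; rewrite lt_min => /andP[h1 h2].
have zh : cabs z / 2 <= cabs (z + h).
  have := cabs_ler_dist z (z + h); rewrite opprD addrA subrr sub0r cabsN; lra.
have zh0 : z + h != 0 by rewrite -cabs_gt0; apply: lt_le_trans zh; rewrite divr_gt0.
have -> : (z + h)^-1 - z^-1 - h * (- z^-1 ^+ 2) = h * h * (z^-1 ^+ 2 * (z + h)^-1).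
  by field; rewrite z0 zh0.
rewrite (cabsM (h * h)) (cabsM h) (cabsM (z^-1 ^+ 2)) mulrAC; apply: ler_wpM2r; first exact: cabs_ge0.
rewrite cabsX !cabsV mulrA.
have zhp : 0 < cabs (z + h) by rewrite cabs_gt0.
rewrite ler_pdivrMr//.
apply: (@le_trans _ _ (e * (cabs z / 2))); last by rewrite ler_wpM2l// ltW.
have -> : e * (cabs z / 2) = (e * cabs z ^+ 3 / 2) * (cabs z)^-1 ^+ 2.
  by field; rewrite gt_eqF.
by rewrite ler_wpM2r ?exprn_ge0 ?invr_ge0 ?cabs_ge0// ltW.
Qed.

Lemma cdiff_cont f z d : cdiff f z d -> forall e : R, 0 < e ->
  exists2 r : R, 0 < r & forall h, cabs h < r -> cabs (f (z + h) - f z) < e.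
Proof.
move=> fd e e0; have [r r0 Hr] := fd 1 ltr01.
have d1 : 0 < 1 + cabs d by rewrite ltr_pwDl// cabs_ge0.
exists (Num.min r (e / (1 + cabs d))); first by rewrite lt_min r0 divr_gt0.
move=> h; rewrite lt_min => /andP[h1 h2].
apply: (le_lt_trans (cabs_ler_dist _ (h * d))).
apply: (@le_lt_trans _ _ (cabs h * cabs d + 1 * cabs h)).
  by rewrite lerD ?cabsM//; exact: Hr.
by move: h2; rewrite ltr_pdivlMr// mulrDr mulr1 mul1r addrC.
Qed.

(** Real counterpart of [cdiff], which transports derivatives between the
    complex plane and the real line. *)
Definition rdiff (f : R -> R) (x d : R) := forall e : R, 0 < e ->
  exists2 r : R, 0 < r & forall h, `|h| < r ->
    `|f (x + h) - f x - h * d| <= e * `|h|.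

Lemma rdiffP (f : R -> R) (x d : R) : rdiff f x d <-> is_derive x 1 f d.
Proof.
have E (h : R) : h != 0 -> h^-1 *: (f (h *: 1 + x) - f x) - d
      = h^-1 * (f (x + h) - f x - h * d).
  move=> h0; rewrite /GRing.scale/= mulr1 (addrC h) [RHS]mulrBr mulrA mulVf// mul1r//.
split.
- move=> fd.
  have H : h^-1 *: (f (h *: 1 + x) - f x) @[h --> (0:R)^'] --> d.
    apply/cvgrPdist_le => e e0.
    have [r r0 Hr] := fd _ e0.
    rewrite near_withinE; near=> h => h0.
    rewrite -normrN opprB E// normrM normfV ler_pdivrMl ?normr_gt0// [`|h| * _]mulrC.
    apply: Hr.
    near: h; exists r => //= y /=; rewrite sub0r normrN//.
  by split; [apply/cvg_ex; exists d|apply: cvg_lim].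
- move=> [dv dE] e e0.
  move/cvgrPdist_le : (dv) => /(_ e e0).
  rewrite near_withinE => -[r /= r0 Hr].
  exists r => // h hr.
  have [->|h0] := eqVneq h 0.
    by rewrite addr0 mul0r !subrr normr0 mulr0.
  have := Hr h; rewrite /ball_/= sub0r normrN => /(_ hr h0).
  rewrite -normrN opprB.
  move: dE; rewrite /derive => ->.
  by rewrite E// normrM normfV ler_pdivrMl ?normr_gt0// [`|h| * _]mulrC.
Unshelve. all: by end_near.
Qed.

End CdiffRules.

(** * The complex exponential *)

Section ComplexExponential.
Context {R : realType}.
Implicit Types z w d : R[i].

Definition cexp z : R[i] :=
  (expR (complex.Re z))%:C * (cos (complex.Im z) +i* sin (complex.Im z)).

Lemma cexpD z w : cexp (z + w) = cexp z * cexp w.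
Proof.
case: z => a b; case: w => c d; rewrite /cexp /= expRD cosD sinD.
by apply/eqP; rewrite eq_complex/=; apply/andP; split; apply/eqP; ring.
Qed.

Lemma cexp0 : cexp 0 = 1.
Proof. by rewrite /cexp /= expR0 cos0 sin0 mul1r. Qed.

Lemma cabs_cexp z : cabs (cexp z) = expR (complex.Re z).
Proof.
rewrite /cexp cabsM cabs_real gtr0_norm ?expR_gt0//.
suff -> : cabs (cos (complex.Im z) +i* sin (complex.Im z)) = 1 by rewrite mulr1.
by rewrite /cabs /= cos2Dsin2 sqrtr1.
Qed.

(** Only the derivative at 0 needs the real functions exp, cos and sin; the
    addition formula carries it to every point. *)
Lemma cdiff_cexp0 : cdiff cexp 0 1.
Proof.
move=> e e0.
have D1 : rdiff expR 0 (1 : R).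
  by apply/rdiffP; rewrite -[X in is_derive _ _ _ X](@expR0 R); exact: is_derive_expR.
have D2 : rdiff cos 0 (0 : R).
  apply/rdiffP; rewrite -[X in is_derive _ _ _ X]oppr0 -[X in - X](@sin0 R).
  exact: is_derive_cos.
have D3 : rdiff sin 0 (1 : R).
  by apply/rdiffP; rewrite -[X in is_derive _ _ _ X](@cos0 R); exact: is_derive_sin.
have [e' [e8 e'1 e'2]] : exists e' : R, [/\ 0 < e', e' <= e / 16 & e' <= 1].
  exists (Num.min (e / 16) 1).
  by rewrite lt_min ltr01 divr_gt0// !ge_min !lexx orbT.
have [r1 r10 H1] := D1 _ e8; have [r2 r20 H2] := D2 _ e8.
have [r3 r30 H3] := D3 _ e8.
exists (Num.min (Num.min r1 r2) (Num.min r3 (Num.min 1 e'))).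
  by rewrite !lt_min r10 r20 r30 ltr01 e8.
case=> x y; rewrite !lt_min => /andP[/andP[h1 h2] /andP[h3 /andP[h4 h5]]].
have xh := cabs_Re (x +i* y); have yh := cabs_Im (x +i* y).
rewrite /= in xh yh.
have := H1 x (le_lt_trans xh h1).
have := H2 y (le_lt_trans yh h2).
have := H3 y (le_lt_trans yh h3).
rewrite !add0r expR0 cos0 sin0 mulr0 !subr0 !mulr1 cexp0.
set s := sin y - y; set c := cos y - 1; set u := expR x - 1 - x.
move=> Hs Hc Hu.
(* Up to the errors s, c and u of sin, cos and exp, only the product x y is
   left; it is of order two. *)
have -> : cexp (x +i* y) - 1 - (x +i* y) =
  (expR x * c + u) +i* (expR x * s + (u + x) * y).
  rewrite /cexp /= /c /u /s; apply/eqP; rewrite eq_complex/=.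
  by apply/andP; split; apply/eqP; ring.
apply: (le_trans (cabs_leD _)) => /=.
have e3 : expR x <= 3.
  have -> : expR x = u + 1 + x by rewrite /u; ring.
  have := ler_norm u; have := ler_norm x; have := ler_norm y.
  have u1 : `|u| <= 1 * `|x| by apply: (le_trans Hu); rewrite ler_wpM2r.
  by have x1 := le_lt_trans xh h4; clearbody u; clear -x1 u1; move: (ler_norm u) (ler_norm x); lra.
have ex0 := expR_gt0 x.
have T1 : `|expR x * c| <= 3 * (e' * `|y|).
  by rewrite normrM gtr0_norm// ler_pM// ltW.
have T2 : `|expR x * s| <= 3 * (e' * `|y|).
  by rewrite normrM gtr0_norm// ler_pM// ltW.
have T3 : `|(u + x) * y| <= `|u| + `|x| * `|y|.
  rewrite mulrDl; apply: (le_trans (ler_normD _ _)).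
  rewrite !normrM lerD2r ler_piMr// ltW//; apply: le_lt_trans yh h4.
have T4 : `|x| * `|y| <= e' * `|y|.
  by rewrite ler_wpM2r// ltW//; apply: le_lt_trans xh h5.
have A1 := ler_normD (expR x * c) u.
have A2 := ler_normD (expR x * s) ((u + x) * y).
have Y1 : e' * `|x| <= e / 16 * `|x| by rewrite ler_wpM2r.
have Y2 : e' * `|y| <= e / 16 * `|y| by rewrite ler_wpM2r.
have X : e / 16 * `|x| <= e / 16 * cabs (x +i* y) by rewrite ler_wpM2l// ltW// divr_gt0.
have Y : e / 16 * `|y| <= e / 16 * cabs (x +i* y) by rewrite ler_wpM2l// ltW// divr_gt0.
have F : `|expR x * c + u| + `|expR x * s + (u + x) * y| <= 16 * (e / 16 * cabs (x +i* y)).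
  by move: (cabs_ge0 (x +i* y)) => ?; have ? := mulr_ge0 (ltW e0) (cabs_ge0 (x +i* y)); lra.
by rewrite mulrA (mulrCA 16) divff ?mulr1// in F.
Qed.

Lemma cdiff_cexp z : cdiff cexp z (cexp z).
Proof.
have -> : cexp = (fun w => cexp z * cexp (- z + 1 * w)).
  by apply/funext => w; rewrite -cexpD mul1r addrA subrr add0r.
rewrite -[X in cdiff _ _ X]mulr1.
have -> : cexp z * cexp (- z + 1 * z) = cexp z by rewrite -cexpD; congr cexp; ring.
apply: cdiffZ; rewrite -[X in cdiff _ _ X](mul1r 1); apply: cdiff_affine.
by rewrite mul1r addNr; exact: cdiff_cexp0.
Qed.

End ComplexExponential.

(** * Integrals of complex-valued functions over a segment *)

Section SegmentIntegral.
Context {R : realType}.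
Implicit Types (a b c : R) (f g : R -> R).
Notation leb := (@lebesgue_measure R).

Lemma seg_integrable f a b : continuous f -> leb.-integrable `[a, b] (EFin \o f).
Proof.
move=> cf; apply: continuous_compact_integrable; first exact: segment_compact.
exact: continuous_subspaceT.
Qed.

Lemma seg_bound f a b (M : R) : continuous f -> a <= b ->
  (forall x, a <= x <= b -> `|f x| <= M) ->
  `|\int[leb]_(x in `[a, b]) f x| <= M * (b - a).
Proof.
move=> cf ab H; have mab : measurable `[a, b]%classic by exact: measurable_itv.
apply: le_trans; first by apply: le_normr_Rintegral => //; exact: seg_integrable.
have lab : leb `[a, b]%classic = (b - a)%:E.
  by rewrite lebesgue_measure_itv /= lte_fin; move: ab; rewrite le_eqVlt => /orP[/eqP ->|->]; rewrite ?ltxx ?subrr.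
have -> : M * (b - a) = \int[leb]_(x in `[a, b]) (cst M x).
  rewrite Rintegral_cst//; congr (_ * _); apply/esym; exact: (congr1 fine lab).
apply: le_Rintegral => //.
- by apply: seg_integrable => x; apply: continuous_comp; [exact: cf|exact: norm_continuous].
- by apply: seg_integrable => x; exact: cst_continuous.
Qed.

Lemma seg_add f a b c : continuous f -> a <= b -> b <= c ->
  \int[leb]_(x in `[a, c]) f x =
  \int[leb]_(x in `[a, b]) f x + \int[leb]_(x in `[b, c]) f x.
Proof.
move=> cf ab bc; apply/eqP; rewrite addrC -subr_eq; apply/eqP.
rewrite Rintegral_itvB; first last.
- by rewrite bnd_simp.
- by rewrite bnd_simp.
- exact: seg_integrable.
apply: Rintegral_itv_obnd_cbnd.
apply: (integrableS _ _ _ (seg_integrable b c cf)) => //; apply: subset_itvr => //; rewrite bnd_simp//.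
Qed.

End SegmentIntegral.

Section ComplexSegmentIntegral.
Context {R : realType}.
Implicit Types (a b c : R) (h k : R -> R[i]).
Notation leb := (@lebesgue_measure R).
Notation Re := complex.Re.
Notation Im := complex.Im.

(** Continuity of both components, which is what integrability of the
    components requires; [ccontP] is the form that composes with holomorphic
    functions. *)
Definition ccont h := continuous (fun x => Re (h x)) /\ continuous (fun x => Im (h x)).

Definition cint a b h : R[i] :=
  (\int[leb]_(x in `[a, b]) Re (h x)) +i* (\int[leb]_(x in `[a, b]) Im (h x)).

Lemma ccontP h : ccont h <-> forall x (e : R), 0 < e ->
  exists2 r : R, 0 < r & forall y, `|y| < r -> cabs (h (x + y) - h x) < e.
Proof.
split.
- move=> [c1 c2] x e e0; have e2 : 0 < e / 2 by rewrite divr_gt0.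
  have /cvgrPdist_lt /(_ _ e2) [r1 /= r10 H1] := c1 x.
  have /cvgrPdist_lt /(_ _ e2) [r2 /= r20 H2] := c2 x.
  exists (Num.min r1 r2); first by rewrite lt_min r10.
  move=> y; rewrite lt_min => /andP[y1 y2].
  have := H1 (x + y); rewrite /= opprD addrA subrr sub0r normrN => /(_ y1) {}H1.
  have := H2 (x + y); rewrite /= opprD addrA subrr sub0r normrN => /(_ y2) {}H2.
  apply: (le_lt_trans (cabs_leD _)); rewrite !raddfB /=.
  by rewrite distrC (distrC (Im _)); lra.
- move=> H; split=> x; apply/cvgrPdist_lt => e e0;
    have [r r0 Hr] := H x e e0; exists r => //= y xy; have := Hr (y - x);
    rewrite distrC xy addrCA subrr addr0 => /(_ isT) Hy.
  + by rewrite distrC -raddfB; apply: le_lt_trans Hy; exact: cabs_Re.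
  + by rewrite distrC -raddfB; apply: le_lt_trans Hy; exact: cabs_Im.
Qed.

Lemma ccont_cst (z : R[i]) : ccont (fun=> z).
Proof. by split=> x; exact: cst_continuous. Qed.

Lemma ccontD h k : ccont h -> ccont k -> ccont (fun x => h x + k x).
Proof.
move=> [h1 h2] [k1 k2]; split=> x.
- by under eq_fun do rewrite raddfD/=; apply: cvgD; [exact: h1|exact: k1].
- by under eq_fun do rewrite raddfD/=; apply: cvgD; [exact: h2|exact: k2].
Qed.

Lemma ReM (z w : R[i]) : Re (z * w) = Re z * Re w - Im z * Im w.
Proof. by case: z; case: w. Qed.

Lemma ImM (z w : R[i]) : Im (z * w) = Re z * Im w + Im z * Re w.
Proof. by case: z; case: w. Qed.

Lemma ccontM h k : ccont h -> ccont k -> ccont (fun x => h x * k x).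
Proof.
move=> [h1 h2] [k1 k2]; split=> x.
- under eq_fun do rewrite ReM; by apply: cvgB; apply: cvgM; first [exact: h1|exact: h2|exact: k1|exact: k2].
- under eq_fun do rewrite ImM; by apply: cvgD; apply: cvgM; first [exact: h1|exact: h2|exact: k1|exact: k2].
Qed.

Lemma ccontZ z h : ccont h -> ccont (fun x => z * h x).
Proof. by move=> ch; apply: ccontM => //; exact: ccont_cst. Qed.

Lemma ccontB h k : ccont h -> ccont k -> ccont (fun x => h x - k x).
Proof.
move=> ch ck; under eq_fun do rewrite -mulN1r; apply: ccontD => //; exact: ccontZ.
Qed.

Lemma cintD a b h k : ccont h -> ccont k ->
  cint a b (fun x => h x + k x) = cint a b h + cint a b k.
Proof.
move=> [h1 h2] [k1 k2]; rewrite /cint; simpc.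
by congr (_ +i* _); (under eq_Rintegral do rewrite raddfD/=);
  rewrite RintegralD//; exact: seg_integrable.
Qed.

Lemma cintZ a b z h : ccont h -> cint a b (fun x => z * h x) = z * cint a b h.
Proof.
move=> [h1 h2]; rewrite /cint; case: z => u v; simpc.
have S (f : R -> R) t : continuous f -> leb.-integrable `[a, b] (EFin \o (fun x => t * f x)).
  by move=> cf; apply: seg_integrable => x; apply: cvgM; [exact: cvg_cst|exact: cf].
congr (_ +i* _).
- under eq_Rintegral do rewrite ReM/=.
  by rewrite RintegralB ?RintegralZl//; first [exact: seg_integrable|exact: S].
- under eq_Rintegral do rewrite ImM/=.
  by rewrite RintegralD ?RintegralZl//; first [exact: seg_integrable|exact: S].
Qed.

Lemma cintB a b h k : ccont h -> ccont k ->
  cint a b (fun x => h x - k x) = cint a b h - cint a b k.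
Proof.
move=> ch ck; have -> : (fun x => h x - k x) = (fun x => h x + (-1) * k x).
  by apply/funext => x; rewrite mulN1r.
by rewrite cintD ?cintZ ?mulN1r//; exact: ccontZ.
Qed.

Lemma cint_add a b c h : ccont h -> a <= b -> b <= c ->
  cint a c h = cint a b h + cint b c h.
Proof.
move=> [h1 h2] ab bc; rewrite /cint; simpc.
by rewrite (seg_add h1 ab bc) (seg_add h2 ab bc).
Qed.

(** The factor 2 comes from bounding the two components separately; no sharp
    constant matters in what follows. *)
Lemma cint_bound a b h (M : R) : ccont h -> a <= b ->
  (forall x, a <= x <= b -> cabs (h x) <= M) ->
  cabs (cint a b h) <= 2 * M * (b - a).
Proof.
move=> [h1 h2] ab H; apply: (le_trans (cabs_leD _)) => /=.
have L1 := seg_bound h1 ab (fun x xab => le_trans (cabs_Re _) (H x xab)).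
have L2 := seg_bound h2 ab (fun x xab => le_trans (cabs_Im _) (H x xab)).
by rewrite -mulrA mulr2n mulrDl mul1r lerD.
Qed.

Lemma eq_cint a b h k : (forall x, a <= x <= b -> h x = k x) ->
  cint a b h = cint a b k.
Proof.
by move=> H; rewrite /cint; congr (_ +i* _); apply: eq_Rintegral => x;
  rewrite inE/= in_itv/= => /H ->.
Qed.

End ComplexSegmentIntegral.

(** * Goursat's bisection argument *)

Section Bisection.
Context {R : realType}.

Lemma lt_pow2 (x : R) : exists n : nat, x < 2 ^+ n.
Proof.
have [x0|x0] := ltP x 0; first by exists 0; rewrite expr0; apply: lt_trans x0 _.
exists (Num.bound x); apply: (lt_trans (archi_boundP x0)).
by rewrite -natrX ltr_nat ltn_expl.
Qed.

(** Goursat's argument for an additive function of rectangles.  If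
    |J| > e size^2 on a rectangle, the same holds on one of its quarters, since
    the four quarters have half the size; the nested quarters shrink to a point,
    where the local hypothesis is contradicted. *)
Lemma bisection (J : R -> R -> R -> R -> R[i]) :
  (forall a m b c d, a <= m -> m <= b -> c <= d ->
     J a b c d = J a m c d + J m b c d) ->
  (forall a b c m d, a <= b -> c <= m -> m <= d ->
     J a b c d = J a b c m + J a b m d) ->
  (forall p q (e : R), 0 < e -> exists2 r : R, 0 < r & forall a b c d,
     a <= p -> p <= b -> c <= q -> q <= d -> b - a < r -> d - c < r ->
     cabs (J a b c d) <= e * (b - a + (d - c)) ^+ 2) ->
  forall a b c d, a <= b -> c <= d -> J a b c d = 0.
Proof.
move=> JH JV JL a0 b0 c0 d0 ab0 cd0; apply/eqP; rewrite -cabs_eq0.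
apply/negPn/negP => J0.
have Jpos : 0 < cabs (J a0 b0 c0 d0) by rewrite lt_def J0 cabs_ge0.
pose S0 := b0 - a0 + (d0 - c0).
have S0p : 0 < S0 ^+ 2 + 1 by rewrite ltr_wpDl// sqr_ge0.
(* The + 1 makes the inequality |J| > e S0^2 strict, also when S0 = 0. *)
pose e := cabs (J a0 b0 c0 d0) / (S0 ^+ 2 + 1).
have e0 : 0 < e by rewrite divr_gt0.
pose P (s : (R * R) * (R * R)) := [/\ s.1.1 <= s.1.2, s.2.1 <= s.2.2 &
  e * (s.1.2 - s.1.1 + (s.2.2 - s.2.1)) ^+ 2 < cabs (J s.1.1 s.1.2 s.2.1 s.2.2)].
have P0 : P ((a0, b0), (c0, d0)).
  split => //=; rewrite /e mulrAC ltr_pdivrMr// ltr_pM2l// -/S0.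
  by rewrite ltrDl.
pose N (s s' : {s | P s}) := let x := sval s in let y := sval s' in
  [/\ x.1.1 <= y.1.1 /\ y.1.2 <= x.1.2, x.2.1 <= y.2.1 /\ y.2.2 <= x.2.2,
     y.1.2 - y.1.1 = (x.1.2 - x.1.1) / 2 & y.2.2 - y.2.1 = (x.2.2 - x.2.1) / 2].
have step : forall s, exists s', N s s'.
  case=> [[[a b] [c d]]] [/= ab cd bad].
  pose m := (a + b) / 2; pose n := (c + d) / 2.
  have [am mb] : a <= m /\ m <= b by rewrite /m; split; lra.
  have [cn nd] : c <= n /\ n <= d by rewrite /n; split; lra.
  have JE : J a b c d = J a m c n + J a m n d + (J m b c n + J m b n d).
    by rewrite (JH a m b c d)// (JV a m c n d)// (JV m b c n d).
  pose S := b - a + (d - c).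
  have [Q|Q] : (exists2 s : (R * R) * (R * R), P s & [/\ a <= s.1.1 /\ s.1.2 <= b, c <= s.2.1 /\ s.2.2 <= d,
     s.1.2 - s.1.1 = (b - a) / 2 & s.2.2 - s.2.1 = (d - c) / 2]) \/
     [/\ cabs (J a m c n) <= e * (S / 2) ^+ 2, cabs (J a m n d) <= e * (S / 2) ^+ 2,
       cabs (J m b c n) <= e * (S / 2) ^+ 2 & cabs (J m b n d) <= e * (S / 2) ^+ 2].
  - have sub (a' b' c' d' : R) : a' <= b' -> c' <= d' -> a <= a' /\ b' <= b -> c <= c' /\ d' <= d ->
      b' - a' = (b - a) / 2 -> d' - c' = (d - c) / 2 ->
      (exists2 s : (R * R) * (R * R), P s & [/\ a <= s.1.1 /\ s.1.2 <= b, c <= s.2.1 /\ s.2.2 <= d,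
       s.1.2 - s.1.1 = (b - a) / 2 & s.2.2 - s.2.1 = (d - c) / 2]) \/
      cabs (J a' b' c' d') <= e * (S / 2) ^+ 2.
      move=> ab' cd' aa cc E1 E2.
      have [L|L] := leP (cabs (J a' b' c' d')) (e * (S / 2) ^+ 2); [by right|left].
      exists ((a', b'), (c', d')) => //; split => //=; rewrite E1 E2.
      by rewrite -mulrDl.
    have [?|I1] := sub a m c n am cn (conj (lexx _) mb) (conj (lexx _) nd) ltac:(rewrite /m; lra) ltac:(rewrite /n; lra); first by left.
    have [?|I2] := sub a m n d am nd (conj (lexx _) mb) (conj cn (lexx _)) ltac:(rewrite /m; lra) ltac:(rewrite /n; lra); first by left.
    have [?|I3] := sub m b c n mb cn (conj am (lexx _)) (conj (lexx _) nd) ltac:(rewrite /m; lra) ltac:(rewrite /n; lra); first by left.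
    have [?|I4] := sub m b n d mb nd (conj am (lexx _)) (conj cn (lexx _)) ltac:(rewrite /m; lra) ltac:(rewrite /n; lra); first by left.
    by right.
  - by case: Q => s Ps Hs; exists (exist _ s Ps).
  - exfalso; case: Q => I1 I2 I3 I4.
    have L1 := cabsD (J a m c n + J a m n d) (J m b c n + J m b n d).
    have L2 := cabsD (J a m c n) (J a m n d).
    have L3 := cabsD (J m b c n) (J m b n d).
    move: bad; rewrite JE -/S ltNge => /negP; apply.
    have -> : e * S ^+ 2 = 4 * (e * (S / 2) ^+ 2) by field.
    lra.
have [g Hg] := choice step.
pose s n := iter n g (exist _ _ P0).
pose a n := (sval (s n)).1.1; pose b n := (sval (s n)).1.2.
pose c n := (sval (s n)).2.1; pose d n := (sval (s n)).2.2.
have Ns n : N (s n) (s n.+1) by exact: Hg.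
have ab n : a n <= b n by have [] := svalP (s n).
have cd n : c n <= d n by have [] := svalP (s n).
have nest (u v : nat -> R) : (forall n, u n <= v n) -> (forall n, u n <= u n.+1) -> (forall n, v n.+1 <= v n) ->
  exists p, forall n, u n <= p /\ p <= v n.
  move=> uv uu vv.
  have ui : {homo u : x y / (x <= y)%N >-> x <= y} by apply: homo_leq => //; exact: le_trans.
  have vi : {homo v : x y / (x <= y)%N >-> y <= x} by apply: homo_leq => // x y z xy yz; exact: le_trans yz xy.
  have uvn n k : u n <= v k.
    apply: (le_trans (ui _ _ (leq_maxl n k))); apply: (le_trans (uv _)).
    exact: (vi _ _ (leq_maxr n k)).
  exists (sup (range u)) => n; split.
  - apply: ub_le_sup; last by exists n.
    by exists (v 0) => _ [k _ <-].
  - apply: ge_sup; first by exists (u 0); exists 0.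
    by move=> _ [k _ <-].
have [p Hp] := nest a b ab (fun n => let: And4 (conj h _) _ _ _ := Ns n in h) (fun n => let: And4 (conj _ h) _ _ _ := Ns n in h).
have [q Hq] := nest c d cd (fun n => let: And4 _ (conj h _) _ _ := Ns n in h) (fun n => let: And4 _ (conj _ h) _ _ := Ns n in h).
have wab n : b n - a n = (b0 - a0) / 2 ^+ n.
  elim: n => [|n IH]; first by rewrite expr0 divr1.
  by have [_ _ -> _] := Ns n; rewrite -/(a n) -/(b n) IH exprSr -mulrA invfM.
have wcd n : d n - c n = (d0 - c0) / 2 ^+ n.
  elim: n => [|n IH]; first by rewrite expr0 divr1.
  by have [_ _ _ ->] := Ns n; rewrite -/(c n) -/(d n) IH exprSr -mulrA invfM.
have [r r0 Hr] := JL p q e e0.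
have [n Hn] := lt_pow2 (S0 / r).
have n2 : 0 < 2 ^+ n :> R by rewrite exprn_gt0.
have Sr : S0 / 2 ^+ n < r by rewrite ltr_pdivrMr// mulrC -ltr_pdivrMr.
have [_ _] := svalP (s n); rewrite ltNge => /negP; apply; apply: Hr.
- by have [] := Hp n.
- by have [] := Hp n.
- by have [] := Hq n.
- by have [] := Hq n.
- rewrite -/(b n) -/(a n) wab; apply: le_lt_trans Sr.
  by rewrite ler_pM2r ?invr_gt0// /S0 lerDl subr_ge0.
- rewrite -/(d n) -/(c n) wcd; apply: le_lt_trans Sr.
  by rewrite ler_pM2r ?invr_gt0// /S0 lerDr subr_ge0.
Qed.

End Bisection.

(** * Independence of the square contour *)

Section SquareContour.
Context {R : realType}.
Notation Re := complex.Re.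
Notation Im := complex.Im.
Notation leb := (@lebesgue_measure R).

(** The side 1 + i t, |t| <= 1, of the square centred at 0 with corners
    +-1 +- i; [ray s] dilates it by e^s.  The other three sides are its images
    under multiplication by i. *)
Definition side (t : R) : R[i] := 1 +i* t.
Definition side_inv (t : R) : R[i] := ((1 + t ^+ 2)^-1)%:C * (1 -i* t).
Definition ray (s t : R) : R[i] := (expR s)%:C * side t.

Lemma side_neq0 t : side t != 0.
Proof. by rewrite eq_complex/= oner_eq0. Qed.

Lemma side_invE t : side_inv t = (side t)^-1.
Proof.
apply: (mulIf (side_neq0 t)); rewrite mulVf ?side_neq0// /side_inv /side.
have t1 : 1 + t ^+ 2 != 0 by rewrite gt_eqF// ltr_pwDl// sqr_ge0.
by simpc; apply/eqP; rewrite eq_complex/=; apply/andP; split; apply/eqP; field.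
Qed.

Lemma ray_neq0 s t : ray s t != 0.
Proof. by rewrite mulf_neq0 ?side_neq0// eq_complex/= eqxx andbT gt_eqF// expR_gt0. Qed.

Lemma cabs_side_ge1 t : 1 <= cabs (side t).
Proof. by apply: le_trans (cabs_Re _); rewrite /= normr1. Qed.

Lemma cabs_side_le t : cabs (side t) <= 1 + `|t|.
Proof. by apply: (le_trans (cabs_leD _)); rewrite /= normr1. Qed.

Lemma cabs_side_inv t : cabs (side_inv t) <= 1.
Proof.
rewrite side_invE cabsV invf_le1 ?cabs_side_ge1//.
by apply: lt_le_trans (cabs_side_ge1 t).
Qed.

Lemma cabs_ray_le s t : `|t| <= 1 -> cabs (ray s t) <= 2 * expR s.
Proof.
move=> t1; rewrite /ray cabsM cabs_real gtr0_norm ?expR_gt0// mulrC.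
rewrite ler_pM2r ?expR_gt0//; apply: (le_trans (cabs_side_le t)); lra.
Qed.

Lemma ccont_side_inv : ccont side_inv.
Proof.
have t1 (t : R) : 1 + t ^+ 2 != 0 by rewrite gt_eqF// ltr_pwDl// sqr_ge0.
have C : continuous (fun t : R => (1 + t ^+ 2)^-1).
  move=> t; apply: cvgV => //; apply: cvgD; first exact: cvg_cst.
  by rewrite expr2; under eq_fun do rewrite expr2; apply: cvgM.
apply: ccontM; split=> t /=; try exact: cst_continuous; first exact: C.
by apply: cvgN.
Qed.

Lemma ccont_ray_s t : ccont (fun s => ray s t).
Proof.
apply: ccontM; last exact: ccont_cst.
by split=> s /=; [exact: continuous_expR|exact: cst_continuous].
Qed.

Lemma ccont_ray_t s : ccont (fun t => ray s t).
Proof.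
apply: ccontZ; split=> t /=; first exact: cst_continuous.
exact: cvg_id.
Qed.

Lemma ccont_comp (G : R[i] -> R[i]) (h : R -> R[i]) : ccont h ->
  (forall x (e : R), 0 < e -> exists2 r : R, 0 < r & forall u, cabs u < r -> cabs (G (h x + u) - G (h x)) < e) ->
  ccont (fun x => G (h x)).
Proof.
move=> /ccontP ch cG; apply/ccontP => x e e0.
have [r r0 Hr] := cG x e e0; have [q q0 Hq] := ch x r r0.
exists q => // y yq; have := Hr _ (Hq y yq).
by rewrite addrCA subrr addr0.
Qed.

Lemma int_expR (a b : R) : a <= b -> \int[leb]_(s in `[a, b]) expR s = expR b - expR a.
Proof.
rewrite le_eqVlt => /orP[/eqP ->|ab]; first by rewrite set_itv1 Rintegral_set1 subrr.
rewrite /Rintegral (continuous_FTC2 (F := expR))//.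
- by apply: continuous_subspaceT => x; exact: continuous_expR.
- split.
  + by move=> x _; exact: derivable_expR.
  + by apply: cvg_at_right_filter; exact: continuous_expR.
  + by apply: cvg_at_left_filter; exact: continuous_expR.
- by move=> x _; rewrite derive1E; have [_ ->] := is_derive_expR x.
Qed.

Lemma cint_expR (a b : R) : a <= b -> cint a b (fun s => (expR s)%:C) = (expR b - expR a)%:C.
Proof.
move=> ab; rewrite /cint/= int_expR//; congr (_ +i* _).
by rewrite Rintegral_cst// mul0r.
Qed.

Lemma cint_cst (a b : R) (z : R[i]) : a <= b -> cint a b (fun=> z) = (b - a)%:C * z.
Proof.
move=> ab.
have lab : leb `[a, b]%classic = (b - a)%:E.
  by rewrite lebesgue_measure_itv /= lte_fin; move: ab; rewrite le_eqVlt => /orP[/eqP ->|->]; rewrite ?ltxx ?subrr.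
have E (r : R) : \int[leb]_(s in `[a, b]) (cst r s) = (b - a) * r.
  rewrite Rintegral_cst// mulrC; congr (_ * _); exact: (congr1 fine lab).
by rewrite /cint (E (Re z)) (E (Im z)); case: z => u v; simpc.
Qed.

Lemma expR_lip (p s E : R) : expR s <= E -> expR p <= E -> `|expR s - expR p| <= E * `|s - p|.
Proof.
wlog ps : p s / p <= s.
  move=> H sE pE; have [/H|/ltW/H] := leP p s; first exact.
  by rewrite distrC (distrC s); exact.
move=> sE _; rewrite ger0_norm ?subr_ge0 ?ler_expR// ger0_norm ?subr_ge0//.
have := expR_ge1Dx (p - s); rewrite expRD expRN => H.
have s0 := expR_gt0 s.
apply: (@le_trans _ _ (expR s * (s - p))); last by rewrite ler_wpM2r// subr_ge0.
have -> : expR p = expR s * (expR p / expR s) by field; rewrite gt_eqF.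
rewrite -{1}(mulr1 (expR s)) -mulrBr ler_pM2l//; lra.
Qed.

(** The constant is local in s and independent of t, so that the error of
    the linear approximation of G can be measured in the coordinates (s, t). *)
Lemma ray_lip (p q s t : R) : `|s - p| < 1 -> cabs (ray s t - ray p q) <=
   expR (p + 1) * (1 + `|q|) * (`|s - p| + `|t - q|).
Proof.
move=> sp; have [sp1 sp2] : s <= p + 1 /\ p <= p + 1.
  by move: sp; rewrite ltr_norml => /andP[? ?]; split; lra.
have q0 := normr_ge0 q.
set E := expR (p + 1).
have sE : expR s <= E by rewrite ler_expR.
have pE : expR p <= E by rewrite ler_expR.
have -> : ray s t - ray p q = (expR s - expR p)%:C * side q + (expR s * (t - q))%:C * 'i.
  by rewrite /ray /side; simpc; apply/eqP; rewrite eq_complex/=; apply/andP; split; apply/eqP; ring.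
apply: (le_trans (cabsD _ _)); rewrite !cabsM !cabs_real cabs_i mulr1.
have L1 := expR_lip sE pE.
have L2 := cabs_side_le q.
rewrite (mulrDr (E * _)); apply: lerD.
  rewrite mulrAC; apply: ler_pM => //; exact: cabs_ge0.
rewrite normrM gtr0_norm ?expR_gt0//; apply: ler_wpM2r => //.
rewrite -[leLHS]mulr1; apply: ler_pM => //; lra.
Qed.

Section Goursat.
Variable G : R[i] -> R[i].
Hypothesis Gd : forall u, u != 0 -> exists d, cdiff G u d.

Lemma contG u (e : R) : u != 0 -> 0 < e -> exists2 r : R, 0 < r & forall h, cabs h < r -> cabs (G (u + h) - G u) < e.
Proof. by move=> /Gd [d /cdiff_cont]; exact. Qed.

Lemma ccontG_s t : ccont (fun s => G (ray s t)).
Proof.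
by apply: (ccont_comp (ccont_ray_s t)) => s e; apply: contG; exact: ray_neq0.
Qed.

Lemma ccontG_t s : ccont (fun t => G (ray s t)).
Proof.
by apply: (ccont_comp (ccont_ray_t s)) => t e; apply: contG; exact: ray_neq0.
Qed.

(** The integral of G(u) du / u along the boundary of the rectangle
    [a, b] x [c, d] of the (s, t) plane, for u = e^s (1 + i t): there
    du / u = ds + i dt / (1 + i t). *)
Definition boundary_int a b c d : R[i] :=
  cint a b (fun s => G (ray s c) - G (ray s d)) +
  'i * cint c d (fun t => side_inv t * (G (ray b t) - G (ray a t))).

Lemma boundary_int_splitH a m b c d : a <= m -> m <= b -> c <= d ->
  boundary_int a b c d = boundary_int a m c d + boundary_int m b c d.
Proof.
move=> am mb cd; rewrite /boundary_int (cint_add (b := m))//; last by apply: ccontB; exact: ccontG_s.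
rewrite addrACA -mulrDr -cintD; try by apply: ccontM; [exact: ccont_side_inv|apply: ccontB; exact: ccontG_t].
congr (_ + _ * _); apply: eq_cint => t _; ring.
Qed.

Lemma boundary_int_splitV a b c m d : a <= b -> c <= m -> m <= d ->
  boundary_int a b c d = boundary_int a b c m + boundary_int a b m d.
Proof.
move=> ab cm md; rewrite /boundary_int (cint_add (a := c) (b := m))//; last first.
  by apply: ccontM; [exact: ccont_side_inv|apply: ccontB; exact: ccontG_t].
rewrite addrACA -mulrDr -cintD; try by apply: ccontB; exact: ccontG_s.
congr (_ + _ * _); apply: eq_cint => t _; ring.
Qed.

(** The constant and the linear part of G at the centre contribute 0
    exactly, because 1 and u have primitives for the form du / u away from 0;
    the remainder is small compared with the size of the rectangle. *)
Lemma boundary_int_local p q (e : R) : 0 < e -> exists2 r : R, 0 < r & forall a b c d,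
     a <= p -> p <= b -> c <= q -> q <= d -> b - a < r -> d - c < r ->
     cabs (boundary_int a b c d) <= e * (b - a + (d - c)) ^+ 2.
Proof.
move=> e0; have [d0 Hd] := Gd (ray_neq0 p q).
pose K := expR (p + 1) * (1 + `|q|).
have K0 : 0 < K by rewrite mulr_gt0 ?expR_gt0// ltr_pwDl.
have K4 : 0 < 4 * K by rewrite mulr_gt0.
have [r r0 Hr] := Hd (e / (4 * K)) (divr_gt0 e0 K4).
exists (Num.min 1 (r / (4 * K))); first by rewrite lt_min ltr01 divr_gt0// mulr_gt0.
move=> a b c d ap pb cq qd; rewrite !lt_min => /andP[ba1 bar] /andP[dc1 dcr].
pose S := b - a + (d - c).
have S0 : 0 <= S by rewrite /S; lra.
pose rm s t := G (ray s t) - (G (ray p q) + (ray s t - ray p q) * d0).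
have near s t : a <= s <= b -> c <= t <= d -> cabs (ray s t - ray p q) <= K * S.
  move=> /andP[? ?] /andP[? ?].
  have s1 : `|s - p| <= b - a by rewrite ler_norml; apply/andP; split; lra.
  have t1 : `|t - q| <= d - c by rewrite ler_norml; apply/andP; split; lra.
  apply: (le_trans (ray_lip _ _ _)); first by apply: le_lt_trans ba1.
  by rewrite ler_pM2l// lerD.
have rmb s t : a <= s <= b -> c <= t <= d -> cabs (rm s t) <= e / 4 * S.
  move=> sab tcd; have N := near s t sab tcd.
  have := Hr (ray s t - ray p q).
  have -> : ray p q + (ray s t - ray p q) = ray s t by ring.
  have -> : G (ray s t) - G (ray p q) - (ray s t - ray p q) * d0 = rm s t by rewrite /rm; ring.
  move=> H; apply: (le_trans (H _)).
    apply: (le_lt_trans N); rewrite mulrC -ltr_pdivlMr//.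
    have : r / (4 * K) * 2 = r / K / 2 by field; rewrite gt_eqF.
    have : 0 < r / K by rewrite divr_gt0.
    rewrite /S; lra.
  apply: (@le_trans _ _ (e / (4 * K) * (K * S))).
    by rewrite ler_wpM2l// divr_ge0// ?ltW// mulr_gt0.
  by rewrite le_eqVlt; apply/orP; left; apply/eqP; field; rewrite gt_eqF.
have crs t : ccont (fun s => rm s t).
  apply: ccontB; first exact: ccontG_s; apply: ccontD; first exact: ccont_cst.
  by apply: ccontM; [apply: ccontB; [exact: ccont_ray_s|]|]; exact: ccont_cst.
have crt s : ccont (fun t => rm s t).
  apply: ccontB; first exact: ccontG_t; apply: ccontD; first exact: ccont_cst.
  by apply: ccontM; [apply: ccontB; [exact: ccont_ray_t|]|]; exact: ccont_cst.
have ab : a <= b by lra.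
have cd : c <= d by lra.
have -> : boundary_int a b c d = cint a b (fun s => rm s c - rm s d) +
  'i * cint c d (fun t => side_inv t * (rm b t - rm a t)).
  rewrite /boundary_int.
  have -> : cint a b (fun s => G (ray s c) - G (ray s d)) =
    cint a b (fun s => rm s c - rm s d) + 'i * (c - d)%:C * d0 * (expR b - expR a)%:C.
    rewrite -cint_expR// -cintZ; last by split=> x /=; [exact: continuous_expR|exact: cst_continuous].
    rewrite -cintD; first last.
    - by apply: ccontZ; split=> x /=; [exact: continuous_expR|exact: cst_continuous].
    - by apply: ccontB; exact: crs.
    apply: eq_cint => s _; rewrite /rm.
    have -> : G (ray s c) - (G (ray p q) + (ray s c - ray p q) * d0) - (G (ray s d) - (G (ray p q) + (ray s d - ray p q) * d0)) =
      G (ray s c) - G (ray s d) - (ray s c - ray s d) * d0 by ring.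
    have -> : ray s c - ray s d = 'i * (c - d)%:C * (expR s)%:C.
      by rewrite /ray /side; simpc; apply/eqP; rewrite eq_complex/=; apply/andP; split; apply/eqP; ring.
    by ring.
  have -> : cint c d (fun t => side_inv t * (G (ray b t) - G (ray a t))) =
    cint c d (fun t => side_inv t * (rm b t - rm a t)) + (d - c)%:C * (d0 * (expR b - expR a)%:C).
    rewrite -cint_cst// -cintD; first last.
    - exact: ccont_cst.
    - by apply: ccontM; [exact: ccont_side_inv|apply: ccontB; exact: crt].
    apply: eq_cint => t _; rewrite /rm.
    have -> : G (ray b t) - (G (ray p q) + (ray b t - ray p q) * d0) - (G (ray a t) - (G (ray p q) + (ray a t - ray p q) * d0)) =
      G (ray b t) - G (ray a t) - (ray b t - ray a t) * d0 by ring.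
    have -> : ray b t - ray a t = (expR b - expR a)%:C * side t.
      by rewrite /ray /side; simpc; apply/eqP; rewrite eq_complex/=; apply/andP; split; apply/eqP; ring.
    rewrite side_invE; field; exact: side_neq0.
  rewrite !rmorphB/=; ring.
have B1 : cabs (cint a b (fun s => rm s c - rm s d)) <= 2 * (e / 2 * S) * (b - a).
  apply: cint_bound => //; first by apply: ccontB; exact: crs.
  move=> s sab; apply: (le_trans (cabsD _ _)); rewrite cabsN.
  have := rmb s c sab; have := rmb s d sab; rewrite !lexx cd => /(_ isT) ? /(_ isT) ?; lra.
have B2 : cabs (cint c d (fun t => side_inv t * (rm b t - rm a t))) <= 2 * (e / 2 * S) * (d - c).
  apply: cint_bound => //; first by apply: ccontM; [exact: ccont_side_inv|apply: ccontB; exact: crt].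
  move=> t tcd; rewrite cabsM; apply: (@le_trans _ _ (1 * cabs (rm b t - rm a t))).
    by rewrite ler_wpM2r ?cabs_ge0 ?cabs_side_inv.
  rewrite mul1r; apply: (le_trans (cabsD _ _)); rewrite cabsN.
  have := rmb a t; have := rmb b t; rewrite !lexx ab tcd => /(_ isT isT) ? /(_ isT isT) ?; lra.
apply: (le_trans (cabsD _ _)); rewrite cabsM cabs_i mul1r.
apply: (le_trans (lerD B1 B2)); rewrite -mulrDr -/S expr2.
by rewrite le_eqVlt; apply/orP; left; apply/eqP; field.
Qed.

Lemma boundary_int_eq0 a b c d : a <= b -> c <= d -> boundary_int a b c d = 0.
Proof. exact: (bisection boundary_int_splitH boundary_int_splitV boundary_int_local). Qed.

Hypothesis Gi : forall u, G ('i * u) = G u.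

(** When G is invariant under u |-> i u, the integrals along the two edges
    t = -1 and t = 1 cancel, as e^s (1 + i) = i e^s (1 - i).  What remains is
    the difference of the integrals along two concentric squares. *)
Lemma square_mean_indep a b :
  cint (-1) 1 (fun t => side_inv t * G (ray a t)) = cint (-1) 1 (fun t => side_inv t * G (ray b t)).
Proof.
wlog ab : a b / a <= b.
  move=> H; have [/H|/ltW/H/esym] := leP a b; exact.
have N11 : -1 <= 1 :> R by lra.
have := @boundary_int_eq0 a b (-1) 1 ab N11.
have E : cint a b (fun s => G (ray s (-1)) - G (ray s 1)) = 0.
  rewrite (eq_cint (k := fun=> 0)) ?cint_cst ?mulr0// => s _.
  rewrite -[G (ray s (-1))]Gi.
  have -> : 'i * ray s (-1) = ray s 1.
    by rewrite /ray /side; simpc; apply/eqP; rewrite eq_complex/=; apply/andP; split; apply/eqP; ring.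
  exact: subrr.
rewrite /boundary_int E add0r => /eqP; rewrite mulf_eq0 -cabs_eq0 cabs_i oner_eq0/=.
have -> : (fun t => side_inv t * (G (ray b t) - G (ray a t))) = (fun t => side_inv t * G (ray b t) - side_inv t * G (ray a t)).
  by apply/funext => t; rewrite mulrBr.
rewrite cintB; try by apply: ccontM; [exact: ccont_side_inv|exact: ccontG_t].
by rewrite subr_eq0 => /eqP/esym; exact.
Qed.

(** A quarter of the integral of du / u around 0, divided by i; that is,
    pi / 2.  The lower bound of [Re_kappa] is all that the estimates use. *)
Definition kappa : R[i] := cint (-1) 1 side_inv.

(** Cauchy's formula at 0 for rotation-invariant functions: the integral does
    not depend on the square, and small squares only see the limit at 0. *)
Theorem square_mean (L : R[i]) s :
  (forall e : R, 0 < e -> exists2 r : R, 0 < r & forall u, u != 0 -> cabs u < r -> cabs (G u - L) <= e) ->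
  cint (-1) 1 (fun t => side_inv t * G (ray s t)) = L * kappa.
Proof.
move=> GL; apply/eqP; rewrite -subr_eq0 -cabs_eq0 eq_le cabs_ge0 andbT.
apply/ler_addgt0Pl => e e0; rewrite addr0.
have [r r0 Hr] := GL (e / 4) ltac:(lra).
pose a := ln (r / 4).
have r4 : expR a = r / 4 by rewrite lnK// posrE divr_gt0.
rewrite (square_mean_indep s a) -cintZ; last exact: ccont_side_inv.
have cS : ccont (fun t => side_inv t * G (ray a t)).
  by apply: ccontM; [exact: ccont_side_inv|exact: ccontG_t].
rewrite -cintB//; last by apply: ccontZ; exact: ccont_side_inv.
have N11 : -1 <= 1 :> R by lra.
apply: (le_trans (cint_bound (M := e / 4) _ N11 _)); last by rewrite le_eqVlt; apply/orP; left; apply/eqP; field.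
  by apply: ccontB => //; apply: ccontZ; exact: ccont_side_inv.
move=> t t1.
have -> : side_inv t * G (ray a t) - L * side_inv t = side_inv t * (G (ray a t) - L) by ring.
rewrite cabsM; apply: (@le_trans _ _ (1 * cabs (G (ray a t) - L))).
  by rewrite ler_wpM2r ?cabs_ge0 ?cabs_side_inv.
rewrite mul1r; apply: Hr; first exact: ray_neq0.
have t1' : `|t| <= 1 by rewrite ler_norml.
apply: (le_lt_trans (cabs_ray_le a t1')); rewrite r4; lra.
Qed.

End Goursat.

Lemma Re_kappa : 1 <= Re kappa.
Proof.
rewrite /kappa /cint/=.
have c1 := (@ccont_side_inv).1.
have lab : leb `[-1, 1]%classic = 2%:E.
  by rewrite lebesgue_measure_itv /= lte_fin ifT; [congr EFin; ring|lra].
rewrite [leLHS](_ : 1 = \int[leb]_(t in `[-1, 1]) (cst (2^-1) t)); last first.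
  by rewrite Rintegral_cst// -[LHS](mulVf (x := 2))//; congr (_ * _); apply/esym; exact: (congr1 fine lab).
apply: le_Rintegral => //.
- by apply: seg_integrable => x; exact: cst_continuous.
- exact: seg_integrable.
- move=> t /=; rewrite in_itv/= => /andP[t1 t2]; rewrite mul0r subr0 mulr1.
  rewrite lef_pV2 ?posrE//; last by rewrite ltr_pwDl// sqr_ge0.
  nra.
Qed.

Lemma cabs_kappa : 1 <= cabs kappa.
Proof. by apply: (le_trans Re_kappa); apply: le_trans (cabs_Re _); exact: ler_norm. Qed.

End SquareContour.

(** * Mean value formulas and Cauchy estimates *)

Section CauchyEstimates.
Context {R : realType}.
Notation Re := complex.Re.
Notation Im := complex.Im.
Implicit Types (z w u h : R[i]) (f : R[i] -> R[i]).

Definition cdifferentiable f u := exists d, cdiff f u d.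

Definition eps_cont f := forall z (e : R), 0 < e ->
  exists2 r : R, 0 < r & forall h, cabs h < r -> cabs (f (z + h) - f z) < e.

Lemma cdifferentiableD f g u : cdifferentiable f u -> cdifferentiable g u -> cdifferentiable (fun w => f w + g w) u.
Proof. by move=> [d fd] [e ge]; exists (d + e); exact: cdiffD. Qed.

Lemma cdifferentiableZ f c u : cdifferentiable f u -> cdifferentiable (fun w => c * f w) u.
Proof. by move=> [d fd]; exists (c * d); exact: cdiffZ. Qed.

Lemma cdifferentiableM f g u : cdifferentiable f u -> cdifferentiable g u -> cdifferentiable (fun w => f w * g w) u.
Proof. by move=> [d fd] [e ge]; eexists; exact: cdiffM fd ge. Qed.

Lemma cdifferentiable_affine f a b u : cdifferentiable f (a + b * u) -> cdifferentiable (fun w => f (a + b * w)) u.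
Proof. by move=> [d fd]; exists (b * d); exact: cdiff_affine. Qed.

(** The four rotations of u are listed explicitly because [rot_box_integral]
    treats them one by one. *)
Definition rot_sum f z u :=
  f (z + 1 * u) + f (z + 'i * u) + (f (z + (-1) * u) + f (z + (- 'i) * u)).

(** The weights i^-k kill the constant term of f at z and keep 4 times the
    linear one, so that this function has a limit at u = 0. *)
Definition rot_quot f z u :=
  (f (z + 1 * u) + (- 'i) * f (z + 'i * u) +
   ((-1) * f (z + (-1) * u) + 'i * f (z + (- 'i) * u))) * u^-1.

Lemma mul_ii : 'i * 'i = -1 :> R[i].
Proof. by simpc. Qed.

Lemma i_neq0 : 'i != 0 :> R[i].
Proof. by rewrite -cabs_eq0 cabs_i oner_eq0. Qed.

Lemma rot_sum_i f z u : rot_sum f z ('i * u) = rot_sum f z u.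
Proof.
rewrite /rot_sum.
have -> : z + 1 * ('i * u) = z + 'i * u by ring.
have -> : z + 'i * ('i * u) = z + (-1) * u by rewrite mulrA mul_ii.
have -> : z + (-1) * ('i * u) = z + (- 'i) * u by ring.
have -> : z + (- 'i) * ('i * u) = z + 1 * u by rewrite mulrA mulNr mul_ii opprK.
by ring.
Qed.

Lemma rot_quot_i f z u : rot_quot f z ('i * u) = rot_quot f z u.
Proof.
rewrite /rot_quot invfM.
have -> : ('i : R[i])^-1 = - 'i.
  by apply: (mulfI i_neq0); rewrite divff ?i_neq0// mulrN mul_ii opprK.
have -> : z + 1 * ('i * u) = z + 'i * u by ring.
have -> : z + 'i * ('i * u) = z + (-1) * u by rewrite mulrA mul_ii.
have -> : z + (-1) * ('i * u) = z + (- 'i) * u by ring.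
have -> : z + (- 'i) * ('i * u) = z + 1 * u by rewrite mulrA mulNr mul_ii opprK.
rewrite [LHS]mulrA; congr (_ * _).
set a := f _; set b := f _; set c := f _; set d := f _.
have -> : (a + - 'i * b + (-1 * c + 'i * d)) * - 'i = - 'i * a + 'i * c + ('i * 'i) * b - ('i * 'i) * d by ring.
by rewrite mul_ii; ring.
Qed.

Lemma ccont_rot_quot f z s : eps_cont f -> ccont (fun t => side_inv t * rot_quot f z (ray s t)).
Proof.
move=> cf; apply: ccontM; first exact: ccont_side_inv.
have A b : ccont (fun t => f (z + b * ray s t)).
  apply: (ccont_comp (h := fun t => z + b * ray s t)); last by move=> t; exact: cf.
  by apply: ccontD; [exact: ccont_cst|apply: ccontZ; exact: ccont_ray_t].
apply: ccontM; first by apply: ccontD; apply: ccontD; first [exact: A|apply: ccontZ; exact: A].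
apply: (ccont_comp (ccont_ray_t s)) => t e e0.
exact: (cdiff_cont (cdiff_inv (ray_neq0 s t))).
Qed.

(** The contour integral which returns the derivative of an entire function
    ([contour_derivE]), as an operator defined on all continuous functions: in
    [deriv_cdifferentiable] it is applied to f' before f' is known to be holomorphic. *)
Definition contour_deriv s f z := (4 * kappa)^-1 * cint (-1) 1 (fun t => side_inv t * rot_quot f z (ray s t)).

Lemma kappa4_neq0 : 4 * kappa != 0 :> R[i].
Proof.
rewrite mulf_neq0// -cabs_eq0 gt_eqF//; apply: lt_le_trans cabs_kappa; exact: ltr01.
Qed.

Lemma contour_deriv_bound s f z (B : R) : eps_cont f ->
  (forall w, cabs (w - z) <= 2 * expR s -> cabs (f w) <= B) ->
  cabs (contour_deriv s f z) <= 4 * B / expR s.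
Proof.
move=> cf H; have N11 : -1 <= 1 :> R by lra.
have s0 := expR_gt0 s.
have B0 : 0 <= B.
  apply: le_trans (cabs_ge0 (f z)) (H z _); rewrite subrr cabs0; lra.
have K : cabs (cint (-1) 1 (fun t => side_inv t * rot_quot f z (ray s t))) <= 2 * (4 * B / expR s) * (1 - -1).
  apply: cint_bound => //; first exact: ccont_rot_quot.
  move=> t t1; rewrite cabsM -[leRHS]mul1r; apply: ler_pM; rewrite ?cabs_ge0 ?cabs_side_inv//.
  have t1' : `|t| <= 1 by rewrite ler_norml.
  have F b : cabs b = 1 -> cabs (f (z + b * ray s t)) <= B.
    by move=> b1; apply: H; rewrite (addrC z) addrK cabsM b1 mul1r; exact: cabs_ray_le.
  rewrite cabsM cabsV; apply: ler_pM; rewrite ?invr_ge0 ?cabs_ge0//.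
    have F1 := F 1 cabs1; have F2 := F 'i cabs_i.
    have F3 := F (-1); have F4 := F (- 'i); rewrite !cabsN cabs1 cabs_i in F3 F4.
    have {}F3 := F3 erefl; have {}F4 := F4 erefl.
    set a := f _ in F1 *; set b := f _ in F2 *; set c := f _ in F3 *; set d := f _ in F4 *.
    have L1 := cabsD (a + - 'i * b) (-1 * c + 'i * d).
    have L2 := cabsD a (- 'i * b); have L3 := cabsD (-1 * c) ('i * d).
    rewrite !cabsM !cabsN cabs1 cabs_i !mul1r in L2 L3; lra.
  rewrite lef_pV2 ?posrE ?cabs_gt0 ?ray_neq0//.
  rewrite /ray cabsM cabs_real gtr0_norm// ler_peMr ?cabs_side_ge1// ltW.
rewrite /contour_deriv cabsM cabsV mulrC ler_pdivrMr ?cabs_gt0 ?kappa4_neq0//.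
apply: (le_trans K); rewrite cabsM.
have -> : cabs (4 : R[i]) = 4.
  have E4 : (4 : R[i]) = (4 : R)%:C by rewrite rmorph_nat.
  by rewrite E4 cabs_real ger0_norm.
have Q0 : 0 <= 4 * B / expR s by rewrite divr_ge0 ?mulr_ge0// ltW.
have k1 := @cabs_kappa R.
have -> : 2 * (4 * B / expR s) * (1 - -1) = 4 * B / expR s * (4 * 1) by ring.
by rewrite ler_wpM2l// ler_pM2l.
Qed.

Lemma contour_derivD s f g z : eps_cont f -> eps_cont g ->
  contour_deriv s (fun w => f w + g w) z = contour_deriv s f z + contour_deriv s g z.
Proof.
move=> cf cg; rewrite /contour_deriv -mulrDr -cintD; try exact: ccont_rot_quot.
by congr (_ * _); apply: eq_cint => t _; rewrite /rot_quot; ring.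
Qed.

Lemma contour_derivZ s f c z : eps_cont f -> contour_deriv s (fun w => c * f w) z = c * contour_deriv s f z.
Proof.
move=> cf; rewrite /contour_deriv [RHS]mulrCA -[c * cint _ _ _]cintZ; last exact: ccont_rot_quot.
by congr (_ * _); apply: eq_cint => t _; rewrite /rot_quot; ring.
Qed.

Lemma cdiff_eps_cont f (d : R[i] -> R[i]) : (forall z, cdiff f z (d z)) -> eps_cont f.
Proof. by move=> fd z; exact: (cdiff_cont (fd z)). Qed.

Lemma contour_derivE s f (d : R[i] -> R[i]) z : (forall z, cdiff f z (d z)) -> contour_deriv s f z = d z.
Proof.
move=> fd.
have SM : cint (-1) 1 (fun t => side_inv t * rot_quot f z (ray s t)) = (4 * d z) * kappa.
  apply: square_mean.
  - move=> u u0; apply: cdifferentiableM; last by eexists; exact: cdiff_inv.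
    have A b : cdifferentiable (fun w => f (z + b * w)) u by apply: cdifferentiable_affine; eexists; exact: fd.
    by apply: cdifferentiableD; apply: cdifferentiableD; first [exact: A|apply: cdifferentiableZ; exact: A].
  - exact: rot_quot_i.
  - move=> e e0; have e4 : 0 < e / 4 by lra.
    have [r r0 Hr] := fd z (e / 4) e4.
    exists r => // u u0 ur.
    pose rho v := f (z + v) - f z - v * d z.
    have -> : rot_quot f z u - 4 * d z = (rho (1 * u) + - 'i * rho ('i * u) + (-1 * rho (-1 * u) + 'i * rho (- 'i * u))) / u.
      rewrite /rot_quot /rho; set a := f _; set b := f _; set c := f _; set k := f _.
      have -> : 4 * d z = (u + - ('i * 'i) * u + (u - ('i * 'i) * u)) * d z / u.
        by rewrite mul_ii; field.
      by field.
    have F b : cabs b = 1 -> cabs (rho (b * u)) <= e / 4 * cabs u.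
      move=> b1; have := Hr (b * u); rewrite cabsM b1 mul1r; exact.
    have F1 := F 1 cabs1; have F2 := F 'i cabs_i.
    have F3 := F (-1); have F4 := F (- 'i); rewrite !cabsN cabs1 cabs_i in F3 F4.
    have {}F3 := F3 erefl; have {}F4 := F4 erefl.
    rewrite cabsM cabsV ler_pdivrMr ?cabs_gt0//.
    set a := rho _ in F1 *; set b := rho _ in F2 *; set c := rho _ in F3 *; set k := rho _ in F4 *.
    have L1 := cabsD (a + - 'i * b) (-1 * c + 'i * k).
    have L2 := cabsD a (- 'i * b); have L3 := cabsD (-1 * c) ('i * k).
    rewrite !cabsM !cabsN cabs1 cabs_i !mul1r in L2 L3; lra.
rewrite /contour_deriv SM; have := kappa4_neq0; rewrite mulf_eq0 negb_or => /andP[k4 k0].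
by field; rewrite k0.
Qed.

(** Cauchy's estimate on a disk of radius 2 r, read off the contour formula
    for the derivative. *)
Lemma deriv_bound f (d : R[i] -> R[i]) z (r B : R) : (forall z, cdiff f z (d z)) -> 0 < r ->
  (forall w, cabs (w - z) <= 2 * r -> cabs (f w) <= B) -> cabs (d z) <= 4 * B / r.
Proof.
move=> fd r0 H; rewrite -(contour_derivE (ln r) z fd).
have E : expR (ln r) = r by rewrite lnK// posrE.
rewrite -{2}E; apply: contour_deriv_bound; first exact: cdiff_eps_cont fd.
by rewrite E.
Qed.

(** The mean value inequality, applied to the real and imaginary parts along
    the segment; whence the factor 2. *)
Lemma seg_mvt f (d : R[i] -> R[i]) w h (M : R) : (forall z, cdiff f z (d z)) ->
  (forall t : R, 0 <= t <= 1 -> cabs (h * d (w + t%:C * h)) <= M) ->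
  cabs (f (w + h) - f w) <= 2 * M.
Proof.
move=> fd H.
have D (t e : R) : 0 < e -> exists2 r : R, 0 < r & forall k : R, `|k| < r ->
   cabs (f (w + (t + k)%:C * h) - f (w + t%:C * h) - k%:C * (h * d (w + t%:C * h))) <= e * `|k|.
  move=> e0.
  have [r r0 Hr] := cdiff_affine (fd (w + h * t%:C)) e0.
  exists r => // k kr; have := Hr k%:C; rewrite cabs_real => /(_ kr).
  by rewrite rmorphD/= !(mulrC h).
have M1 (P : R[i] -> R) : (forall a b, P (a - b) = P a - P b) -> (forall (k : R) a, P (k%:C * a) = k * P a) ->
    (forall a, `|P a| <= cabs a) -> `|P (f (w + h) - f w)| <= M.
  move=> PB PZ Pn.
  have dP (t : R) : is_derive t 1 (fun t : R => P (f (w + t%:C * h))) (P (h * d (w + t%:C * h))).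
    apply/rdiffP => e e0; have [r r0 Hr] := D t e e0.
    exists r => // k kr; apply: le_trans (Hr k kr).
    by apply: le_trans (Pn _); rewrite !PB PZ.
  have [c c01] := MVT_segment (a := 0) (b := 1) ler01 (fun t _ => dP t)
      (derivable_within_continuous (fun t _ => ex_derive (is_derive := dP t))).
  rewrite mul1r mul0r addr0 -PB subr0 mulr1 => ->.
  by apply: le_trans (Pn _) (H c _); move: c01; rewrite in_itv.
apply: (le_trans (cabs_leD _)).
have ZRe (k : R) a : Re (k%:C * a) = k * Re a by rewrite ReM mul0r subr0.
have ZIm (k : R) a : Im (k%:C * a) = k * Im a by rewrite ImM mul0r addr0.
have A1 := M1 (@complex.Re R) (raddfB _) ZRe (@cabs_Re R).
have A2 := M1 (@complex.Im R) (raddfB _) ZIm (@cabs_Im R).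
lra.
Qed.

(** Cauchy's estimate is used twice: on f, to make f locally Lipschitz, and
    then on the entire function w |-> f (w + h) - f w, which is O(|h|). *)
Lemma deriv_lip f (d : R[i] -> R[i]) z : (forall z, cdiff f z (d z)) ->
  exists2 r : R, 0 < r & exists2 M : R, 0 <= M & forall w h, cabs (w - z) <= r -> cabs h <= r ->
    cabs (d (w + h) - d w) <= M * cabs h.
Proof.
move=> fd; have [r0 r00 H0] := cdiff_cont (fd z) ltr01.
(* Three nested disks of radii 6 r, 4 r and 3 r are needed: a bound on f, a
   bound on f', a Lipschitz bound on f. *)
pose r := r0 / 16; pose B := cabs (f z) + 1.
have rp : 0 < r by rewrite divr_gt0.
have B0 : 0 <= B by rewrite addr_ge0 ?cabs_ge0.
have fB w : cabs (w - z) <= 6 * r -> cabs (f w) <= B.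
  move=> wz; have := H0 (w - z); rewrite addrCA subrr addr0 => /(_ _) K.
  apply: (le_trans (cabs_ler_dist _ (f z))); rewrite lerD2l ltW//; apply: K.
  apply: le_lt_trans wz _; rewrite /r; lra.
pose M := 4 * B / r.
have M0 : 0 <= M by rewrite divr_ge0 ?mulr_ge0// ltW.
have tri w1 w2 z1 (a b : R) : cabs (w1 - w2) <= a -> cabs (w2 - z1) <= b -> cabs (w1 - z1) <= a + b.
  move=> H1 H2; have -> : w1 - z1 = w1 - w2 + (w2 - z1) by ring.
  by apply: (le_trans (cabsD _ _)); exact: lerD.
have dM w : cabs (w - z) <= 4 * r -> cabs (d w) <= M.
  move=> wz; apply: (deriv_bound fd rp) => w' w'w; apply: fB.
  by have := tri _ _ _ _ _ w'w wz; rewrite -mulrDl; rewrite (_ : 2 + 4 = 6)//; ring.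
have fL w h : cabs (w - z) <= 3 * r -> cabs h <= r -> cabs (f (w + h) - f w) <= 2 * (M * cabs h).
  move=> wz hr; apply: (seg_mvt fd) => t /andP[t0 t1].
  rewrite cabsM mulrC ler_wpM2r ?cabs_ge0//; apply: dM.
  have th : cabs (w + t%:C * h - w) <= 1 * r.
    rewrite (addrC w) addrK cabsM cabs_real ger0_norm//; apply: ler_pM; rewrite ?cabs_ge0//.
  by have := tri _ _ _ _ _ th wz; rewrite -mulrDl; rewrite (_ : 1 + 3 = 4)//; ring.
have M8 : 0 <= 4 * (2 * M) by apply: mulr_ge0 => //; exact: mulr_ge0.
exists r => //; exists (4 * (2 * M) / r); first exact: divr_ge0 M8 (ltW rp).
move=> w h wz hr.
have gd w' : cdiff (fun w => f (h + 1 * w) + (-1) * f w) w' (1 * d (h + 1 * w') + (-1) * d w').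
  by apply: cdiffD; [apply: cdiff_affine|apply: cdiffZ]; exact: fd.
have := deriv_bound (z := w) (B := 2 * (M * cabs h)) gd rp.
have -> : 1 * d (h + 1 * w) + -1 * d w = d (w + h) - d w by rewrite !mul1r mulN1r addrC [h + w]addrC addrC.
have -> : 4 * (2 * (M * cabs h)) / r = 4 * (2 * M) / r * cabs h by ring.
apply => w' w'w; rewrite mul1r mulN1r (addrC h); apply: fL => //.
by have := tri _ _ _ _ _ w'w wz; rewrite (_ : 3 * r = 2 * r + r)//; ring.
Qed.

(** Differentiate the contour formula for f' under the integral sign.  No
    limit theorem is required: f (w + h) - f w - h f'(w) is O(|h|^2) uniformly
    on the contour, since f' is locally Lipschitz. *)
Lemma deriv_cdifferentiable f (d : R[i] -> R[i]) : (forall z, cdiff f z (d z)) -> forall z, cdifferentiable d z.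
Proof.
move=> fd.
have cd : eps_cont d.
  move=> z e e0; have [r r0 [M M0 H]] := deriv_lip z fd.
  have M1 : 0 < M + 1 by rewrite ltr_wpDl.
  exists (Num.min r (e / (M + 1))); first by rewrite lt_min r0 divr_gt0.
  move=> h; rewrite lt_min => /andP[hr he].
  apply: (le_lt_trans (H z h _ (ltW hr))); first by rewrite subrr cabs0 ltW.
  move: he; rewrite ltr_pdivlMr// mulrC; apply: le_lt_trans.
  by rewrite ler_wpM2r ?cabs_ge0// lerDl.
move=> z; have [r r0 [M M0 H]] := deriv_lip z fd.
pose s := ln (r / 2).
have Es : expR s = r / 2 by rewrite lnK// posrE divr_gt0.
exists (contour_deriv s d z) => e e0.
pose K := 4 * (2 * M) / (r / 2) + 1.
have r2 : 0 < r / 2 by rewrite divr_gt0.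
have M8 : 0 <= 4 * (2 * M) by apply: mulr_ge0 => //; exact: mulr_ge0.
have K0 : 0 < K by rewrite ltr_wpDl//; exact: divr_ge0 M8 (ltW r2).
exists (Num.min r (e / K)); first by rewrite lt_min r0 divr_gt0.
move=> h; rewrite lt_min => /andP[hr he].
have fh w : cdiff (fun w => f (h + 1 * w)) w (1 * d (h + 1 * w)) by exact: cdiff_affine.
have c1 := cdiff_eps_cont fh; have c2 := cdiff_eps_cont fd.
have c3 : eps_cont (fun w => (-1) * f w).
  by apply: (@cdiff_eps_cont _ (fun w => (-1) * d w)) => w; exact: cdiffZ.
have c4 : eps_cont (fun w => (- h) * d w).
  move=> w e1 e10; have h1 : 0 < cabs h + 1 by rewrite ltr_wpDl ?cabs_ge0.
  have [q q0 Hq] := cd w _ (divr_gt0 e10 h1).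
  exists q => // k /Hq Hk; rewrite -mulrBr cabsM cabsN.
  rewrite ltr_pdivlMr// in Hk; apply: le_lt_trans Hk.
  by rewrite mulrC ler_wpM2l ?cabs_ge0// lerDl.
have cD f1 f2 : eps_cont f1 -> eps_cont f2 -> eps_cont (fun w => f1 w + f2 w).
  move=> k1 k2 w e1 e10; have e2 : 0 < e1 / 2 by lra.
  have [q1 q10 H1] := k1 w _ e2; have [q2 q20 H2] := k2 w _ e2.
  exists (Num.min q1 q2); first by rewrite lt_min q10.
  move=> k; rewrite lt_min => /andP[/H1 G1 /H2 G2].
  have -> : f1 (w + k) + f2 (w + k) - (f1 w + f2 w) = (f1 (w + k) - f1 w) + (f2 (w + k) - f2 w) by ring.
  apply: (le_lt_trans (cabsD _ _)); lra.
(* The contour integral at z of a remainder that is quadratic in h. *)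
have -> : d (z + h) - d z - h * contour_deriv s d z =
  contour_deriv s (fun w => f (h + 1 * w) + (-1) * f w + (- h) * d w) z.
  rewrite !contour_derivD ?contour_derivZ//; last exact: cD.
  rewrite (contour_derivE s z fh) (contour_derivE s z fd) !mul1r mulN1r mulNr (addrC h) //.
have B : cabs (contour_deriv s (fun w => f (h + 1 * w) + (-1) * f w + (- h) * d w) z) <= 4 * (2 * (M * cabs h * cabs h)) / expR s.
  apply: contour_deriv_bound; first by apply: (cD (fun w => _ + _)) => //; exact: cD.
  rewrite Es => w wz.
  have wz' : cabs (w - z) <= r by apply: (le_trans wz); rewrite mulrCA divff ?mulr1.
  have gd v : cdiff (fun v => f v + (- d w) * v) v (d v + (- d w) * 1).
    by apply: cdiffD; [exact: fd|apply: cdiffZ; exact: cdiff_id].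
  have := seg_mvt (w := w) (h := h) (M := M * cabs h * cabs h) gd.
  have -> : f (w + h) + - d w * (w + h) - (f w + - d w * w) = f (h + 1 * w) + -1 * f w + - h * d w.
    by rewrite mul1r (addrC h); ring.
  apply => t /andP[t0 t1]; rewrite mulr1 cabsM mulrC ler_wpM2r ?cabs_ge0//.
  have th : cabs (t%:C * h) <= cabs h.
    by rewrite cabsM cabs_real ger0_norm// ler_piMl ?cabs_ge0.
  apply: (le_trans (H w _ wz' (le_trans th (ltW hr)))).
  by rewrite ler_wpM2l.
apply: (le_trans B); rewrite Es.
have -> : 4 * (2 * (M * cabs h * cabs h)) / (r / 2) = (4 * (2 * M) / (r / 2)) * cabs h * cabs h by ring.
rewrite ler_wpM2r ?cabs_ge0//; move: he; rewrite ltr_pdivlMr// => /ltW; apply: le_trans.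
by rewrite mulrC ler_wpM2l ?cabs_ge0// lerDl.
Qed.

Lemma entire_cdiffE f : entire f -> forall z, cdiff f z (cderiv 1 f z).
Proof. by move/entireP. Qed.

Lemma entire_deriv f : entire f -> entire (cderiv 1 f).
Proof.
move=> /entireP fd z; have [d dd] := deriv_cdifferentiable fd z.
by have /cdiffP[] := dd.
Qed.

Lemma entire_cderiv n f : entire f -> entire (cderiv n f).
Proof. by move=> ef; elim: n => [|n IH]; [exact: ef|exact: (entire_deriv IH)]. Qed.

(** Induction on n: each derivative uses up half of the remaining radius. *)
Lemma cauchy_estimate n : exists2 C : R, 0 <= C & forall f z (r B : R), entire f -> 0 < r ->
  (forall w, cabs (w - z) <= r -> cabs (f w) <= B) -> cabs (cderiv n f z) <= C / r ^+ n * B.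
Proof.
elim: n => [|n [C C0 IH]].
  exists 1 => // f z r B _ r0 H; rewrite expr0 divr1 mul1r; apply: H.
  by rewrite subrr cabs0 ltW.
exists (16 * 2 ^+ n * C); first by rewrite !mulr_ge0 ?exprn_ge0.
move=> f z r B ef r0 H.
have r2 : 0 < r / 2 by rewrite divr_gt0.
have r4 : 0 < r / 4 by rewrite divr_gt0.
have rn : r ^+ n != 0 by rewrite expf_neq0// gt_eqF.
have -> : 16 * 2 ^+ n * C / r ^+ n.+1 * B = 4 * (C / (r / 2) ^+ n * B) / (r / 4).
  by rewrite expr_div_n exprS; field; rewrite rn gt_eqF// expf_neq0.
have T := @deriv_bound (cderiv n f) (cderiv 1 (cderiv n f)) z (r / 4) (C / (r / 2) ^+ n * B) (entire_cdiffE (@entire_cderiv n f ef)) r4.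
rewrite cderivS.
apply: T.
move=> w wz; apply: IH => // v vw; apply: H.
have -> : v - z = v - w + (w - z) by ring.
apply: (le_trans (cabsD _ _)).
have : 2 * (r / 4) + r / 2 = r by field.
lra.
Qed.

End CauchyEstimates.

(** * Affine changes of variables in the plane *)

Section PlaneIntegrals.
Context {R : realType}.
Notation leb := (@lebesgue_measure R).
Notation leb2 := (leb \x leb)%E.

(** Open subsets of the plane are countable unions of rational boxes, hence
    measurable for the product sigma-algebra. *)
Lemma measurable_eps_cont2 (N : R * R -> R) :
  (forall p (e : R), 0 < e -> exists2 r : R, 0 < r & forall q,
     `|q.1 - p.1| < r -> `|q.2 - p.2| < r -> `|N q - N p| < e) ->
  measurable_fun setT N.
Proof.
move=> cN; apply: (measurability _ (RGenOInfty.measurableE R)) => _ [_ [x ->] <-].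
rewrite setTI.
pose bx (i : rat * rat * (rat * rat)) : set (R * R) :=
  `]ratr i.1.1, ratr i.1.2[%classic `*` `]ratr i.2.1, ratr i.2.2[%classic.
pose U := N @^-1` `]x, +oo[%classic.
have -> : N @^-1` `]x, +oo[%classic = \bigcup_i (if pselect (bx i `<=` U) then bx i else set0).
  apply/seteqP; split => [p Up|p [i _]]; last by case: pselect => // H; exact: H.
  have Np : 0 < N p - x by move: Up; rewrite /= in_itv/= andbT subr_gt0.
  have [r r0 Hr] := cN p _ Np.
  have ratbox (u : R) : exists a b : rat, [/\ u - r < ratr a, ratr a < u, u < ratr b & ratr b < u + r].
    have [a] := @rat_in_itvoo R (u - r) u ltac:(lra).
    have [b] := @rat_in_itvoo R u (u + r) ltac:(lra).
    by rewrite !in_itv/= => /andP[? ?] /andP[? ?]; exists a, b.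
  have [a [b [a1 a2 b1 b2]]] := ratbox p.1.
  have [c [d [c1 c2 d1 d2]]] := ratbox p.2.
  have S : bx ((a, b), (c, d)) `<=` U.
    move=> q [/=]; rewrite !in_itv/= => /andP[q1 q2] /andP[q3 q4].
    have n1 : `|q.1 - p.1| < r by rewrite ltr_norml; apply/andP; split; lra.
    have n2 : `|q.2 - p.2| < r by rewrite ltr_norml; apply/andP; split; lra.
    have := Hr q n1 n2; rewrite ltr_norml => /andP[H _].
    by rewrite /U/= in_itv/= andbT; lra.
  exists ((a, b), (c, d)) => //; case: pselect => [H|] //=.
  by split; rewrite /= in_itv/= ?a2 ?c2 ?b1 ?d1.
apply: countable_bigcupT_measurable; first exact: countableP.
move=> i; case: pselect => [H|H] /=; [exact: measurableX|exact: measurable0].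
Qed.

(** The image of Lebesgue measure under an affine map, rescaled by |e|, takes
    the right values on intervals, hence is Lebesgue measure. *)
Lemma affine_integral (f : R -> \bar R) (a e : R) : e != 0 ->
  measurable_fun [set: R] f -> (forall x, 0 <= f x)%E ->
  (`|e|%:E * \int[leb]_x f (a + e * x)%R = \int[leb]_x f x)%E.
Proof.
move=> e0 mf f0.
have ae0 : 0 < `|e| by rewrite normr_gt0.
pose phi : measurableTypeR R -> measurableTypeR R := fun x => a + e * x.
have mphi : measurable_fun setT phi.
  by apply: measurable_funD => //; apply: measurable_funM.
pose s : {nonneg R} := NngNum (normr_ge0 e).
have U (A : set R) : measurable A -> leb A = mscale s (pushforward leb phi) A.
  move=> mA; apply: lebesgue_measure_unique => // _ [[u v]] _ <-.
  rewrite -[RHS]/(`|e|%:E * leb (phi @^-1` `]u, v]%classic))%E.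
  have [e_gt|e_lt|] := ltgtP 0 e; last by move=> /esym/eqP; rewrite (negPf e0).
  - rewrite (_ : phi @^-1` _ = `](u - a) / e, (v - a) / e]%classic); last first.
      apply/seteqP; split => x /=; rewrite !in_itv/= /phi ltr_pdivrMr// ler_pdivlMr// ltrBlDl lerBrDl [x * e]mulrC//.
    rewrite [LHS]lebesgue_measure_itv [X in (_ * X)%E]lebesgue_measure_itv/= !lte_fin.
    rewrite ltr_pM2r ?invr_gt0// ltrD2r; case: ifP; rewrite ?mule0// => uv.
    by rewrite -EFinM gtr0_norm// -mulrBl mulrCA divff// mulr1; congr EFin; ring.
  - rewrite (_ : phi @^-1` _ = `[(v - a) / e, (u - a) / e[%classic); last first.
      apply/seteqP; split => x /=; rewrite !in_itv/= /phi ltr_ndivlMr// ler_ndivrMr// ltrBlDl lerBrDl [x * e]mulrC andbC//.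
    rewrite [LHS]lebesgue_measure_itv [X in (_ * X)%E]lebesgue_measure_itv/= !lte_fin.
    rewrite ltr_nM2r ?invr_lt0// ltrD2r; case: ifP; rewrite ?mule0// => uv.
    by rewrite -EFinM ltr0_norm// -mulrBl; congr EFin; field.
rewrite (_ : (\int[leb]_x f (a + e * x)%R)%E = (\int[pushforward leb phi]_x f x)%E); last first.
  by rewrite ge0_integral_pushforward.
rewrite -[X in (X * _)%E]/((s%:num)%:E) -ge0_integral_mscale//.
apply: eq_measure_integral => A mA _; exact/esym/U.
Qed.

(** One variable at a time: Tonelli makes each variable the inner one in
    turn. *)
Lemma plane_affine (F : R * R -> \bar R) (a b e e' : R) :
  measurable_fun [set: R * R] F -> (forall x, 0 <= F x)%E -> `|e| = 1 -> `|e'| = 1 ->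
  (\int[leb2]_p F (a + e * p.1, b + e' * p.2)%R = \int[leb2]_p F p)%E.
Proof.
move=> mF F0 e1 e'1.
have e0 : e != 0 by rewrite -normr_eq0 e1 oner_eq0.
have e'0 : e' != 0 by rewrite -normr_eq0 e'1 oner_eq0.
have mA (u v : R) : measurable_fun setT (fun x : R => u + v * x).
  by apply: measurable_funD => //; apply: measurable_funM.
have m1 : measurable_fun setT (fun p : R * R => F (p.1, b + e' * p.2)).
  apply: (measurableT_comp mF); apply: measurable_fun_pair => //.
  exact: (measurableT_comp (mA b e')).
have m2 : measurable_fun setT (fun p : R * R => F (a + e * p.1, b + e' * p.2)).
  apply: (measurableT_comp m1 (f := _) (g := fun p : R * R => (a + e * p.1, p.2))).
  apply: measurable_fun_pair => //.
  exact: (measurableT_comp (mA a e)).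
rewrite fubini_tonelli2// /fubini_G/=.
transitivity (\int[leb]_y \int[leb]_x F (x, b + e' * y)%R)%E.
  apply: eq_integral => y _.
  rewrite -[RHS](@affine_integral _ a e)// ?e1 ?mul1e//.
  exact: (measurable_fun_pair1 (f := fun p => F (p.1, b + e' * p.2)) y m1).
rewrite -(fubini_tonelli (m1 := leb) (m2 := leb) (fun p : R * R => F (p.1, b + e' * p.2)))//.
rewrite [RHS]fubini_tonelli1// /fubini_F/=.
apply: eq_integral => x _.
rewrite -[RHS](@affine_integral _ b e')// ?e'1 ?mul1e//.
exact: (measurable_fun_pair2 (f := F) x mF).
Qed.

Lemma plane_swap (F : R * R -> \bar R) :
  measurable_fun [set: R * R] F -> (forall x, 0 <= F x)%E ->
  (\int[leb2]_p F (p.2, p.1) = \int[leb2]_p F p)%E.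
Proof.
move=> mF F0.
rewrite fubini_tonelli1//; last first.
  by apply: (measurableT_comp mF); exact: measurable_fun_pair.
by rewrite [RHS]fubini_tonelli2.
Qed.

End PlaneIntegrals.

(** * The area mean value inequality *)

Section AreaMean.
Context {R : realType}.
Notation Re := complex.Re.
Notation Im := complex.Im.
Notation leb := (@lebesgue_measure R).
Notation leb2 := (leb \x leb)%E.
Implicit Types (z b : R[i]) (f : R[i] -> R[i]).

Lemma toC_dist (p q : R * R) : cabs (toC q - toC p) <= `|q.1 - p.1| + `|q.2 - p.2|.
Proof. by apply: (le_trans (cabs_leD _)). Qed.

Lemma measurable_lip_toC (P : R[i] -> R) f : (forall u v, `|P u - P v| <= cabs (u - v)) ->
  eps_cont f -> measurable_fun setT (fun p : R * R => P (f (toC p))).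
Proof.
move=> HP cf; apply: measurable_eps_cont2 => p e e0.
have [r r0 Hr] := cf (toC p) e e0.
exists (r / 2); first by rewrite divr_gt0.
move=> q q1 q2; apply: (le_lt_trans (HP _ _)).
have := Hr (toC q - toC p); rewrite addrCA subrr addr0; apply.
apply: (le_lt_trans (toC_dist p q)); lra.
Qed.

Lemma cabs_lip (u v : R[i]) : `|cabs u - cabs v| <= cabs (u - v).
Proof.
rewrite ler_norml; apply/andP; split.
  by have := cabs_ler_dist v u; rewrite cabsBC; lra.
by have := cabs_ler_dist u v; lra.
Qed.

Lemma measurable_cabs_toC f : eps_cont f -> measurable_fun setT (fun p : R * R => cabs (f (toC p))).
Proof. exact: (measurable_lip_toC cabs_lip). Qed.

Lemma measurable_Re_toC f : eps_cont f -> measurable_fun setT (fun p : R * R => Re (f (toC p))).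
Proof. by apply: (@measurable_lip_toC (@complex.Re R)) => u v; rewrite -raddfB; exact: cabs_Re. Qed.

Lemma measurable_Im_toC f : eps_cont f -> measurable_fun setT (fun p : R * R => Im (f (toC p))).
Proof. by apply: (@measurable_lip_toC (@complex.Im R)) => u v; rewrite -raddfB; exact: cabs_Im. Qed.

Lemma eps_cont_affine f z b : eps_cont f -> eps_cont (fun u => f (z + b * u)).
Proof.
move=> cf u e e0; have [r r0 Hr] := cf (z + b * u) e e0.
have b1 : 0 < cabs b + 1 by rewrite ltr_wpDl ?cabs_ge0.
exists (r / (cabs b + 1)); first by rewrite divr_gt0.
move=> h; rewrite ltr_pdivlMr// => hr; have := Hr (b * h).
have -> : z + b * u + b * h = z + b * (u + h) by ring.
apply; rewrite cabsM; apply: le_lt_trans hr.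
by rewrite mulrC ler_wpM2l ?cabs_ge0// lerDl.
Qed.

(** Boolean, so that its value can be used as a numerical factor in
    integrands. *)
Definition inbox z (d : R) (p : R * R) : bool :=
  (`|p.1 - Re z| <= d) && (`|p.2 - Im z| <= d).

Lemma measurable_ball1 (x d : R) : measurable_fun setT (fun t : R => ((`|t - x| <= d)%R%:R : R)).
Proof.
rewrite (_ : (fun _ => _) = \1_(`[x - d, x + d]%classic)); last first.
  apply/funext => t; rewrite indicE; congr (_%:R); rewrite mem_setE/=.
  by rewrite ler_distl in_itv.
exact: measurable_indic.
Qed.

Lemma measurable_ball0 (d : R) : measurable_fun setT (fun t : R => ((`|t| <= d)%R%:R : R)).
Proof.
have := measurable_ball1 0 d; congr (measurable_fun _ _).
by apply/funext => t; rewrite subr0.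
Qed.

Lemma measurable_inbox z d : measurable_fun setT (fun p : R * R => ((inbox z d p)%:R : R)).
Proof.
rewrite (_ : (fun _ => _) = (fun p : R * R => (`|p.1 - Re z| <= d)%R%:R * (`|p.2 - Im z| <= d)%R%:R)).
  apply: measurable_funM.
    exact: (measurableT_comp (measurable_ball1 (Re z) d)).
  exact: (measurableT_comp (measurable_ball1 (Im z) d)).
by apply/funext => p; rewrite /inbox -mulnb natrM.
Qed.

Lemma cint_le_integral (a b : R) (h : R -> R[i]) : ccont h ->
  ((cabs (cint a b h))%:E <= 2%:E * \int[leb]_(x in `[a, b]) (cabs (h x))%:E)%E.
Proof.
move=> ch; have [h1 h2] := ch.
have mh : measurable_fun setT (fun x => cabs (h x)).
  apply: continuous_measurable_fun => x; apply/cvgrPdist_lt => e e0.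
  have [r r0 Hr] := (ccontP h).1 ch x e e0.
  exists r => //= y xy; apply: (le_lt_trans (cabs_lip _ _)); rewrite cabsBC.
  by have := Hr (y - x); rewrite distrC xy addrCA subrr addr0; exact.
have K (P : R[i] -> R) : continuous (fun x => P (h x)) -> (forall u, `|P u| <= cabs u) ->
    ((`|\int[leb]_(x in `[a, b]) P (h x)|)%:E <= \int[leb]_(x in `[a, b]) (cabs (h x))%:E)%E.
  move=> cP HP; have iP := seg_integrable a b cP.
  rewrite EFin_normr_Rintegral//; apply: (le_trans (le_abse_integral _ _ _)) => //.
    by case/integrableP : iP.
  apply: ge0_le_integral => //.
  - by apply: measurableT_comp => //; case/integrableP : iP.
  - by apply/measurable_EFinP; exact: measurable_funTS.
  - by move=> x _; rewrite lee_fin; exact: HP.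
have K1 := K _ h1 (@cabs_Re R); have K2 := K _ h2 (@cabs_Im R).
apply: (@le_trans _ _ ((`|\int[leb]_(x in `[a, b]) Re (h x)| + `|\int[leb]_(x in `[a, b]) Im (h x)|)%:E)).
  by rewrite lee_fin; exact: cabs_leD.
rewrite EFinD; apply: (le_trans (leeD K1 K2)).
by rewrite -[2%R]/(1 + 1)%R EFinD ge0_muleDl// !mul1e.
Qed.

Definition rot_cabs f z (p : R * R) : R :=
  cabs (f (z + 1 * toC p)) + cabs (f (z + 'i * toC p)) +
  (cabs (f (z + (-1) * toC p)) + cabs (f (z + (- 'i) * toC p))).

Lemma rot_cabs_ge0 f z p : 0 <= rot_cabs f z p.
Proof. by rewrite /rot_cabs !addr_ge0 ?cabs_ge0. Qed.

Lemma measurable_rot_cabs f z : eps_cont f -> measurable_fun setT (rot_cabs f z).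
Proof.
move=> cf; have A b : measurable_fun setT (fun p : R * R => cabs (f (z + b * toC p))).
  exact: (measurable_cabs_toC (eps_cont_affine z b cf)).
by apply: measurable_funD; apply: measurable_funD; exact: A.
Qed.

(** The mean value formula on the square of half-side s, with the side
    parametrised by y = s t instead of t. *)
Lemma box_mean_slice f (d : R[i] -> R[i]) z (s : R) : (forall z, cdiff f z (d z)) -> 0 < s ->
  ((4 * cabs (f z) * s)%:E <=
   2%:E * \int[leb]_y (rot_cabs f z (s, y) * (`|y| <= s)%R%:R)%:E)%E.
Proof.
move=> fd s0; have cf := cdiff_eps_cont fd.
pose h t := side_inv t * rot_sum f z (ray (ln s) t).
have rE t : ray (ln s) t = toC (s, s * t).
  by rewrite /ray lnK ?posrE// /side /toC; simpc.
have ch : ccont h.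
  apply: ccontM; first exact: ccont_side_inv.
  have A b : ccont (fun t => f (z + b * ray (ln s) t)).
    apply: (ccont_comp (h := fun t => z + b * ray (ln s) t)); last by move=> t; exact: cf.
    by apply: ccontD; [exact: ccont_cst|apply: ccontZ; exact: ccont_ray_t].
  by apply: ccontD; apply: ccontD; exact: A.
(* The limit of the sum over the four rotations at u = 0 is 4 f(z). *)
have SM : cint (-1) 1 h = (4 * f z) * kappa.
  apply: square_mean.
  - move=> u u0.
    have A b : cdifferentiable (fun w => f (z + b * w)) u by apply: cdifferentiable_affine; eexists; exact: fd.
    by apply: cdifferentiableD; apply: cdifferentiableD; exact: A.
  - exact: rot_sum_i.
  - move=> e e0; have e4 : 0 < e / 4 by lra.
    have [r r0 Hr] := cf z _ e4; exists r => // u _ ur.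
    have F b : cabs b = 1 -> cabs (f (z + b * u) - f z) <= e / 4.
      by move=> b1; apply/ltW/Hr; rewrite cabsM b1 mul1r.
    have F1 := F 1 cabs1; have F2 := F 'i cabs_i.
    have F3 := F (-1); have F4 := F (- 'i); rewrite !cabsN cabs1 cabs_i in F3 F4.
    have {}F3 := F3 erefl; have {}F4 := F4 erefl.
    rewrite /rot_sum; set a := f _ in F1 *; set b := f _ in F2 *; set c := f _ in F3 *; set k := f _ in F4 *.
    have -> : a + b + (c + k) - 4 * f z = (a - f z) + (b - f z) + ((c - f z) + (k - f z)) by ring.
    have L1 := cabsD (a - f z + (b - f z)) (c - f z + (k - f z)).
    have L2 := cabsD (a - f z) (b - f z); have L3 := cabsD (c - f z) (k - f z); lra.
pose Phi (y : R) := (rot_cabs f z (s, y) * (`|y| <= s)%R%:R)%:E.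
have mPhi : measurable_fun setT Phi.
  apply/measurable_EFinP; apply: measurable_funM.
    exact: (measurable_fun_pair2 (f := rot_cabs f z) s (measurable_rot_cabs z cf)).
  exact: measurable_ball0.
have Phi0 y : (0 <= Phi y)%E by rewrite lee_fin mulr_ge0 ?rot_cabs_ge0.
have := @affine_integral R Phi 0 s (lt0r_neq0 s0) mPhi Phi0.
rewrite gtr0_norm// => <-.
rewrite muleA (muleC 2%:E) -muleA.
rewrite -[leLHS]/(_%:E) mulrC EFinM; apply: lee_wpmul2l; first by rewrite lee_fin ltW.
have k1 : 4 * cabs (f z) <= cabs (cint (-1) 1 h).
  rewrite SM cabsM cabsM.
  have -> : cabs (4 : R[i]) = 4.
    have E4 : (4 : R[i]) = (4 : R)%:C by rewrite rmorph_nat.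
    by rewrite E4 cabs_real ger0_norm.
  rewrite -[leLHS]mulr1; apply: ler_wpM2l; first by rewrite mulr_ge0 ?cabs_ge0.
  exact: cabs_kappa.
apply: (@le_trans _ _ (cabs (cint (-1) 1 h))%:E); first by rewrite lee_fin.
apply: (le_trans (cint_le_integral (-1) 1 ch)).
apply: lee_wpmul2l; first by [].
have m11 : measurable (`[-1, 1]%classic : set R) by [].
have mPs : measurable_fun setT (fun t : R => Phi (0 + s * t)).
  by apply: (measurableT_comp mPhi); apply: measurable_funD => //; apply: measurable_funM.
apply: (@le_trans _ _ (\int[leb]_(t in `[(-1)%R, 1%R]) Phi (0 + s * t)%R)%E); last first.
  by apply: ge0_subset_integral => //.
apply: ge0_le_integral => //.
- by move=> t _; rewrite lee_fin cabs_ge0.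
- apply/measurable_EFinP; apply: measurable_funTS; apply: continuous_measurable_fun => x; apply/cvgrPdist_lt => e e0.
  have [r r0 Hr] := (ccontP h).1 ch x e e0.
  exists r => //= y xy; apply: (le_lt_trans (cabs_lip _ _)); rewrite cabsBC.
  by have := Hr (y - x); rewrite distrC xy addrCA subrr addr0; exact.
- exact: measurable_funTS.
- move=> t /=; rewrite in_itv/= => t1; rewrite /Phi add0r lee_fin.
  have -> : `|s * t| <= s by rewrite normrM gtr0_norm// ger_pMr// ler_norml.
  rewrite mulr1 /h rE cabsM.
  apply: (@le_trans _ _ (1 * cabs (rot_sum f z (toC (s, s * t))))).
    by rewrite ler_wpM2r ?cabs_ge0 ?cabs_side_inv.
  rewrite mul1r /rot_sum /rot_cabs.
  by apply: (le_trans (cabsD _ _)); apply: lerD; exact: cabsD.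
Qed.

(** Rotations by multiples of a right angle preserve both the square and
    Lebesgue measure. *)
Lemma rot_box_integral f z (d : R) b : eps_cont f -> b \in [:: 1; 'i; -1; - 'i] ->
  (\int[leb2]_p (cabs (f (z + b * toC p)) * (inbox 0 d p)%:R)%:E =
   \int[leb2]_p (cabs (f (toC p)) * (inbox z d p)%:R)%:E)%E.
Proof.
move=> cf.
pose F (p : R * R) := (cabs (f (toC p)) * (inbox z d p)%:R)%:E.
have mF : measurable_fun setT F.
  apply/measurable_EFinP; apply: measurable_funM; first exact: measurable_cabs_toC.
  exact: measurable_inbox.
have F0 p : (0 <= F p)%E by rewrite lee_fin mulr_ge0 ?cabs_ge0.
have n1 : `|1 : R| = 1 by rewrite normr1.
have nN1 : `|-1 : R| = 1 by rewrite normrN normr1.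
have mA (u v u' v' : R) : measurable_fun setT (fun p : R * R => F (u + v * p.1, u' + v' * p.2)).
  apply: (measurableT_comp mF); apply: measurable_fun_pair; apply: measurable_funD => //; exact: measurable_funM.
have key (x y e e' : R) : `|e| = 1 -> `|e'| = 1 ->
   (\int[leb2]_p F (x + e * p.1, y + e' * p.2)%R = \int[leb2]_p F p)%E.
  by move=> e1 e'1; exact: plane_affine.
have key2 (x y e e' : R) : `|e| = 1 -> `|e'| = 1 ->
   (\int[leb2]_p F (x + e * p.2, y + e' * p.1)%R = \int[leb2]_p F p)%E.
  move=> e1 e'1; rewrite -(key x y e e' e1 e'1).
  exact: (plane_swap (F := fun p => F (x + e * p.1, y + e' * p.2))).
rewrite -[RHS]/(\int[leb2]_p F p)%E.
have eF (w1 w2 : R[i]) (p1 p2 : R * R) : w1 = toC p2 -> inbox 0 d p1 = inbox z d p2 ->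
    (cabs (f w1) * (inbox 0 d p1)%:R)%:E = F p2.
  by move=> -> ->.
rewrite !inE => /or4P[] /eqP ->.
- rewrite -(key (Re z) (Im z) 1 1 n1 n1); apply: eq_integral => -[s t] _; apply: eF => //.
    by rewrite /toC; case: (z) => x y; simpc.
  by rewrite /inbox/= !mul1r !subr0 (addrC (Re z)) (addrC (Im z)) !addrK.
- rewrite -(key2 (Re z) (Im z) (-1) 1 nN1 n1); apply: eq_integral => -[s t] _; apply: eF => //.
    by rewrite /toC; case: (z) => x y; simpc.
  by rewrite /inbox/= mul1r mulN1r !subr0 (addrC (Re z)) (addrC (Im z)) !addrK normrN andbC.
- rewrite -(key (Re z) (Im z) (-1) (-1) nN1 nN1); apply: eq_integral => -[s t] _; apply: eF => //.
    by rewrite /toC; case: (z) => x y; simpc.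
  by rewrite /inbox/= !mulN1r !subr0 (addrC (Re z)) (addrC (Im z)) !addrK !normrN.
- rewrite -(key2 (Re z) (Im z) 1 (-1) n1 nN1); apply: eq_integral => -[s t] _; apply: eF => //.
    by rewrite /toC; case: (z) => x y; simpc.
  by rewrite /inbox/= mul1r mulN1r !subr0 (addrC (Re z)) (addrC (Im z)) !addrK normrN andbC.
Qed.

(** Integrate [box_mean_slice] over the squares of half-side between r / 2
    and r.  Squares, unlike circles, are swept out in Cartesian coordinates, so
    that no polar coordinates are needed. *)
Theorem box_mean f (d : R[i] -> R[i]) z (r : R) : (forall z, cdiff f z (d z)) -> 0 < r ->
  ((r ^+ 2 * cabs (f z))%:E <=
   8%:E * \int[leb2]_p (cabs (f (toC p)) * (inbox z r p)%:R)%:E)%E.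
Proof.
move=> fd r0; have cf := cdiff_eps_cont fd.
pose T b p := (cabs (f (z + b * toC p)) * (inbox 0 r p)%:R)%:E.
have mT b : measurable_fun setT (T b).
  apply/measurable_EFinP; apply: measurable_funM; last exact: measurable_inbox.
  exact: (measurable_cabs_toC (eps_cont_affine z b cf)).
have T0 b p : (0 <= T b p)%E by rewrite lee_fin mulr_ge0 ?cabs_ge0.
pose G p := (rot_cabs f z p * (inbox 0 r p)%:R)%:E.
have mG : measurable_fun setT G.
  by apply/measurable_EFinP; apply: measurable_funM; [exact: measurable_rot_cabs|exact: measurable_inbox].
have G0 p : (0 <= G p)%E by rewrite lee_fin mulr_ge0 ?rot_cabs_ge0.
have -> : (8%:E * \int[leb2]_p (cabs (f (toC p)) * (inbox z r p)%:R)%:E = 2%:E * \int[leb2]_p G p)%E.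
  have -> : (\int[leb2]_p G p = \int[leb2]_p (T 1%R p + T 'i p + (T (-1)%R p + T (- 'i)%R p)))%E.
    by apply: eq_integral => p _; rewrite /G /T -!EFinD -!mulrDl.
  have mT2 b1 b2 : measurable_fun setT (fun p => T b1 p + T b2 p)%E by exact: (emeasurable_funD (mT b1) (mT b2)).
  have T02 b1 b2 p : (0 <= T b1 p + T b2 p)%E by apply: adde_ge0.
  rewrite !ge0_integralD//; try exact: mT; try exact: mT2.
  rewrite /T !rot_box_integral//; try by rewrite !inE eqxx ?orbT.
  set I := (\int[_]_p _)%E.
  have I0 : (0 <= I)%E by apply: integral_ge0 => p _; rewrite lee_fin mulr_ge0 ?cabs_ge0.
  have -> : (I + I + (I + I) = 4%:E * I)%E.
    rewrite (_ : 4%R = 1 + 1 + (1 + 1)); last by ring.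
    by rewrite !EFinD !ge0_muleDl ?adde_ge0// ?mul1e.
  by rewrite muleA -EFinM; congr (_%:E * _)%E; ring.
rewrite (fubini_tonelli1 (m1 := leb) (m2 := leb) G mG G0) /fubini_F -ge0_integralZl//; first last.
- by move=> x _; exact: integral_ge0.
- exact: (measurable_fun_fubini_tonelli_F (m2 := leb) G mG G0).
have mH : measurable_fun setT (fun x => 2%:E * \int[leb]_y G (x, y))%E.
  apply: measurable_funeM; exact: (measurable_fun_fubini_tonelli_F (m2 := leb) G mG G0).
have H0 (x : R) : (0 <= 2%:E * \int[leb]_y G (x, y))%E.
  by apply: mule_ge0 => //; exact: integral_ge0.
have mr : measurable (`[r / 2, r]%classic : set R) by [].
apply: (@le_trans _ _ (\int[leb]_(x in `[(r / 2)%R, r]) (2%:E * \int[leb]_y G (x, y)))%E); last first.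
  exact: ge0_subset_integral.
have lab : leb `[r / 2, r]%classic = (r / 2)%:E.
  by rewrite lebesgue_measure_itv /= lte_fin ifT; [congr EFin; field|lra].
have -> : (r ^+ 2 * cabs (f z))%:E = (\int[leb]_(x in `[(r / 2)%R, r]) (cst (2 * r * cabs (f z))%:E x))%E.
  rewrite integral_cst//.
  transitivity ((2 * r * cabs (f z))%:E * (r / 2)%:E)%E; last by congr (_ * _)%E; exact/esym/lab.
  by rewrite -EFinM; congr EFin; field.
apply: ge0_le_integral => //.
- by move=> x _; rewrite lee_fin !mulr_ge0 ?cabs_ge0 ?ltW.
- exact: measurable_funTS.
move=> s /=; rewrite in_itv/= => /andP[s1 s2].
have s0 : 0 < s by lra.
apply: le_trans (le_trans (box_mean_slice z fd s0) _).
  rewrite lee_fin -!mulrA mulrCA; have := cabs_ge0 (f z); nra.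
apply: lee_wpmul2l => //; apply: ge0_le_integral => //.
- by move=> y _; rewrite lee_fin mulr_ge0 ?rot_cabs_ge0.
- apply/measurable_EFinP; apply: measurable_funM.
    exact: (measurable_fun_pair2 (f := rot_cabs f z) s (measurable_rot_cabs z cf)).
  exact: measurable_ball0.
- exact: (measurable_fun_pair2 (f := G) s mG).
move=> y _; rewrite lee_fin; apply: ler_wpM2l; first exact: rot_cabs_ge0.
rewrite ler_nat; case: leP => //= ys; rewrite /inbox/= !subr0 gtr0_norm// s2/=.
by rewrite (le_trans ys s2).
Qed.

End AreaMean.

(** * Measures defined as suprema *)

Lemma sigma_finite_measure_pack d (T : measurableType d) (R : realType)
    (m : {measure set T -> \bar R}) : sigma_finite setT m ->
  exists m' : {sigma_finite_measure set T -> \bar R}, (m' : set T -> \bar R) = m.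
Proof.
move=> sf.
pose H2 := isSFinite.Build _ _ _ _ (sfinite_measure_sigma_finite sf).
pose H3 := isSigmaFinite.Build _ _ _ _ sf.
by exists (HB.pack_for (SigmaFiniteMeasure.type T R) (Measure.sort m) H2 H3).
Qed.

Section SupMeasure.
Context d {T : measurableType d} {R : realType}.
Variable X : set T -> set R.
Hypothesis X_0 : forall A, X A 0.
Hypothesis X_set0 : forall x, X set0 x -> x <= 0.
Hypothesis X_mono : forall A B, A `<=` B -> X A `<=` X B.
Hypothesis X_add : forall A B x y, A `&` B = set0 -> X A x -> X B y -> X (A `|` B) (x + y).
Hypothesis X_sub : forall (F : nat -> set T) x (e : R), (forall i, measurable (F i)) -> trivIset setT F ->
  X (\bigcup_i F i) x -> 0 < e -> exists (n : nat) (y : nat -> R),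
  (forall i, X (F i) (y i)) /\ x <= \sum_(i < n) y i + e.

Let S (A : set T) : \bar R := ereal_sup [set x%:E | x in X A].

Let S_ge A x : X A x -> (x%:E <= S A)%E.
Proof. by move=> Ax; apply: ereal_sup_ubound; exists x. Qed.

Let S_ge0 A : (0 <= S A)%E.
Proof. exact: (S_ge (X_0 A)). Qed.

Let S_set0 : S set0 = 0%E.
Proof.
apply/eqP; rewrite eq_le S_ge0 andbT; apply: ge_ereal_sup => _ [x x0 <-].
by rewrite lee_fin X_set0.
Qed.

Let S_mono A B : A `<=` B -> (S A <= S B)%E.
Proof.
move=> AB; apply: ge_ereal_sup => _ [x x0 <-]; apply: S_ge; exact: X_mono AB _ x0.
Qed.

Let S_add A B : A `&` B = set0 -> (S A + S B <= S (A `|` B))%E.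
Proof.
move=> AB; have [fin|] := boolP (S (A `|` B) \is a fin_num); last first.
  rewrite fin_numE negb_and !negbK => /orP[/eqP H|/eqP ->]; last by rewrite leey.
  by have := S_ge0 (A `|` B); rewrite H.
have fA : S A \is a fin_num.
  rewrite ge0_fin_numE//; apply: le_lt_trans (S_mono (@subsetUl _ A B)) _; by rewrite -ge0_fin_numE.
have fB : S B \is a fin_num.
  rewrite ge0_fin_numE//; apply: le_lt_trans (S_mono (@subsetUr _ A B)) _; by rewrite -ge0_fin_numE.
rewrite -leeBrDr//; apply: ge_ereal_sup => _ [x Ax <-].
rewrite leeBrDr// addeC -leeBrDr//; apply: ge_ereal_sup => _ [y By <-].
by rewrite leeBrDr// addeC -EFinD; apply: S_ge; exact: X_add.
Qed.

Let S_sigma : semi_sigma_additive S.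
Proof.
move=> F mF tF _.
pose s n := (\sum_(0 <= i < n) S (F i))%E.
have ns : nondecreasing_seq s.
  by apply/nondecreasing_seqP => n; rewrite /s big_nat_recr//= leeDl.
have sle n : (s n <= S (\bigcup_(i < n) F i))%E.
  elim: n => [|n IH]; first by rewrite /s big_geq.
  rewrite /s big_nat_recr//= -/(s n); apply: (le_trans (leeD2r _ IH)).
  rewrite (_ : \bigcup_(i < n.+1) F i = \bigcup_(i < n) F i `|` F n); last first.
    apply/seteqP; split => t.
      by move=> [i /=]; rewrite ltnS leq_eqVlt => /orP[/eqP -> ?|ni ?]; [right|left; exists i].
    by move=> [[i /= ni Fi]|Fn]; [exists i => //=; exact: ltnW|exists n => /=].
  apply: S_add; rewrite -subset0 => t [[i /= ni Fi] Fn].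
  by move: tF ni => /(_ i n I I) H; rewrite H ?ltnn//; exists t.
suff -> : S (\bigcup_i F i) = ereal_sup (range s) by exact: ereal_nondecreasing_cvgn.
apply/eqP; rewrite eq_le; apply/andP; split; last first.
  apply: ge_ereal_sup => _ [n _ <-]; apply: (le_trans (sle n)); apply: S_mono.
  by move=> t [i _ Fi]; exists i.
apply: ge_ereal_sup => _ [x Fx <-]; apply/lee_addgt0Pr => e e0.
have [n [y [Fy xy]]] := X_sub mF tF Fx e0.
apply: (@le_trans _ _ (s n + e%:E)%E); last first.
  by apply: leeD2r; apply: ereal_sup_ubound; exists n.
apply: (@le_trans _ _ (\sum_(i < n) y i + e)%:E); first by rewrite lee_fin.
rewrite EFinD leeD2r// /s big_mkord -sumEFin; apply: lee_sum => i _; exact: S_ge.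
Qed.

(** X A stands for the finite sums whose supremum defines the value at A.  The
    hypotheses are additivity of such sums over disjoint sets, and the
    possibility of cutting each of them along a countable partition at an
    arbitrarily small cost. *)
Lemma sup_measure : exists m : {measure set T -> \bar R}, (m : set T -> \bar R) = S.
Proof.
pose m : {measure set T -> \bar R} := HB.pack S (isMeasure.Build d T R S S_set0 S_ge0 S_sigma).
by exists m.
Qed.

Lemma sup_sigma_finite_measure : sigma_finite setT S ->
  exists m : {sigma_finite_measure set T -> \bar R}, (m : set T -> \bar R) = S.
Proof.
move=> sf.
have [m0 m0S] := sup_measure; rewrite -m0S in sf *.
exact: sigma_finite_measure_pack.
Qed.

End SupMeasure.

(** * The variation and the Jordan parts of a complex measure *)

Section Variation.
Context {R : realType}.
Notation T := (R * R)%type.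
Notation Re := complex.Re.
Notation Im := complex.Im.
Implicit Types (A B : set T).

Lemma bounded_setP A : bounded_set A <-> exists M : R, forall p, A p -> `|p.1| <= M /\ `|p.2| <= M.
Proof.
split.
- move=> [M [_ HM]]; exists (M + 1) => p Ap.
  have := HM (M + 1) ltac:(rewrite ltrDl; exact: ltr01) p Ap.
  by rewrite /= /Num.norm/= ge_max => /andP[].
- move=> [M HM]; exists M; split; first exact: num_real.
  move=> x Mx p /HM[p1 p2]; rewrite /= /Num.norm/= ge_max.
  by rewrite (le_trans p1 (ltW Mx)) (le_trans p2 (ltW Mx)).
Qed.

Lemma bounded_setS A B : A `<=` B -> bounded_set B -> bounded_set A.
Proof.
by move=> AB /bounded_setP[M H]; apply/bounded_setP; exists M => p /AB /H.
Qed.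

Lemma bounded_borelI A B : bounded_borel A -> measurable B -> bounded_borel (A `&` B).
Proof.
by move=> [mA bA] mB; split; [exact: measurableI|apply: bounded_setS bA; exact: subIsetl].
Qed.

Lemma bounded_borelU A B : bounded_borel A -> bounded_borel B -> bounded_borel (A `|` B).
Proof.
move=> [mA /bounded_setP[M HM]] [mB /bounded_setP[N HN]]; split; first exact: measurableU.
apply/bounded_setP; exists (Num.max M N) => p [/HM|/HN] [p1 p2]; split; rewrite le_max ?p1 ?p2 ?orbT//.
Qed.

Lemma bounded_borel0 : bounded_borel (set0 : set T).
Proof. by split => //; apply/bounded_setP; exists 0. Qed.

Variable mu : lf_complex_measure R.

(** Countable additivity in epsilon form, with real errors. *)
Lemma cmeas_cvg (E : nat -> set T) (e : R) : (forall i, measurable (E i)) -> trivIset setT E ->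
  bounded_set (\bigcup_i E i) -> 0 < e -> exists N, forall n, (N <= n)%N ->
  cabs (\sum_(i < n) mu (E i) - mu (\bigcup_i E i)) < e.
Proof.
move=> mE tE bE e0; have /cvgrPdist_lt := cmeas_sigma_additive (l := mu) mE tE bE.
move=> /(_ e%:C); rewrite ltcR => /(_ e0) [N _ HN]; exists N => n Nn.
have := HN n Nn; rewrite /= -normrN opprB.
by rewrite [X in X < _](normC_cabs (\sum_(i < n) mu (E i) - mu (\bigcup_i E i))) ltcR.
Qed.

Let triv0 : trivIset setT (fun _ : nat => set0 : set T).
Proof. by apply/trivIsetP => *; rewrite setI0. Qed.

(** The constant sequence of empty sets has convergent partial sums
    n * mu (set0). *)
Lemma cmeas_set0 : mu set0 = 0.
Proof.
have b0 : bounded_set (\bigcup_(i : nat) (set0 : set T)).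
  by rewrite bigcup0//; exact: (bounded_borel0).2.
have H e := @cmeas_cvg (fun=> set0) e (fun=> measurable0) triv0 b0.
rewrite bigcup0// in H.
apply/eqP; rewrite -cabs_eq0 eq_le cabs_ge0 andbT.
apply/ler_addgt0Pl => e e0; rewrite addr0.
have e2 : 0 < e / 2 by rewrite divr_gt0.
have [N HN] := H _ e2.
have := HN N (leqnn _); have := HN N.+1 (leqnSn _).
rewrite big_ord_recr/=; set s := \sum_(i < N) _ => H1 H2.
have -> : mu set0 = (s + mu set0 - mu set0) - (s - mu set0) by ring.
by apply: (le_trans (cabsD _ _)); rewrite cabsN; lra.
Qed.

Lemma cmeasU A B : bounded_borel A -> bounded_borel B -> A `&` B = set0 ->
  mu (A `|` B) = mu A + mu B.
Proof.
move=> bA bB AB; have bAB := bounded_borelU bA bB.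
pose E := bigcup2 A B.
have EU : \bigcup_i E i = A `|` B by exact: bigcup2E.
have mE i : measurable (E i).
  by rewrite /E /bigcup2; case: i => [|[|i]] //=; [exact: bA.1|exact: bB.1].
have tE : trivIset setT E.
  by apply/trivIsetP => -[|[|i]] [|[|j]] //= _ _ _; rewrite /E /bigcup2/= ?setI0 ?set0I// setIC.
apply/eqP; rewrite -subr_eq0 -cabs_eq0 eq_le cabs_ge0 andbT.
apply/ler_addgt0Pl => e e0; rewrite addr0.
have bE : bounded_set (\bigcup_i E i) by rewrite EU; exact: bAB.2.
have [N HN] := cmeas_cvg mE tE bE e0.
have := HN N.+2 (leq_trans (leqnSn _) (leqnSn _)); rewrite EU.
rewrite !big_ord_recl/= big1; last by move=> i _; rewrite /E /bigcup2/= cmeas_set0.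
by rewrite addr0 {1 2}/E /bigcup2/= cabsBC => /ltW.
Qed.

Definition var_sums A : set R := [set x | exists (n : nat) (E : nat -> set T),
    [/\ forall i, bounded_borel (E i) /\ E i `<=` A, trivIset setT E &
        x = \sum_(i < n) cabs (mu (E i))]].

Lemma cvariationE A : cvariation mu A = ereal_sup [set x%:E | x in var_sums A].
Proof.
congr ereal_sup; apply/seteqP; split=> [_ [n [E [H1 H2 ->]]]|_ [_ [n [E [H1 H2 ->]]] <-]].
  by exists (\sum_(i < n) cabs (mu (E i))) => //; exists n, E.
by exists n, E.
Qed.

Lemma var_sums0 A : var_sums A 0.
Proof.
exists 0, (fun=> set0); split.
- by move=> _; split; [exact: bounded_borel0|exact: sub0set].
- exact: triv0.
- by rewrite big_ord0.
Qed.

Lemma var_sums_set0 x : var_sums set0 x -> x <= 0.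
Proof.
move=> [n [E [H1 _ ->]]]; rewrite big1// => i _.
by have [_] := H1 i; rewrite subset0 => ->; rewrite cmeas_set0 cabs0.
Qed.

Lemma var_sumsS A B : A `<=` B -> var_sums A `<=` var_sums B.
Proof.
move=> AB x [n [E [H1 H2 ->]]]; exists n, E; split=> // i.
by have [? ?] := H1 i; split=> //; exact: subset_trans AB.
Qed.

Lemma var_sumsD A B x y : A `&` B = set0 -> var_sums A x -> var_sums B y ->
  var_sums (A `|` B) (x + y).
Proof.
move=> AB [n [E [E1 E2 ->]]] [m [F [F1 F2 ->]]].
pose G i := if (i < n)%N then E i else F (i - n)%N.
exists (n + m)%N, G; split.
- move=> i; rewrite /G; case: ifP => _.
    by have [? ?] := E1 i; split=> //; apply: subset_trans (@subsetUl _ A B).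
  by have [? ?] := F1 (i - n)%N; split=> //; apply: subset_trans (@subsetUr _ A B).
- apply/trivIsetP => i j _ _ ij; rewrite /G.
  have disj k l : E k `&` F l = set0.
    rewrite -subset0 => t [Ek Fl]; rewrite -AB; split; [exact: (E1 k).2|exact: (F1 l).2].
  case: ltnP => ni; case: ltnP => nj //; last 2 first.
  + by rewrite setIC.
  + move/trivIsetP : F2; apply => //; apply: contra ij => /eqP H; apply/eqP.
    by rewrite -(subnK ni) -(subnK nj) H.
  by move/trivIsetP : E2; apply.
- rewrite big_split_ord/=; congr (_ + _); apply: eq_bigr => i _; rewrite /G /=.
    by rewrite ltn_ord.
  by rewrite ltnNge leq_addr/= addKn.
Qed.

Lemma cmeas_split (F : nat -> set T) B (e : R) : (forall i, measurable (F i)) -> trivIset setT F ->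
  bounded_borel B -> B `<=` \bigcup_i F i -> 0 < e -> exists N, forall n, (N <= n)%N ->
  cabs (\sum_(i < n) mu (B `&` F i) - mu B) < e.
Proof.
move=> mF tF bB BF e0.
have E : \bigcup_i (B `&` F i) = B by rewrite -setI_bigcupr; exact/setIidPl.
have [N HN] := @cmeas_cvg (fun i => B `&` F i) e (fun i => (bounded_borelI bB (mF i)).1)
  (trivIset_setIl tF) ltac:(rewrite E; exact: bB.2) e0.
by exists N => n /HN; rewrite E.
Qed.

(** Each of the finitely many sets E j is cut along the partition F; finitely
    many terms of F exhaust every mu (E j) up to e / (n + 1). *)
Lemma var_sums_sub (F : nat -> set T) x (e : R) : (forall i, measurable (F i)) -> trivIset setT F ->
  var_sums (\bigcup_i F i) x -> 0 < e -> exists (n : nat) (y : nat -> R),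
  (forall i, var_sums (F i) (y i)) /\ x <= \sum_(i < n) y i + e.
Proof.
move=> mF tF [n [E [E1 E2 ->]]] e0.
have en : 0 < e / n.+1%:R by rewrite divr_gt0.
have [Nf HN] := choice (fun j => cmeas_split mF tF (E1 j).1 (E1 j).2 en).
pose N := \max_(j < n) Nf j.
exists N, (fun i => \sum_(j < n) cabs (mu (E j `&` F i))); split.
  move=> i; exists n, (fun j => E j `&` F i); split=> //.
  - by move=> j; split; [exact: bounded_borelI (E1 j).1 (mF i)|exact: subIsetr].
  - exact: trivIset_setIr.
rewrite exchange_big/= .
apply: (@le_trans _ _ (\sum_(j < n) (\sum_(i < N) cabs (mu (E j `&` F i)) + e / n.+1%:R))).
  apply: ler_sum => j _.
  have NN : (Nf j <= N)%N by apply: (leq_bigmax (F := fun j : 'I_n => Nf j)).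
  apply: (le_trans (cabs_ler_dist _ (\sum_(i < N) mu (E j `&` F i)))); apply: lerD.
    elim/big_ind2 : _ => //; first by rewrite cabs0.
    by move=> a b c d ab cd; apply: (le_trans (cabsD _ _)); exact: lerD.
  by rewrite cabsBC; apply/ltW/HN.
rewrite big_split/=; apply: lerD => //.
have -> : \sum_(j < n) (e / n.+1%:R) = e * (n%:R / n.+1%:R).
  by rewrite sumr_const card_ord -[LHS]mulr_natr mulrAC mulrA.
by rewrite -[leRHS]mulr1 ler_pM2l// ler_pdivrMr// mul1r ler_nat.
Qed.

Lemma cvariation_box_lty (M : R) : (cvariation mu (`[(- M)%R, M]%classic `*` `[(- M)%R, M]%classic) < +oo)%E.
Proof.
apply: cmeas_locally_finite; split; first exact: measurableX.
by apply/bounded_setP; exists M => p [/=]; rewrite !in_itv/= !ler_norml.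
Qed.

(** The total variation is a genuine sigma-finite measure, defined on all
    Borel sets although mu itself is only used on bounded ones. *)
Lemma cvariation_measure : exists m : {sigma_finite_measure set T -> \bar R},
  (m : set T -> \bar R) = cvariation mu.
Proof.
have E : cvariation mu = fun A => ereal_sup [set x%:E | x in var_sums A].
  by apply/funext => A; exact: cvariationE.
rewrite E; apply: sup_sigma_finite_measure.
- exact: var_sums0.
- exact: var_sums_set0.
- exact: var_sumsS.
- exact: var_sumsD.
- exact: var_sums_sub.
rewrite -E; exists (fun n => `[(- n%:R)%R, n%:R]%classic `*` `[(- n%:R)%R, n%:R]%classic).
- apply/seteqP; split => // p _.
  exists (Num.bound (Num.max `|p.1| `|p.2|)) => //=.
  have := @archi_boundP R (Num.max `|p.1| `|p.2|); rewrite le_max normr_ge0 => /(_ isT).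
  by rewrite gt_max => /andP[/ltW + /ltW +]; rewrite !ler_norml !in_itv.
- move=> n; split; first exact: measurableX.
  exact: cvariation_box_lty.
Qed.

Lemma cmeas_le_cvariation A B : bounded_borel B -> B `<=` A -> ((cabs (mu B))%:E <= cvariation mu A)%E.
Proof.
move=> bB BA; apply: ereal_sup_ubound; exists 1%N, (fun i => if i is 0%N then B else set0); split.
- by move=> [|i]; [|split; [exact: bounded_borel0|exact: sub0set]].
- by apply/trivIsetP => -[|i] [|j] //= _ _ _; rewrite ?setI0 ?set0I.
- by rewrite big_ord1.
Qed.

Section Jordan.
Variable P : R[i] -> R.
Hypothesis PD : forall u v, P (u + v) = P u + P v.
Hypothesis Pn : forall u, P u <= cabs u.

Let P0 : P 0 = 0.
Proof. by have /eqP := PD 0 0; rewrite addr0 -subr_eq subrr eq_sym => /eqP. Qed.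

Let PN u : P (- u) = - P u.
Proof. by apply/eqP; rewrite -addr_eq0 -PD addNr P0. Qed.

Definition jordan_vals A : set R := [set P (mu B) | B in [set B | bounded_borel B /\ B `<=` A]].

(** P stands for one of Re, Im, - Re and - Im, which give the four Jordan
    parts of mu. *)
Lemma jordan_measure : exists m : {measure set T -> \bar R},
  (m : set T -> \bar R) = jordan_part (fun A => P (mu A)).
Proof.
have E : jordan_part (fun A => P (mu A)) = fun A => ereal_sup [set x%:E | x in jordan_vals A].
  apply/funext => A; congr ereal_sup; apply/seteqP; split.
    by move=> _ [B HB <-]; exists (P (mu B)) => //; exists B.
  by move=> _ [_ [B HB <-] <-]; exists B.
rewrite E; apply: sup_measure.
- move=> A; exists set0; last by rewrite cmeas_set0.
  by split; [exact: bounded_borel0|exact: sub0set].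
- by move=> x [B [_]]; rewrite subset0 => -> <-; rewrite cmeas_set0 P0.
- by move=> A B AB x [D [bD DA] <-]; exists D => //; split=> //; exact: subset_trans AB.
- move=> A B _ _ AB [D [bD DA] <-] [D' [bD' DB] <-]; exists (D `|` D').
    by split; [exact: bounded_borelU|exact: setUSS].
  by rewrite cmeasU ?PD// -subset0 -AB; exact: setISS.
- move=> F _ e mF tF [B [bB BF] <-] e0.
  have [N HN] := cmeas_split mF tF bB BF e0.
  exists N, (fun i => P (mu (B `&` F i))); split.
    by move=> i; exists (B `&` F i) => //; split; [exact: bounded_borelI|exact: subIsetr].
  have -> : \sum_(i < N) P (mu (B `&` F i)) = P (\sum_(i < N) mu (B `&` F i)).
    by apply/esym; elim/big_ind2 : _ => // a b c d <- <-.
  have H := HN N (leqnn _); rewrite cabsBC in H.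
  have := Pn (mu B - \sum_(i < N) mu (B `&` F i)); rewrite PD PN; lra.
Qed.

(** The Jordan parts are dominated by the variation; hence integrability
    against |mu| controls all the real integrals that make up a complex one. *)
Lemma jordan_le_cvariation A : (jordan_part (fun A => P (mu A)) A <= cvariation mu A)%E.
Proof.
apply: ge_ereal_sup => _ [B [bB BA] <-]; apply: le_trans (cmeas_le_cvariation bB BA).
by rewrite lee_fin.
Qed.

End Jordan.

End Variation.

(** * Integration against a complex measure *)

Section ComplexIntegral.
Context {R : realType}.
Notation T := (R * R)%type.
Notation Re := complex.Re.
Notation Im := complex.Im.
Variable mu : lf_complex_measure R.

Let V_ex := cvariation_measure mu.
Let V : {sigma_finite_measure set T -> \bar R} := sval (cid V_ex).
Let VE : cvariation mu = V.
Proof. by rewrite /V; case: cid. Qed.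

Section RealPart.
Variable P : R[i] -> R.
Hypothesis PD : forall u v, P (u + v) = P u + P v.
Hypothesis Pn : forall u, `|P u| <= cabs u.

Let P1 u : P u <= cabs u.
Proof. exact: le_trans (ler_norm _) (Pn u). Qed.

Let NPD u v : - P (u + v) = - P u + - P v.
Proof. by rewrite PD opprD. Qed.

Let NP1 u : - P u <= cabs u.
Proof. by apply: le_trans (Pn u); rewrite -normrN ler_norm. Qed.

Let m1 : {measure set T -> \bar R} := sval (cid (jordan_measure mu PD P1)).
Let m2 : {measure set T -> \bar R} := sval (cid (jordan_measure mu NPD NP1)).

Let m1E : jordan_part (fun A => P (mu A)) = m1.
Proof. by rewrite /m1; case: cid. Qed.

Let m2E : jordan_part (fun A => - P (mu A)) = m2.
Proof. by rewrite /m2; case: cid. Qed.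

Let m1V A : (m1 A <= V A)%E.
Proof. by rewrite -m1E -VE; exact: jordan_le_cvariation. Qed.

Let m2V A : (m2 A <= V A)%E.
Proof. by rewrite -m2E -VE; exact: (jordan_le_cvariation mu NP1). Qed.

(** One of the real integrals that make up the integral against mu. *)
Definition rint (h : T -> R) := real_integral (fun A => P (mu A)) h.

Let rintE h : rint h = \int[m1]_p h p - \int[m2]_p h p.
Proof. by rewrite /rint /real_integral m1E m2E. Qed.

Let integral_dominated (m : {measure set T -> \bar R}) (h : T -> R) : (forall A, m A <= V A)%E ->
  V.-integrable setT (EFin \o h) ->
  m.-integrable setT (EFin \o h) /\
  ((`|\int[m]_p h p|)%:E <= \int[V]_p (`|h p|)%:E)%E.
Proof.
move=> mV /integrableP[mh ih].
have L : (\int[m]_p (`|h p|)%:E <= \int[V]_p (`|h p|)%:E)%E.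
  apply: ge0_le_measure_integral => //.
  by apply/measurable_EFinP; apply: measurableT_comp => //; exact/measurable_EFinP.
have im : m.-integrable setT (EFin \o h).
  by apply/integrableP; split => //; apply: le_lt_trans L ih.
split=> //; apply: le_trans L.
by rewrite EFin_normr_Rintegral//; exact: le_abse_integral.
Qed.

Lemma rintD h k : integrable (cvariation mu) setT (EFin \o h) ->
  integrable (cvariation mu) setT (EFin \o k) -> rint (fun p => h p + k p) = rint h + rint k.
Proof.
rewrite VE => hV kV; rewrite !rintE.
have [h1 _] := integral_dominated m1V hV; have [h2 _] := integral_dominated m2V hV.
have [k1 _] := integral_dominated m1V kV; have [k2 _] := integral_dominated m2V kV.
by rewrite !RintegralD//; ring.
Qed.

Lemma rintZ c h : integrable (cvariation mu) setT (EFin \o h) ->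
  rint (fun p => c * h p) = c * rint h.
Proof.
rewrite VE => hV; rewrite !rintE.
have [h1 _] := integral_dominated m1V hV; have [h2 _] := integral_dominated m2V hV.
by rewrite !RintegralZl// mulrBr.
Qed.

Lemma rint_bound h : integrable (cvariation mu) setT (EFin \o h) ->
  ((`|rint h|)%:E <= \int[cvariation mu]_p (`|h p|)%:E + \int[cvariation mu]_p (`|h p|)%:E)%E.
Proof.
rewrite VE => hV; rewrite !rintE.
have [_ h1] := integral_dominated m1V hV; have [_ h2] := integral_dominated m2V hV.
by apply: le_trans (leeD h1 h2); rewrite -EFinD lee_fin; exact: ler_normB.
Qed.

End RealPart.

Lemma integrable_comb (a b : R) (h k : T -> R) : integrable (cvariation mu) setT (EFin \o h) ->
  integrable (cvariation mu) setT (EFin \o k) ->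
  integrable (cvariation mu) setT (EFin \o (fun p => a * h p + b * k p)).
Proof.
rewrite VE => ih ik.
rewrite (_ : EFin \o _ = (fun p => a%:E * (EFin \o h) p + b%:E * (EFin \o k) p)%E)//.
by apply: integrableD => //; exact: integrableZl.
Qed.

Let cintegralE h : cintegral mu h =
  (rint (@complex.Re R) (fun p => Re (h p)) - rint (@complex.Im R) (fun p => Im (h p))) +i*
  (rint (@complex.Re R) (fun p => Im (h p)) + rint (@complex.Im R) (fun p => Re (h p))).
Proof. by []. Qed.

Lemma rint_comb (P : R[i] -> R) (a b : R) (h k : T -> R) :
  (forall u v, P (u + v) = P u + P v) -> (forall u, `|P u| <= cabs u) ->
  integrable (cvariation mu) setT (EFin \o h) ->
  integrable (cvariation mu) setT (EFin \o k) ->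
  rint P (fun p => a * h p + b * k p) = a * rint P h + b * rint P k.
Proof.
move=> PD Pn ih ik.
have ih' : integrable (cvariation mu) setT (EFin \o (fun p => a * h p)).
  have := integrable_comb a 0 ih ih; congr (integrable _ _ (EFin \o _)).
  by apply/funext => p; rewrite mul0r addr0.
have ik' : integrable (cvariation mu) setT (EFin \o (fun p => b * k p)).
  have := integrable_comb b 0 ik ik; congr (integrable _ _ (EFin \o _)).
  by apply/funext => p; rewrite mul0r addr0.
by rewrite (rintD PD Pn ih' ik') (rintZ PD Pn a ih) (rintZ PD Pn b ik).
Qed.

Lemma cintegral_linear (c : R[i]) (h k : T -> R[i]) : cintegrable mu h -> cintegrable mu k ->
  cintegral mu (fun p => c * h p + k p) = c * cintegral mu h + cintegral mu k.
Proof.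
move=> [h1 h2] [k1 k2].
have c1 := integrable_comb (Re c) (- Im c) h1 h2.
have c2 := integrable_comb (Re c) (Im c) h2 h1.
have E1 p : Re (c * h p + k p) = 1 * (Re c * Re (h p) + - Im c * Im (h p)) + 1 * Re (k p).
  by rewrite raddfD/= ReM; ring.
have E2 p : Im (c * h p + k p) = 1 * (Re c * Im (h p) + Im c * Re (h p)) + 1 * Im (k p).
  by rewrite raddfD/= ImM; ring.
have RD := raddfD (@complex.Re R); have ID := raddfD (@complex.Im R).
have Rn := @cabs_Re R; have In := @cabs_Im R.
rewrite !cintegralE.
rewrite (funext E1) (funext E2).
rewrite (rint_comb 1 1 RD Rn c1 k1) (rint_comb 1 1 ID In c1 k1).
rewrite (rint_comb 1 1 RD Rn c2 k2) (rint_comb 1 1 ID In c2 k2).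
rewrite (rint_comb _ _ RD Rn h1 h2) (rint_comb _ _ ID In h1 h2).
rewrite (rint_comb _ _ RD Rn h2 h1) (rint_comb _ _ ID In h2 h1).
move: (rint (@complex.Re R) (fun p => Re (h p))) (rint (@complex.Im R) (fun p => Re (h p)))
  (rint (@complex.Re R) (fun p => Im (h p))) (rint (@complex.Im R) (fun p => Im (h p)))
  (rint (@complex.Re R) (fun p => Re (k p))) (rint (@complex.Im R) (fun p => Re (k p)))
  (rint (@complex.Re R) (fun p => Im (k p))) (rint (@complex.Im R) (fun p => Im (k p))) => x1 x2 x3 x4 x5 x6 x7 x8.
by case: (c) => a b; apply/eqP; rewrite eq_complex/=; apply/andP; split; apply/eqP; ring.
Qed.

(** Four real integrals, each one a difference of integrals against two
    measures that are at most |mu|: this is the constant 8. *)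
Lemma cintegrableP (h : T -> R[i]) : measurable_fun setT (fun p => Re (h p)) ->
  measurable_fun setT (fun p => Im (h p)) ->
  measurable_fun setT (fun p => cabs (h p)) ->
  (\int[cvariation mu]_p (cabs (h p))%:E < +oo)%E ->
  cintegrable mu h /\ ((cabs (cintegral mu h))%:E <= 8%:E * \int[cvariation mu]_p (cabs (h p))%:E)%E.
Proof.
move=> mr mi mc fin.
have K (Q : R[i] -> R) : (forall u, `|Q u| <= cabs u) -> measurable_fun setT (fun p => Q (h p)) ->
    (\int[cvariation mu]_p (`|Q (h p)|)%:E <= \int[cvariation mu]_p (cabs (h p))%:E)%E.
  move=> Qn mQ; rewrite VE; apply: ge0_le_integral => //.
  - by apply/measurable_EFinP; apply: measurableT_comp.
  - exact/measurable_EFinP.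
  - by move=> p _; rewrite lee_fin.
have I (S : R[i] -> R) : (forall u, `|S u| <= cabs u) -> measurable_fun setT (fun p => S (h p)) ->
    integrable (cvariation mu) setT (EFin \o (fun p => S (h p))).
  move=> Sn mS; have := le_lt_trans (K S Sn mS) fin; rewrite VE => L.
  by apply/integrableP; split => //; exact/measurable_EFinP.
have Rn := @cabs_Re R; have In := @cabs_Im R.
have RD := raddfD (@complex.Re R); have ID := raddfD (@complex.Im R).
have ir := I _ Rn mr; have mul_ii := I _ In mi.
split; first by split.
have B (P S : R[i] -> R) : (forall u v, P (u + v) = P u + P v) -> (forall u, `|P u| <= cabs u) ->
   (forall u, `|S u| <= cabs u) -> measurable_fun setT (fun p => S (h p)) ->
   ((`|rint P (fun p => S (h p))|)%:E <= 2%:E * \int[cvariation mu]_p (cabs (h p))%:E)%E.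
  move=> PD Pn Sn mS; apply: (le_trans (rint_bound PD Pn (I S Sn mS))).
  apply: (le_trans (leeD (K S Sn mS) (K S Sn mS))).
  rewrite VE; set J := (\int[_]_p _)%E.
  have J0 : (0 <= J)%E by apply: integral_ge0 => p _; rewrite lee_fin cabs_ge0.
  by rewrite -[2%R]/(1 + 1)%R EFinD ge0_muleDl// !mul1e.
have B1 := B _ _ RD Rn Rn mr; have B2 := B _ _ RD Rn In mi.
have B3 := B _ _ ID In Rn mr; have B4 := B _ _ ID In In mi.
rewrite cintegralE; set r1 := rint _ _ in B1 *; set r2 := rint _ _ in B2 *.
set r3 := rint _ _ in B3 *; set r4 := rint _ _ in B4 *.
apply: (@le_trans _ _ ((`|r1| + `|r4| + (`|r2| + `|r3|))%:E)).
  rewrite lee_fin; apply: (le_trans (cabs_leD _)) => /=.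
  by apply: lerD; [exact: ler_normB|exact: ler_normD].
rewrite !EFinD; apply: (le_trans (leeD (leeD B1 B4) (leeD B2 B3))).
rewrite VE; set J := (\int[_]_p _)%E.
have J0 : (0 <= J)%E by apply: integral_ge0 => p _; rewrite lee_fin cabs_ge0.
rewrite -!ge0_muleDl ?adde_ge0//.
by rewrite -!EFinD (_ : 2 + 2 + (2 + 2) = 8)//; ring.
Qed.

End ComplexIntegral.

(** * Local estimates in the Fock space *)

Section FockPointwise.
Context {R : realType}.
Notation T := (R * R)%type.
Notation Re := complex.Re.
Notation Im := complex.Im.
Notation leb := (@lebesgue_measure R).
Notation leb2 := (leb \x leb)%E.
Implicit Types (z w : R[i]) (f : R[i] -> R[i]).

Lemma fock_weight_gt0 z : 0 < fock_weight z.
Proof. by rewrite /fock_weight mulr_gt0 ?invr_gt0 ?pi_gt0 ?expR_gt0. Qed.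

(** The integrand of the Fock norm. *)
Definition density f (p : T) : R := cabs (f (toC p)) ^+ 2 * fock_weight (toC p).

Lemma density_ge0 f p : 0 <= density f p.
Proof. by rewrite /density mulr_ge0 ?sqr_ge0 ?ltW ?fock_weight_gt0. Qed.

Lemma entire_eps_cont f : entire f -> eps_cont f.
Proof. by move=> ef; apply: (@cdiff_eps_cont _ f (cderiv 1 f)); exact: entire_cdiffE. Qed.

Lemma measurable_cabs : measurable_fun setT (fun p : T => cabs (toC p)).
Proof. by apply: (@measurable_cabs_toC _ (fun z => z)); apply: (@cdiff_eps_cont _ _ (fun=> 1)) => z; exact: cdiff_id. Qed.

Lemma measurable_gauss : measurable_fun setT (fun p : T => expR (- cabs (toC p) ^+ 2)).
Proof.
apply: (measurableT_comp (f := expR)); first exact: measurable_expR.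
apply: measurableT_comp => //; apply: measurable_funX; exact: measurable_cabs.
Qed.

Lemma measurable_fock_weight : measurable_fun setT (fun p : T => fock_weight (toC p)).
Proof. by apply: measurable_funM => //; exact: measurable_gauss. Qed.

Lemma measurable_density f : entire f -> measurable_fun setT (density f).
Proof.
move=> ef; apply: measurable_funM; last exact: measurable_fock_weight.
by apply: measurable_funX; apply: measurable_cabs_toC; exact: entire_eps_cont.
Qed.

Definition local_mass f z (r : R) : \bar R :=
  (\int[leb2]_p (density f p * (inbox z r p)%:R)%:E)%E.

Lemma measurable_density_box f z r : entire f ->
  measurable_fun setT (fun p : T => (density f p * (inbox z r p)%:R)%:E).
Proof.
move=> ef; apply/measurable_EFinP; apply: measurable_funM; first exact: measurable_density.
exact: measurable_inbox.
Qed.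

Lemma density_box_ge0 f z r (p : T) : (0 <= (density f p * (inbox z r p)%:R)%:E)%E.
Proof. by rewrite lee_fin mulr_ge0 ?density_ge0. Qed.

Lemma local_mass_ge0 f z r : (0 <= local_mass f z r)%E.
Proof. by apply: integral_ge0 => p _; exact: density_box_ge0. Qed.

(** The box of half-side r at w is contained in the box of half-side s at z. *)
Lemma local_mass_mono f z w (r s : R) : entire f -> cabs (w - z) <= s - r ->
  (local_mass f w r <= local_mass f z s)%E.
Proof.
move=> ef wz; apply: ge0_le_integral => //.
- by move=> p _; exact: density_box_ge0.
- exact: measurable_density_box.
- exact: measurable_density_box.
move=> p _; rewrite lee_fin ler_wpM2l ?density_ge0// ler_nat.
rewrite /inbox; case: andP => // -[p1 p2].
have w1 : `|Re w - Re z| <= s - r by rewrite -raddfB; apply: le_trans wz; exact: cabs_Re.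
have w2 : `|Im w - Im z| <= s - r by rewrite -raddfB; apply: le_trans wz; exact: cabs_Im.
have -> : `|p.1 - Re z| <= s.
  have -> : p.1 - Re z = p.1 - Re w + (Re w - Re z) by ring.
  by apply: (le_trans (ler_normD _ _)); lra.
have -> : `|p.2 - Im z| <= s => //.
have -> : p.2 - Im z = p.2 - Im w + (Im w - Im z) by ring.
by apply: (le_trans (ler_normD _ _)); lra.
Qed.

Lemma local_mass_le f z r : entire f -> (local_mass f z r <= fock_norm2 f)%E.
Proof.
move=> ef; apply: ge0_le_integral => //.
- by move=> p _; exact: density_box_ge0.
- exact: measurable_density_box.
- by apply/measurable_EFinP; exact: measurable_density.
move=> p _; rewrite lee_fin -[leRHS]mulr1; apply: ler_wpM2l; first exact: density_ge0.
by case: inbox.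
Qed.

(** The factor exp (- z^* (u - z)) is 1 at z, and for |u - z| bounded its
    squared modulus is exp (|z|^2 - |u|^2) up to a bounded factor, because
    |u|^2 = |z|^2 + 2 Re (z^* (u - z)) + |u - z|^2. *)
Lemma fock_pointwise f z : entire f ->
  ((cabs (f z) ^+ 2 * fock_weight z)%:E <= (128 * expR 1)%:E * local_mass f z (1 / 4)%R)%E.
Proof.
move=> ef; have fd := entire_cdiffE ef.
pose g w := f w * cexp (z^* * z + (- z^*) * w).
have gd w : exists d, cdiff g w d.
  eexists; apply: cdiffM; first exact: fd.
  by apply: cdiff_affine; exact: cdiff_cexp.
have g2d w : exists d, cdiff (fun w => g w * g w) w d.
  by have [d hd] := gd w; eexists; apply: cdiffM; exact: hd.
have [d hd] := choice g2d.
have r4 : (0 : R) < 1 / 4 by lra.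
have := box_mean z hd r4.
have gz : g z = f z by rewrite /g -mulrDl subrr mul0r cexp0 mulr1.
rewrite gz cabsM -expr2 => H.
have w0 := fock_weight_gt0 z.
rewrite mulrC EFinM.
have K : ((cabs (f z) ^+ 2)%:E <= 128%:E * \int[leb2]_p (cabs (g (toC p) * g (toC p)) * (inbox z (1 / 4) p)%:R)%:E)%E.
  have -> : (cabs (f z) ^+ 2)%:E = (16%:E * ((1 / 4) ^+ 2 * cabs (f z) ^+ 2)%:E)%E.
    by rewrite -EFinM; congr EFin; field.
  have -> : (128%:E = 16%:E * 8%:E :> \bar R)%E by rewrite -EFinM; congr EFin; ring.
  by rewrite -muleA; apply: lee_wpmul2l.
have w0' : (0 <= (fock_weight z)%:E)%E by rewrite lee_fin ltW.
apply: (le_trans (lee_wpmul2l w0' K)).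
have mg : measurable_fun setT (fun p : T => (cabs (g (toC p) * g (toC p)) * (inbox z (1 / 4) p)%:R)%:E).
  apply/measurable_EFinP; apply: measurable_funM; last exact: measurable_inbox.
  by apply: (@measurable_cabs_toC _ (fun w => g w * g w)); exact: cdiff_eps_cont hd.
have g0 (p : T) : (0 <= (cabs (g (toC p) * g (toC p)) * (inbox z (1 / 4) p)%:R)%:E)%E.
  by rewrite lee_fin mulr_ge0 ?cabs_ge0.
rewrite muleA (muleC (fock_weight z)%:E) -muleA [X in (_ <= X * _)%E]EFinM -[leRHS]muleA.
apply: lee_wpmul2l => //.
have e1 : (0 <= (expR 1 : R)%:E)%E by rewrite lee_fin ltW ?expR_gt0.
have E1 := ge0_integralZl leb2 measurableT mg (fun p _ => g0 p) w0'.
have E2 := ge0_integralZl leb2 measurableT (measurable_density_box z (1 / 4) ef) (fun p _ => density_box_ge0 f z (1 / 4) p) e1.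
rewrite -E1 -E2.
apply: ge0_le_integral => //.
- by move=> p _; rewrite mule_ge0.
- exact: measurable_funeM.
- by apply: measurable_funeM; exact: measurable_density_box.
move=> p _; rewrite -!EFinM lee_fin /inbox; case: andP => [[p1 p2]|]; last by rewrite !mulr0.
have -> : cabs (g (toC p) * g (toC p)) = cabs (f (toC p)) ^+ 2 * expR (Re (z^* * z + (- z^*) * toC p)) ^+ 2.
  have -> : cabs (g (toC p) * g (toC p)) = cabs (g (toC p)) * cabs (g (toC p)) by exact: cabsM.
  have -> : cabs (g (toC p)) = cabs (f (toC p)) * expR (Re (z^* * z + (- z^*) * toC p)).
    by rewrite -cabs_cexp -cabsM.
  by rewrite !expr2 mulrACA.
rewrite !mulr1 /density.
rewrite mulrCA [leRHS]mulrCA; apply: ler_wpM2l; first exact: sqr_ge0.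
rewrite /fock_weight -mulrA [leRHS]mulrCA; apply: ler_wpM2l; first by rewrite invr_ge0 pi_ge0.
rewrite -expRM_natl -!expRD ler_expR !cabs_sqr.
case: (z) p1 p2 => a b /= p1 p2; rewrite /toC/=.
have q1 : (p.1 - a) ^+ 2 <= 1 / 16.
  by rewrite -[(p.1 - a) ^+ 2]real_normK ?num_real//; move: (normr_ge0 (p.1 - a)) p1; set u := `|_|; nra.
have q2 : (p.2 - b) ^+ 2 <= 1 / 16.
  by rewrite -[(p.2 - b) ^+ 2]real_normK ?num_real//; move: (normr_ge0 (p.2 - b)) p2; set u := `|_|; nra.
move: q1 q2 {p1 p2}; rewrite !expr2; case: p => x y /=; lra.
Qed.

(** On the disk of radius r = 1 / (4 (1 + |z|)) around z, |u|^2 differs from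
    |z|^2 by at most 1, so Cauchy's estimate costs r^(-2 n), which is comparable
    to (1 + |z|^2)^n, and a bounded factor.  The order matters: the area mean is
    taken on boxes of fixed size before differentiating, since an area mean on
    the small disk would cost two further powers of 1 + |z|. *)
Lemma cderiv_pointwise n : exists2 C : R, 0 <= C & forall f z, fock f ->
  ((cabs (cderiv n f z) ^+ 2 * fock_weight z)%:E <=
    (C * (1 + cabs z ^+ 2) ^+ n)%:E * local_mass f z (1 / 2)%R)%E.
Proof.
have [K K0 HK] := @cauchy_estimate R n.
exists (K ^+ 2 * 32 ^+ n * (128 * expR 1) * expR 1).
  by rewrite !mulr_ge0 ?exprn_ge0 ?expR_ge0.
move=> f z [ef nf].
have w0 := fock_weight_gt0 z; have z0 := cabs_ge0 z.
have Jfin : local_mass f z (1 / 2) \is a fin_num.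
  by rewrite ge0_fin_numE ?local_mass_ge0//; apply: le_lt_trans nf; exact: local_mass_le.
rewrite -(fineK Jfin) -EFinM lee_fin.
set J := fine _; have J0 : 0 <= J by rewrite fine_ge0 ?local_mass_ge0.
pose r := (4 * (1 + cabs z))^-1.
have z1 : 0 < 1 + cabs z by lra.
have r0 : 0 < r by rewrite invr_gt0 mulr_gt0.
have r4 : r <= 1 / 4.
  by rewrite /r mul1r lef_pV2 ?posrE ?mulr_gt0//; lra.
have rz : r * cabs z <= 1 / 4.
  rewrite /r mulrC ler_pdivrMr ?mulr_gt0//; lra.
(* One factor e comes from [fock_pointwise], the other one from the variation
   of the weight on the disk. *)
pose B := Num.sqrt (128 * expR 1 * J * expR 1 / fock_weight z).
have e1 := expR_gt0 (1 : R).
have B2 : B ^+ 2 = 128 * expR 1 * J * expR 1 / fock_weight z.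
  by rewrite sqr_sqrtr// divr_ge0 ?(ltW w0)// !mulr_ge0// ltW.
have H w : cabs (w - z) <= r -> cabs (f w) <= B.
  move=> wz; rewrite -(ler_pXn2r (n := 2))// ?nnegrE ?cabs_ge0 ?sqrtr_ge0//.
  rewrite B2 ler_pdivlMr//.
  have P1 : cabs (f w) ^+ 2 * fock_weight w <= 128 * expR 1 * J.
    rewrite -lee_fin; apply: (le_trans (fock_pointwise w ef)).
    rewrite [leRHS]EFinM fineK//; apply: lee_wpmul2l; first by rewrite lee_fin !mulr_ge0// ltW.
    apply: local_mass_mono => //; apply: (le_trans wz); lra.
  have P2 : fock_weight z <= fock_weight w * expR 1.
    rewrite /fock_weight -mulrA; apply: ler_wpM2l; first by rewrite invr_ge0 pi_ge0.
    rewrite -expRD ler_expR.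
    have wl := cabs_ler_dist w z; have w00 := cabs_ge0 w; have d0 := cabs_ge0 (w - z).
    have : cabs w ^+ 2 <= (cabs z + r) ^+ 2.
      by rewrite ler_pXn2r ?nnegrE//; [apply: (le_trans wl); rewrite lerD2l|lra].
    have -> : (cabs z + r) ^+ 2 = cabs z ^+ 2 + 2 * (r * cabs z) + r * r by ring.
    have : r * r <= 1 / 4 * (1 / 4) by apply: ler_pM => //; exact: ltW.
    lra.
  apply: (@le_trans _ _ (cabs (f w) ^+ 2 * (fock_weight w * expR 1))).
    by rewrite ler_wpM2l ?sqr_ge0.
  by rewrite mulrA ler_wpM2r// ltW.
have L := HK f z r B ef r0 H.
have B0 : 0 <= B by exact: sqrtr_ge0.
have L2 : cabs (cderiv n f z) ^+ 2 <= (K / r ^+ n * B) ^+ 2.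
  by rewrite ler_pXn2r ?nnegrE ?cabs_ge0// !mulr_ge0 ?invr_ge0 ?exprn_ge0// ltW.
apply: (le_trans (ler_wpM2r (ltW w0) L2)).
rewrite !exprMn B2.
have -> : K ^+ 2 * (r ^+ n)^-1 ^+ 2 * (128 * expR 1 * J * expR 1 / fock_weight z) * fock_weight z =
   K ^+ 2 * (r ^- n) ^+ 2 * (128 * expR 1 * J * expR 1).
  by field; rewrite !gt_eqF ?exprn_gt0.
have -> : K ^+ 2 * 32 ^+ n * (128 * expR 1) * expR 1 * (1 + cabs z ^+ 2) ^+ n * J =
   K ^+ 2 * (32 ^+ n * (1 + cabs z ^+ 2) ^+ n) * (128 * expR 1 * J * expR 1) by ring.
apply: ler_wpM2r; first by rewrite !mulr_ge0// ltW.
apply: ler_wpM2l; first exact: sqr_ge0.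
rewrite -exprMn -exprVn -exprM mulnC exprM; apply: lerXn2r; rewrite ?nnegrE ?sqr_ge0//.
  by rewrite mulr_ge0// addr_ge0// sqr_ge0.
rewrite /r invrK; have := sqr_ge0 (1 - cabs z); rewrite !expr2; nra.
Qed.

End FockPointwise.

(** * From the disk condition to a Carleson inequality *)

Section Carleson.
Context {R : realType}.
Notation T := (R * R)%type.
Notation Re := complex.Re.
Notation Im := complex.Im.
Notation leb := (@lebesgue_measure R).
Notation leb2 := (leb \x leb)%E.
Implicit Types (z w : R[i]) (f g : R[i] -> R[i]).

Lemma measurable_disk z (r : R) : measurable (disk z r).
Proof.
have m : measurable_fun setT (fun p : T => cabs (toC p - z)).
  apply: (@measurable_cabs_toC _ (fun w => w - z)); apply: (@cdiff_eps_cont _ _ (fun=> 1 + 0)) => w.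
  by apply: cdiffD; [exact: cdiff_id|exact: cdiff_cst].
rewrite (_ : disk z r = setT `&` (fun p : T => cabs (toC p - z)) @^-1` `]-oo, r[%classic).
  by apply: m => //; exact: measurable_itv.
by rewrite setTI; apply/seteqP; split=> p; rewrite /disk/= in_itv.
Qed.

(** Tonelli's theorem on the product of the plane with itself asks for a
    sigma-finite structure on the plane measure. *)
Lemma leb2_sigma_finite : exists L : {sigma_finite_measure set (measurableTypeR R * measurableTypeR R)%type -> \bar R},
  (L : set (measurableTypeR R * measurableTypeR R)%type -> \bar R) = leb2.
Proof.
apply: sigma_finite_measure_pack.
exists (fun n => `[(- n%:R)%R, n%:R]%classic `*` `[(- n%:R)%R, n%:R]%classic).
- apply/seteqP; split => // p _.
  exists (Num.bound (Num.max `|p.1| `|p.2|)) => //=.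
  have := @archi_boundP R (Num.max `|p.1| `|p.2|); rewrite le_max normr_ge0 => /(_ isT).
  by rewrite gt_max => /andP[/ltW + /ltW +]; rewrite !ler_norml !in_itv.
- move=> n; split; first exact: measurableX.
  pose I : set R := `[(- n%:R)%R, n%:R]%classic.
  have mI : measurable I by exact: measurable_itv.
  have lI : (leb I < +oo)%E.
    by rewrite lebesgue_measure_itv/=; case: ifP => // _; rewrite -EFinB ltry.
  have E : leb2 (I `*` I) = (leb I * leb I)%E := product_measure1E leb leb mI mI.
  have : (leb I * leb I < +oo)%E by rewrite lte_mul_pinfty// ge0_fin_numE.
  by rewrite -E.
Qed.

(** The weight m of the introduction. *)
Definition poly_wt (p : T) : R := 1 + cabs (toC p) ^+ 2.

Lemma poly_wt_ge1 p : 1 <= poly_wt p.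
Proof. by rewrite /poly_wt lerDl sqr_ge0. Qed.

Lemma poly_wt_gt0 p : 0 < poly_wt p.
Proof. exact: lt_le_trans ltr01 (poly_wt_ge1 p). Qed.

Lemma measurable_poly_wt : measurable_fun setT poly_wt.
Proof. by apply: measurable_funD => //; apply: measurable_funX; exact: measurable_cabs. Qed.

Lemma measurable_poly_wt_powR (k : R) : measurable_fun setT (fun p => poly_wt p `^ k).
Proof. exact: (measurableT_comp (measurable_powR k) measurable_poly_wt). Qed.

(** The half-side 1 / 2 is chosen so that the unit box fits into the disk of
    radius sqrt 2; on that box the weight varies by a factor at most 2. *)
Lemma box_in_disk (p q : T) : inbox (toC p) (1 / 2) q ->
  disk (toC q) (Num.sqrt 2) p /\ poly_wt p <= 2 * poly_wt q.
Proof.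
rewrite /inbox /toC/= => /andP[h1 h2].
have s1 : (p.1 - q.1) ^+ 2 <= 1 / 4.
  by rewrite -[(p.1 - q.1) ^+ 2]real_normK ?num_real// distrC; move: (normr_ge0 (q.1 - p.1)) h1; set u := `|_|; nra.
have s2 : (p.2 - q.2) ^+ 2 <= 1 / 4.
  by rewrite -[(p.2 - q.2) ^+ 2]real_normK ?num_real// distrC; move: (normr_ge0 (q.2 - p.2)) h2; set u := `|_|; nra.
have d : cabs (toC p - toC q) ^+ 2 <= 1 / 2 by rewrite cabs_sqr/=; lra.
split.
  rewrite -[disk _ _ _]/(is_true (cabs (toC p - toC q) < Num.sqrt 2)).
  have -> : cabs (toC p - toC q) = Num.sqrt (cabs (toC p - toC q) ^+ 2).
    by rewrite sqrtr_sqr ger0_norm// cabs_ge0.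
  by rewrite ltr_sqrt//; apply: (le_lt_trans d); lra.
rewrite /poly_wt !cabs_sqr/=; move: s1 s2; clear; move: p q => [a b] [c e] /=; rewrite !expr2 => s1 s2.
have := sqr_ge0 (a - 2 * c); have := sqr_ge0 (b - 2 * e); rewrite !expr2; lra.
Qed.

Lemma measurable_inbox_pair :
  measurable_fun setT (fun x : T * T => ((inbox (toC x.1) (1 / 2) x.2)%:R : R)).
Proof.
have mf (p : T * T -> R) : measurable_fun setT p ->
    measurable_fun setT (fun x => ((`|p x| <= 1 / 2)%R%:R : R)).
  by move=> mp; exact: (measurableT_comp (measurable_ball0 (1 / 2)) mp).
rewrite (_ : (fun _ => _) = (fun x : T * T => (`|x.2.1 - x.1.1| <= 1 / 2)%R%:R * (`|x.2.2 - x.1.2| <= 1 / 2)%R%:R)).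
  apply: measurable_funM; apply: mf; apply: measurable_funB.
  - by apply: (measurableT_comp measurable_fst); exact: measurable_snd.
  - by apply: (measurableT_comp measurable_fst); exact: measurable_fst.
  - by apply: (measurableT_comp measurable_snd); exact: measurable_snd.
  - by apply: (measurableT_comp measurable_snd); exact: measurable_fst.
by apply/funext => p; rewrite /inbox -mulnb natrM.
Qed.

Lemma measurable_local_mass f : entire f ->
  measurable_fun setT (fun p : T => local_mass f (toC p) (1 / 2)%R).
Proof.
move=> ef; have [L LE] := leb2_sigma_finite.
pose G (x : T * T) := (density f x.2 * (inbox (toC x.1) (1 / 2) x.2)%:R)%:E.
have mG : measurable_fun setT G.
  apply/measurable_EFinP; apply: measurable_funM; last exact: measurable_inbox_pair.
  by apply: (measurableT_comp (measurable_density ef)); exact: measurable_snd.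
have G0 x : (0 <= G x)%E by rewrite lee_fin mulr_ge0 ?density_ge0.
rewrite (_ : (fun p => _) = fubini_F L G).
  exact: (measurable_fun_fubini_tonelli_F (m2 := L) G mG G0).
by apply/funext => p; rewrite /fubini_F /local_mass -LE.
Qed.

Variable mu : lf_complex_measure R.

(** After exchanging the integrals, the inner one is taken over the points p
    whose unit box contains q; they lie in the disk of radius sqrt 2 at q. *)
Lemma carleson_tonelli (k D : R) f : 0 <= k -> 0 <= D -> entire f ->
  (forall z, cvariation mu (disk z (Num.sqrt 2)) * ((1 + cabs z ^+ 2) `^ k)%:E <= D%:E)%E ->
  (\int[cvariation mu]_p ((poly_wt p `^ k)%:E * local_mass f (toC p) (1 / 2)%R) <=
     (2 `^ k * D)%:E * fock_norm2 f)%E.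
Proof.
move=> k0 D0 ef; have [V VE] := cvariation_measure mu; rewrite -VE => HD.
pose F (x : T * T) := (poly_wt x.1 `^ k * (density f x.2 * (inbox (toC x.1) (1 / 2) x.2)%:R))%:E.
have mib := measurable_inbox_pair.
have mF : measurable_fun setT F.
  apply/measurable_EFinP; apply: measurable_funM.
    by apply: (measurableT_comp (measurable_poly_wt_powR k)); exact: measurable_fst.
  apply: measurable_funM => //.
  by apply: (measurableT_comp (measurable_density ef)); exact: measurable_snd.
have F0 x : (0 <= F x)%E.
  rewrite lee_fin; apply: mulr_ge0; first exact: powR_ge0.
  by apply: mulr_ge0 => //; exact: density_ge0.
have -> : (\int[V]_p ((poly_wt p `^ k)%:E * local_mass f (toC p) (1 / 2)%R) = \int[V]_p \int[leb2]_q F (p, q))%E.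
  apply: eq_integral => p _; rewrite /local_mass -ge0_integralZl//.
  - exact: measurable_density_box.
  - by move=> q _; exact: density_box_ge0.
  - by rewrite lee_fin powR_ge0.
have [L LE] := leb2_sigma_finite.
rewrite -LE (fubini_tonelli (m1 := V) (m2 := L) F mF F0) LE.
have kD : (0 <= (2 `^ k * D)%:E)%E by rewrite lee_fin; apply: mulr_ge0 => //; exact: powR_ge0.
rewrite /fock_norm2 -ge0_integralZl//; first last.
- by move=> p _; rewrite lee_fin; exact: density_ge0.
- by apply/measurable_EFinP; exact: (measurable_density ef).
apply: ge0_le_integral => //.
- by move=> q _; exact: integral_ge0.
- exact: (measurable_fun_fubini_tonelli_G (m1 := V) F mF F0).
- by apply: measurable_funeM; apply/measurable_EFinP; exact: (measurable_density ef).
move=> q _.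
have md := measurable_disk (toC q) (Num.sqrt 2).
apply: (@le_trans _ _ (\int[V]_p ((density f q * (2 `^ k * poly_wt q `^ k))%:E * (\1_(disk (toC q) (Num.sqrt 2)) p)%:E))%E).
  apply: ge0_le_integral => //.
  - exact: (measurable_fun_pair1 (f := F) q mF).
  - by apply: measurable_funeM; apply/measurable_EFinP; exact: measurable_indic.
  move=> p _; rewrite /F -EFinM lee_fin/=.
  case: (boolP (inbox (toC p) (1 / 2) q)) => [|_]; last first.
    rewrite !mulr0; apply: mulr_ge0 => //; apply: mulr_ge0; first exact: density_ge0.
    by apply: mulr_ge0; exact: powR_ge0.
  move=> /box_in_disk[pd pq]; rewrite indicE mem_set// !mulr1 mulrC; apply: ler_wpM2l.
    exact: density_ge0.
  rewrite -powRM ?(ltW (poly_wt_gt0 _))//; apply: ge0_ler_powR; rewrite ?nnegrE ?mulr_ge0 ?(ltW (poly_wt_gt0 _))//.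
rewrite ge0_integralZl//; first last.
- rewrite lee_fin; apply: mulr_ge0; first exact: density_ge0.
  by apply: mulr_ge0; exact: powR_ge0.
- by apply/measurable_EFinP; exact: measurable_indic.
rewrite integral_indic// setIT.
rewrite -[X in (_ <= _ * X)%E]/((density f q)%:E).
have -> : ((density f q * (2 `^ k * poly_wt q `^ k))%:E * V (disk (toC q) (Num.sqrt 2)) =
  (density f q * 2 `^ k)%:E * (V (disk (toC q) (Num.sqrt 2)) * (poly_wt q `^ k)%:E))%E.
  by rewrite mulrA EFinM -muleA; congr (_ * _)%E; rewrite muleC.
have -> : ((2 `^ k * D)%:E * (density f q)%:E = (density f q * 2 `^ k)%:E * D%:E)%E.
  by rewrite -!EFinM; congr EFin; ring.
apply: lee_wpmul2l; last exact: HD.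
by rewrite lee_fin; apply: mulr_ge0; [exact: density_ge0|exact: powR_ge0].
Qed.

End Carleson.

(** * Testing on reproducing kernels *)

Section TestFunctions.
Context {R : realType}.
Notation T := (R * R)%type.
Notation Re := complex.Re.
Notation Im := complex.Im.
Notation leb := (@lebesgue_measure R).
Notation leb2 := (leb \x leb)%E.
Implicit Types (z w : R[i]).

(** The normalised reproducing kernel of the Fock space at z0. *)
Definition kernel_fun z0 z : R[i] := cexp ((- (cabs z0 ^+ 2 / 2))%:C + z0^* * z).

Lemma kernel_cdiff z0 n z :
  cdiff (fun w => (z0^*) ^+ n * kernel_fun z0 w) z ((z0^*) ^+ n.+1 * kernel_fun z0 z).
Proof.
rewrite exprSr -mulrA; apply: cdiffZ; apply: cdiff_affine; exact: cdiff_cexp.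
Qed.

Lemma kernel_cderiv z0 n : cderiv n (kernel_fun z0) = fun w => (z0^*) ^+ n * kernel_fun z0 w.
Proof.
elim: n => [|n IH]; first by apply/funext => w; rewrite expr0 mul1r.
rewrite cderivS IH; apply/funext => z; apply: cdiff_derive; exact: kernel_cdiff.
Qed.

Lemma kernel_entire z0 : entire (kernel_fun z0).
Proof.
have [H _] := @entire_cdiff R _ _ (kernel_cdiff z0 0).
move: H; congr entire; apply/funext => w; by rewrite expr0 mul1r.
Qed.

(** Completing the square: the Gaussian centred at 0 is moved to z0. *)
Lemma kernel_abs z0 (p : T) : cabs (kernel_fun z0 (toC p)) ^+ 2 * expR (- cabs (toC p) ^+ 2) =
  expR (- (p.1 - Re z0) ^+ 2) * expR (- (p.2 - Im z0) ^+ 2).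
Proof.
rewrite cabs_cexp -expRM_natl -!expRD !cabs_sqr; congr expR.
by case: z0 => a b; case: p => x y /=; field.
Qed.

Lemma gauss_plane : (\int[leb2]_p (pi^-1 * (expR (- p.1 ^+ 2) * expR (- p.2 ^+ 2)))%:E = 1)%E.
Proof.
have mg : measurable_fun setT (fun x : R => expR (- x ^+ 2)) by exact: measurable_gauss_fun.
have G : (\int[leb]_x (expR (- x ^+ 2))%:E = (Num.sqrt pi)%:E)%E by exact: integralT_gauss.
have g0 (x : R) : (0 <= (expR (- x ^+ 2))%:E)%E by rewrite lee_fin expR_ge0.
have pi0 := pi_gt0 R.
rewrite fubini_tonelli1/=; first last.
- by move=> p; rewrite lee_fin !mulr_ge0 ?expR_ge0// invr_ge0 ltW.
- apply/measurable_EFinP; apply: measurable_funM => //; apply: measurable_funM.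
    exact: (measurableT_comp mg measurable_fst).
  exact: (measurableT_comp mg measurable_snd).
rewrite /fubini_F/=.
have -> : (\int[leb]_x \int[leb]_y (pi^-1 * (expR (- x ^+ 2) * expR (- y ^+ 2)))%:E =
   \int[leb]_x ((pi^-1 * Num.sqrt pi)%:E * (expR (- x ^+ 2))%:E))%E.
  apply: eq_integral => x _.
  transitivity (\int[leb]_y ((pi^-1 * expR (- x ^+ 2))%:E * (expR (- y ^+ 2))%:E))%E.
    by apply: eq_integral => y _; rewrite -EFinM mulrA.
  rewrite ge0_integralZl//; first by rewrite G -!EFinM mulrAC.
  - exact/measurable_EFinP.
  - by rewrite lee_fin mulr_ge0 ?expR_ge0// invr_ge0 ltW.
rewrite ge0_integralZl//.
- by rewrite G -EFinM -mulrA -expr2 sqr_sqrtr ?ltW// mulVf// gt_eqF.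
- exact/measurable_EFinP.
- by rewrite lee_fin mulr_ge0 ?sqrtr_ge0// invr_ge0 ltW.
Qed.

(** By [kernel_abs] this is the integral of a translated Gaussian. *)
Lemma kernel_norm2 z0 : fock_norm2 (kernel_fun z0) = 1%E.
Proof.
rewrite -[RHS]gauss_plane.
have pi0 := pi_gt0 R.
pose G (p : T) := (pi^-1 * (expR (- p.1 ^+ 2) * expR (- p.2 ^+ 2)))%:E.
have mg : measurable_fun setT (fun x : R => expR (- x ^+ 2)) by exact: measurable_gauss_fun.
have mG : measurable_fun setT G.
  apply/measurable_EFinP; apply: measurable_funM => //; apply: measurable_funM.
    exact: (measurableT_comp mg measurable_fst).
  exact: (measurableT_comp mg measurable_snd).
have G0 p : (0 <= G p)%E by rewrite lee_fin !mulr_ge0 ?expR_ge0// invr_ge0 ltW.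
rewrite -[RHS](@plane_affine R G (- Re z0) (- Im z0) 1 1 mG G0 (normr1 _) (normr1 _)).
apply: eq_integral => p _; rewrite /G /fock_weight mulrCA kernel_abs/= !mul1r.
by rewrite (addrC (- Re z0)) (addrC (- Im z0)).
Qed.

Lemma kernel_fock z0 : fock (kernel_fun z0).
Proof. by split; [exact: kernel_entire|rewrite kernel_norm2 ltry]. Qed.

Variable mu : lf_complex_measure R.

Lemma FC_bound_kernel j (c : R) z0 : FC_bound mu j c ->
  (\int[cvariation mu]_p (cabs z0 ^+ j ^+ 2 * (expR (- (p.1 - Re z0) ^+ 2) * expR (- (p.2 - Im z0) ^+ 2)))%:E <= c%:E)%E.
Proof.
move=> /(_ _ (kernel_fock z0)); rewrite kernel_norm2 mule1.
have [V VE] := cvariation_measure mu; rewrite -VE.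
apply: le_trans; rewrite le_eqVlt; apply/orP; left; apply/eqP.
apply: eq_integral => p _; congr EFin.
rewrite kernel_cderiv -kernel_abs mulrA.
have -> : cabs (z0^* ^+ j * kernel_fun z0 (toC p)) = cabs z0 ^+ j * cabs (kernel_fun z0 (toC p)).
  by rewrite -(cabs_conj z0) -cabsX -cabsM.
by rewrite exprMn.
Qed.

Let measurable_kernel (a : R) z0 : measurable_fun setT
  (fun p : T => (a * (expR (- (p.1 - Re z0) ^+ 2) * expR (- (p.2 - Im z0) ^+ 2)))%:E).
Proof.
have mg : measurable_fun setT (fun x : R => expR (- x ^+ 2)) by exact: measurable_gauss_fun.
have ms (u : R) : measurable_fun setT (fun x : R => expR (- (x - u) ^+ 2)).
  by apply: (measurableT_comp mg); apply: measurable_funB.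
apply/measurable_EFinP; apply: measurable_funM => //; apply: measurable_funM.
  exact: (measurableT_comp (ms (Re z0)) measurable_fst).
exact: (measurableT_comp (ms (Im z0)) measurable_snd).
Qed.

(** The kernel at z0 has |f|^2 exp (- |.|^2) >= exp (- 2) on the disk of radius
    sqrt 2 at z0. *)
Lemma FC_disk j (c : R) z0 : FC_bound mu j c ->
  ((cabs z0 ^+ j ^+ 2 * expR (- 2))%:E * cvariation mu (disk z0 (Num.sqrt 2)) <= c%:E)%E.
Proof.
move=> /(FC_bound_kernel z0); have [V VE] := cvariation_measure mu; rewrite -VE.
apply: le_trans.
have md := measurable_disk z0 (Num.sqrt 2).
have := integral_indic V measurableT md; rewrite setIT => <-.
have c0 : 0 <= cabs z0 ^+ j ^+ 2 * expR (- 2) by rewrite mulr_ge0 ?sqr_ge0 ?expR_ge0.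
rewrite -ge0_integralZl//; first last.
- exact/measurable_EFinP/measurable_indic.
apply: ge0_le_integral => //.
- by move=> p _; rewrite -EFinM lee_fin mulr_ge0.
- by apply: measurable_funeM; exact/measurable_EFinP/measurable_indic.
move=> p _; rewrite -EFinM lee_fin indicE; case: (boolP (p \in _)) => [|_]; last first.
  rewrite mulr0; apply: mulr_ge0; first exact: sqr_ge0.
  by apply: mulr_ge0; exact: expR_ge0.
rewrite inE mulr1 => pd; apply: ler_wpM2l; first exact: sqr_ge0.
rewrite -expRD ler_expR.
have : cabs (toC p - z0) ^+ 2 < 2.
  have -> : (2 : R) = Num.sqrt 2 ^+ 2 by rewrite sqr_sqrtr.
  by rewrite ltr_pXn2r ?nnegrE ?cabs_ge0 ?sqrtr_ge0.
rewrite cabs_sqr !raddfB/=; lra.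
Qed.

Lemma cvariation_le (A B : set T) : A `<=` B -> (cvariation mu A <= cvariation mu B)%E.
Proof.
move=> AB; rewrite !cvariationE; apply: ge_ereal_sup => _ [x Ax <-].
by apply: ereal_sup_ubound; exists x => //; exact: var_sumsS AB _ Ax.
Qed.

Lemma cvariation_ge0 (A : set T) : (0 <= cvariation mu A)%E.
Proof. by rewrite cvariationE; apply: ereal_sup_ubound; exists 0 => //; exact: var_sums0. Qed.

(** For |z| >= 1 the factor |z|^(2 j) given by the kernels is comparable to
    (1 + |z|^2)^j; the disks with |z| < 1 all lie in one bounded box. *)
Lemma FC_disk_bound j (c : R) : FC_bound mu j c -> exists2 D : R, 0 <= D &
  forall z, (cvariation mu (disk z (Num.sqrt 2)) * ((1 + cabs z ^+ 2) `^ j%:R)%:E <= D%:E)%E.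
Proof.
move=> FC.
pose bx : set T := `[(- 3)%R, 3%R]%classic `*` `[(- 3)%R, 3%R]%classic.
have Bfin : cvariation mu bx \is a fin_num.
  by rewrite ge0_fin_numE ?cvariation_ge0//; exact: cvariation_box_lty.
pose B := fine (cvariation mu bx).
have B0 : 0 <= B by rewrite fine_ge0 ?cvariation_ge0.
exists (2 ^+ j * expR 2 * `|c| + B * 2 ^+ j).
  by rewrite addr_ge0// !mulr_ge0 ?exprn_ge0 ?expR_ge0.
move=> z; rewrite powR_mulrn; last by rewrite addr_ge0// sqr_ge0.
have m0 : 0 <= 1 + cabs z ^+ 2 by rewrite addr_ge0// sqr_ge0.
have [z1|z1] := leP 1 (cabs z).
  apply: (@le_trans _ _ ((2 ^+ j * expR 2)%:E * ((cabs z ^+ j ^+ 2 * expR (- 2))%:E * cvariation mu (disk z (Num.sqrt 2))))%E).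
    rewrite muleC muleA; apply: lee_wpmul2r; first exact: cvariation_ge0.
    rewrite -EFinM lee_fin.
    have -> : 2 ^+ j * expR 2 * (cabs z ^+ j ^+ 2 * expR (-2)) = (2 * cabs z ^+ 2) ^+ j.
      rewrite expRN exprMn -!exprM mulnC; field; by rewrite gt_eqF ?expR_gt0.
    by rewrite lerXn2r ?nnegrE ?mulr_ge0 ?sqr_ge0//; nra.
  apply: (@le_trans _ _ ((2 ^+ j * expR 2)%:E * (`|c|)%:E)%E).
    apply: lee_wpmul2l; first by rewrite lee_fin mulr_ge0 ?exprn_ge0 ?expR_ge0.
    by apply: (le_trans (FC_disk z FC)); rewrite lee_fin ler_norm.
  by rewrite -EFinM lee_fin lerDl mulr_ge0 ?exprn_ge0.
apply: (@le_trans _ _ (B%:E * (2 ^+ j)%:E)%E); last first.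
  by rewrite -EFinM lee_fin lerDr !mulr_ge0 ?exprn_ge0 ?expR_ge0.
apply: lee_pmul.
- exact: cvariation_ge0.
- by rewrite lee_fin exprn_ge0.
- rewrite /B fineK//; apply: cvariation_le => p pd.
  have s2 : Num.sqrt 2 <= 2 :> R.
    rewrite -[leRHS](ger0_norm (x := 2))// -sqrtr_sqr ler_sqrt//; lra.
  have pz : cabs (toC p - z) < 2 by apply: lt_le_trans s2.
  have p3 : cabs (toC p) <= 3 by have := cabs_ler_dist (toC p) z; lra.
  by split; rewrite /= in_itv/= -ler_norml; [apply: le_trans (cabs_Re (toC p)) p3|apply: le_trans (cabs_Im (toC p)) p3].
- rewrite lee_fin lerXn2r ?nnegrE//; have := cabs_ge0 z; nra.
Qed.

Lemma FC_measure_disk (k : R) : FC_measure k mu -> 0 <= k /\ exists2 D : R, 0 <= D &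
  forall z, (cvariation mu (disk z (Num.sqrt 2)) * ((1 + cabs z ^+ 2) `^ k)%:E <= D%:E)%E.
Proof.
case=> [[j -> [c FC]]|[j kE]]; first by split; [|exact: FC_disk_bound FC].
set S := ereal_sup _ => Soo; split; first by rewrite kE addr_ge0// invr_ge0.
have ub z : (cvariation mu (disk z (Num.sqrt 2)) * ((1 + cabs z ^+ 2) `^ k)%:E <= S)%E.
  by apply: ereal_sup_ubound; exists z.
have S0 : (0 <= S)%E.
  by apply: le_trans (ub 0); apply: mule_ge0; [exact: cvariation_ge0|rewrite lee_fin powR_ge0].
exists (fine S); first exact: fine_ge0.
by move=> z; rewrite fineK ?ge0_fin_numE.
Qed.

Lemma FC_const_ge0 j : (0 <= FC_const j mu)%E.
Proof. by apply: le_ereal_inf_tmp => _ [c [c0 _] <-]; rewrite lee_fin. Qed.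

(** The kernel at 1 turns the Carleson inequality with constant 0 into the
    vanishing of the |mu|-integral of a positive function. *)
Lemma FC_const0 j (h : T -> R) : FC_const j mu = 0%E -> measurable_fun setT h -> (forall p, 0 <= h p) ->
  (\int[cvariation mu]_p (h p)%:E = 0)%E.
Proof.
move=> FC0 mh h0; have [V VE] := cvariation_measure mu.
pose g (p : T) : \bar R := (1 * (expR (- (p.1 - Re (1 : R[i])) ^+ 2) * expR (- (p.2 - Im (1 : R[i])) ^+ 2)))%:E.
have mg : measurable_fun setT g by exact: (measurable_kernel 1 1).
have gpos p : (0 < g p)%E by rewrite lte_fin mul1r mulr_gt0 ?expR_gt0.
have Ig : (\int[V]_p g p = 0)%E.
  apply/eqP; rewrite eq_le; apply/andP; split; last by apply: integral_ge0 => p _; exact: ltW.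
  apply/lee_addgt0Pr => e e0; rewrite add0e.
  have : (FC_const j mu < e%:E)%E by rewrite FC0 lte_fin.
  move=> /ereal_inf_lt[_ [c [_ FC] <-]]; rewrite lte_fin => ce.
  have := FC_bound_kernel 1 FC; rewrite cabs1 !expr1n -VE => H.
  by apply: (le_trans H); rewrite lee_fin ltW.
have Ig' : (\int[V]_p `|g p| = 0)%E.
  by rewrite -[RHS]Ig; apply: eq_integral => p _; rewrite gee0_abs// ltW.
have := (ae_eq_integral_abs V measurableT mg).1 Ig'.
rewrite -VE => ae0.
have aeh : ae_eq V setT (EFin \o h) (cst 0%E).
  apply: filterS ae0 => p /(_ I) /=; move: (gpos p) => + E; by rewrite E ltxx.
have mh' : measurable_fun setT (EFin \o h) by exact/measurable_EFinP.
have := (ae_eq_integral_abs V measurableT mh').2 aeh.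
by move=> <-; apply: eq_integral => p _; rewrite gee0_abs//= lee_fin.
Qed.

End TestFunctions.

(** * The sesquilinear form *)

Section Forms.
Context {R : realType}.
Notation T := (R * R)%type.
Notation Re := complex.Re.
Notation Im := complex.Im.
Implicit Types (z w : R[i]) (f g : R[i] -> R[i]).

(** Optimisation over t; when A or B vanishes the optimum is not attained, and
    the bound 0 is obtained in the limit. *)
Lemma amgm_inf (x A B : R) : 0 <= A -> 0 <= B ->
  (forall t, 0 < t -> x <= t * A + t^-1 * B) -> x <= 2 * Num.sqrt (A * B).
Proof.
move=> A0 B0 H.
have [A_0|A_0] := eqVneq A 0.
  rewrite A_0 mul0r sqrtr0 mulr0; apply/ler_addgt0Pl => e e0; rewrite addr0.
  have B1 : 0 < B + 1 by rewrite ltr_wpDl.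
  have := H ((B + 1) / e) (divr_gt0 B1 e0); rewrite A_0 mulr0 add0r invf_div => /le_trans; apply.
  by rewrite mulrAC ler_pdivrMr// ler_pM2l// lerDl.
have [B_0|B_0] := eqVneq B 0.
  rewrite B_0 mulr0 sqrtr0 mulr0; apply/ler_addgt0Pl => e e0; rewrite addr0.
  have A1 : 0 < A + 1 by rewrite ltr_wpDl.
  have := H (e / (A + 1)) (divr_gt0 e0 A1); rewrite B_0 mulr0 addr0 => /le_trans; apply.
  by rewrite mulrAC ler_pdivrMr// ler_pM2l// lerDl.
have Ap : 0 < A by rewrite lt_def A_0.
have Bp : 0 < B by rewrite lt_def B_0.
pose a := Num.sqrt A; pose b := Num.sqrt B.
have a0 : 0 < a by rewrite sqrtr_gt0.
have b0 : 0 < b by rewrite sqrtr_gt0.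
have aE : A = a ^+ 2 by rewrite sqr_sqrtr.
have bE : B = b ^+ 2 by rewrite sqr_sqrtr.
have := H (b / a) (divr_gt0 b0 a0); rewrite sqrtrM// -/a -/b {1}aE {1}bE => /le_trans; apply.
by rewrite le_eqVlt; apply/orP; left; apply/eqP; field; rewrite !gt_eqF.
Qed.

Lemma cderiv_comb n (c : R[i]) f g : entire f -> entire g ->
  cderiv n (fun z => c * f z + g z) = fun z => c * cderiv n f z + cderiv n g z.
Proof.
move=> ef eg; elim: n => [|n IH]; first by [].
rewrite (cderivS n (fun z => c * f z + g z)) IH; apply/funext => z; apply: cdiff_derive.
have df := entire_cdiffE (@entire_cderiv _ n f ef) z.
have dg := entire_cdiffE (@entire_cderiv _ n g eg) z.
exact: (cdiffD (cdiffZ c df) dg).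
Qed.

Definition deriv_density n f (p : T) : R := cabs (cderiv n f (toC p)) ^+ 2 * fock_weight (toC p).

Lemma deriv_density_ge0 n f p : 0 <= deriv_density n f p.
Proof. exact: (density_ge0 (cderiv n f)). Qed.

Lemma measurable_deriv_density n f : entire f -> measurable_fun setT (deriv_density n f).
Proof. by move=> ef; exact: (measurable_density (@entire_cderiv _ n f ef)). Qed.

Lemma cabs_coder_integrand a b f g (p : T) : cabs (coder_integrand a b f g p) =
  cabs (cderiv a f (toC p)) * cabs (cderiv b g (toC p)) * fock_weight (toC p).
Proof.
rewrite /coder_integrand.
have E (u v w : R[i]) : cabs (u * v * w) = cabs u * cabs v * cabs w.
  by rewrite (cabsM (u * v)) (cabsM u).
by rewrite E cabs_conj cabs_real gtr0_norm// fock_weight_gt0.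
Qed.

Lemma measurable_coder a b f g : entire f -> entire g ->
  [/\ measurable_fun setT (fun p => Re (coder_integrand a b f g p)),
      measurable_fun setT (fun p => Im (coder_integrand a b f g p)) &
      measurable_fun setT (fun p => cabs (coder_integrand a b f g p))].
Proof.
move=> ef eg.
have cf := entire_eps_cont (@entire_cderiv _ a f ef).
have cg := entire_eps_cont (@entire_cderiv _ b g eg).
have mw := @measurable_fock_weight R.
have rf := measurable_Re_toC cf; have ifm := measurable_Im_toC cf.
have rg := measurable_Re_toC cg; have ig := measurable_Im_toC cg.
have E p : Re (coder_integrand a b f g p) =
   (Re (cderiv a f (toC p)) * Re (cderiv b g (toC p)) + Im (cderiv a f (toC p)) * Im (cderiv b g (toC p))) * fock_weight (toC p).
  by rewrite /coder_integrand; case: (cderiv a f _) => u v; case: (cderiv b g _) => s t /=; ring.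
have F p : Im (coder_integrand a b f g p) =
   (Im (cderiv a f (toC p)) * Re (cderiv b g (toC p)) - Re (cderiv a f (toC p)) * Im (cderiv b g (toC p))) * fock_weight (toC p).
  by rewrite /coder_integrand; case: (cderiv a f _) => u v; case: (cderiv b g _) => s t /=; ring.
split.
- rewrite (funext E); apply: measurable_funM => //; apply: measurable_funD; exact: measurable_funM.
- rewrite (funext F); apply: measurable_funM => //; apply: measurable_funB; exact: measurable_funM.
- rewrite (funext (cabs_coder_integrand a b f g)); apply: measurable_funM => //.
  by apply: measurable_funM; exact: measurable_cabs_toC.
Qed.

Variable mu : lf_complex_measure R.

Lemma cabs_coder_form a b f g :
  cabs (coder_form mu a b f g) = cabs (cintegral mu (coder_integrand a b f g)).
Proof. by rewrite /coder_form cabsM cabsX cabsN cabs1 expr1n mul1r. Qed.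

(** Weighted Cauchy-Schwarz, by the inequality of the two means with a free
    parameter t. *)
Lemma coder_form_cauchy_schwarz a b f g (r : T -> R) (A B : R) : entire f -> entire g ->
  (forall p, 0 < r p) -> measurable_fun setT r -> measurable_fun setT (fun p => (r p)^-1) ->
  0 <= A -> 0 <= B ->
  (\int[cvariation mu]_p (r p * deriv_density a f p)%:E <= A%:E)%E ->
  (\int[cvariation mu]_p ((r p)^-1 * deriv_density b g p)%:E <= B%:E)%E ->
  cintegrable mu (coder_integrand a b f g) /\
  cabs (coder_form mu a b f g) <= 8 * Num.sqrt (A * B).
Proof.
move=> ef eg r0 mr mri A0 B0 HA HB.
have [m1 m2 m3] := measurable_coder a b ef eg.
have mP : measurable_fun setT (fun p => (r p * deriv_density a f p)%:E).
  by apply/measurable_EFinP; apply: measurable_funM => //; exact: measurable_deriv_density.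
have mQ : measurable_fun setT (fun p => ((r p)^-1 * deriv_density b g p)%:E).
  by apply/measurable_EFinP; apply: measurable_funM => //; exact: measurable_deriv_density.
have P0 p : (0 <= (r p * deriv_density a f p)%:E)%E.
  by rewrite lee_fin mulr_ge0 ?deriv_density_ge0// ltW.
have Q0 p : (0 <= ((r p)^-1 * deriv_density b g p)%:E)%E.
  by rewrite lee_fin mulr_ge0 ?deriv_density_ge0// invr_ge0 ltW.
have L t : 0 < t -> (\int[cvariation mu]_p (cabs (coder_integrand a b f g p))%:E <=
    (2^-1 * (t * A + t^-1 * B))%:E)%E.
  move=> t0; have [V VE] := cvariation_measure mu; rewrite -VE in HA HB *.
  have c1 : (0 <= (2^-1 * t)%:E)%E by rewrite lee_fin mulr_ge0 ?invr_ge0// ltW.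
  have c2 : (0 <= (2^-1 * t^-1)%:E)%E by rewrite lee_fin mulr_ge0 ?invr_ge0// ltW.
  apply: (@le_trans _ _ (\int[V]_p ((2^-1 * t)%:E * (r p * deriv_density a f p)%:E +
      (2^-1 * t^-1)%:E * ((r p)^-1 * deriv_density b g p)%:E))%E).
    apply: ge0_le_integral => //.
    - by move=> p _; rewrite lee_fin cabs_ge0.
    - exact/measurable_EFinP.
    - by apply: emeasurable_funD; exact: measurable_funeM.
    move=> p _; rewrite -!EFinM -EFinD lee_fin cabs_coder_integrand /deriv_density.
    have w0 := @fock_weight_gt0 R (toC p).
    set u := cabs (cderiv a f _); set v := cabs (cderiv b g _).
    pose s := Num.sqrt (t * r p).
    have tr : 0 < t * r p by rewrite mulr_gt0.
    have s0 : 0 < s by rewrite sqrtr_gt0.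
    have sE : t * r p = s ^+ 2 by rewrite sqr_sqrtr// ltW.
    have -> : 2^-1 * t * (r p * (u ^+ 2 * fock_weight (toC p))) + 2^-1 * t^-1 * ((r p)^-1 * (v ^+ 2 * fock_weight (toC p))) =
      (2^-1 * ((t * r p) * u ^+ 2 + (t * r p)^-1 * v ^+ 2)) * fock_weight (toC p).
      by rewrite invfM; ring.
    apply: ler_wpM2r; first exact: ltW.
    rewrite sE; have := sqr_ge0 (s * u - s^-1 * v).
    have -> : (s * u - s^-1 * v) ^+ 2 = s ^+ 2 * u ^+ 2 + (s ^+ 2)^-1 * v ^+ 2 - 2 * (u * v).
      by field; rewrite gt_eqF.
    lra.
  rewrite ge0_integralD//; first last.
  - exact: measurable_funeM.
  - by move=> p _; exact: mule_ge0.
  - exact: measurable_funeM.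
  - by move=> p _; exact: mule_ge0.
  rewrite !ge0_integralZl//.
  apply: (le_trans (leeD (lee_wpmul2l c1 HA) (lee_wpmul2l c2 HB))).
  by rewrite -!EFinM -EFinD lee_fin le_eqVlt; apply/orP; left; apply/eqP; ring.
have fin : (\int[cvariation mu]_p (cabs (coder_integrand a b f g p))%:E < +oo)%E.
  by apply: le_lt_trans (L 1 ltr01) _; rewrite ltry.
have [ci bound] := cintegrableP m1 m2 m3 fin.
split=> //; rewrite cabs_coder_form.
set x := cabs _ in bound *.
suff : x / 4 <= 2 * Num.sqrt (A * B) by lra.
apply: amgm_inf => // t t0.
have x8 : x <= 8 * (2^-1 * (t * A + t^-1 * B)).
  by rewrite -lee_fin; apply: (le_trans bound); rewrite EFinM; apply: lee_wpmul2l => //; exact: L.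
lra.
Qed.

Lemma fock_normE f : fock f -> exists2 N : R, 0 <= N & fock_norm2 f = N%:E /\ fock_norm f = Num.sqrt N.
Proof.
move=> [ef nf].
have n0 : (0 <= fock_norm2 f)%E by apply: integral_ge0 => p _; rewrite lee_fin; exact: density_ge0.
have fN : fock_norm2 f \is a fin_num by rewrite ge0_fin_numE.
by exists (fine (fock_norm2 f)); [exact: fine_ge0|rewrite fineK].
Qed.

(** The power m^n lost in [cderiv_pointwise] turns m^(k - n) into m^k, which
    is the weight of the disk condition. *)
Lemma weighted_deriv_bound n : exists2 C : R, 0 <= C & forall (k D : R) f, 0 <= k -> 0 <= D -> fock f ->
  (forall z, cvariation mu (disk z (Num.sqrt 2)) * ((1 + cabs z ^+ 2) `^ k)%:E <= D%:E)%E ->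
  (\int[cvariation mu]_p (poly_wt p `^ (k - n%:R) * deriv_density n f p)%:E <=
     (C * (2 `^ k * D))%:E * fock_norm2 f)%E.
Proof.
have [C C0 HC] := @cderiv_pointwise R n.
exists C => // k D f k0 D0 ff HD; have [ef _] := ff.
have H := carleson_tonelli k0 D0 ef HD.
have [V VE] := cvariation_measure mu; rewrite -VE in H *.
have C0' : (0 <= C%:E)%E by rewrite lee_fin.
apply: (@le_trans _ _ (C%:E * \int[V]_p ((poly_wt p `^ k)%:E * local_mass f (toC p) (1 / 2)%R))%E); last first.
  by rewrite EFinM -muleA; exact: lee_wpmul2l.
have mloc : measurable_fun setT (fun p : T => ((poly_wt p `^ k)%:E * local_mass f (toC p) (1 / 2)%R)%E).
  apply: emeasurable_funM; first by apply/measurable_EFinP; exact: measurable_poly_wt_powR.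
  exact: measurable_local_mass.
rewrite -ge0_integralZl//; last first.
  by move=> p _; rewrite mule_ge0 ?local_mass_ge0// lee_fin powR_ge0.
apply: ge0_le_integral => //.
- by move=> p _; rewrite lee_fin mulr_ge0 ?powR_ge0 ?deriv_density_ge0.
- by apply/measurable_EFinP; apply: measurable_funM; [exact: measurable_poly_wt_powR|exact: measurable_deriv_density].
- exact: measurable_funeM.
move=> p _.
have := HC f (toC p) ff; rewrite -/(poly_wt p) => K.
have q0 : (0 <= (poly_wt p `^ (k - n%:R))%:E)%E by rewrite lee_fin powR_ge0.
rewrite EFinM; apply: (le_trans (lee_wpmul2l q0 K)).
rewrite muleA muleA; apply: lee_wpmul2r; first exact: local_mass_ge0.
rewrite -!EFinM lee_fin mulrCA; apply: ler_wpM2l => //.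
rewrite -powR_mulrn ?(ltW (poly_wt_gt0 p))// -powRD ?subrK//.
by apply/implyP => _; rewrite gt_eqF// poly_wt_gt0.
Qed.

End Forms.

(** * Boundedness and the final inequality *)

Section Conclusion.
Context {R : realType}.
Notation T := (R * R)%type.
Implicit Types (f g : R[i] -> R[i]).
Variable mu : lf_complex_measure R.

(** The weights m^(k - a) and m^(k - b) are inverse to each other since
    a + b = 2 k. *)
Lemma FC_form_bound (k : R) a b : FC_measure k mu -> (a + b)%:R = 2 * k ->
  exists M : R, forall f g, fock f -> fock g ->
    cintegrable mu (coder_integrand a b f g) /\
    cabs (coder_form mu a b f g) <= M * fock_norm f * fock_norm g.
Proof.
move=> /FC_measure_disk[k0 [D D0 HD]] abk.
have [Ca Ca0 Ha] := weighted_deriv_bound mu a.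
have [Cb Cb0 Hb] := weighted_deriv_bound mu b.
pose K := 2 `^ k * D.
have K0 : 0 <= K by rewrite mulr_ge0 ?powR_ge0.
exists (8 * Num.sqrt (Ca * K * (Cb * K))) => f g ff fg.
have [Nf Nf0 [NfE fnE]] := fock_normE ff.
have [Ng Ng0 [NgE gnE]] := fock_normE fg.
have HA := Ha k D f k0 D0 ff HD; have HB := Hb k D g k0 D0 fg HD.
rewrite NfE -EFinM -/K in HA; rewrite NgE -EFinM -/K in HB.
have bE (p : T) : (poly_wt p `^ (k - a%:R))^-1 = poly_wt p `^ (k - b%:R).
  rewrite -powRN; congr (_ `^ _); move: abk; rewrite natrD; lra.
have A0 : 0 <= Ca * K * Nf by apply: mulr_ge0 => //; exact: mulr_ge0.
have B0 : 0 <= Cb * K * Ng by apply: mulr_ge0 => //; exact: mulr_ge0.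
have mri : measurable_fun setT (fun p : T => (poly_wt p `^ (k - a%:R))^-1).
  by rewrite (funext bE); exact: measurable_poly_wt_powR.
have HB' : (\int[cvariation mu]_p ((poly_wt p `^ (k - a%:R))^-1 * deriv_density b g p)%:E <= (Cb * K * Ng)%:E)%E.
  have -> : (fun p => ((poly_wt p `^ (k - a%:R))^-1 * deriv_density b g p)%:E) =
      fun p => (poly_wt p `^ (k - b%:R) * deriv_density b g p)%:E.
    by apply/funext => p; rewrite bE.
  exact: HB.
have [ci bd] := coder_form_cauchy_schwarz ff.1 fg.1 (fun p => powR_gt0 _ (poly_wt_gt0 p))
  (measurable_poly_wt_powR _) mri A0 B0 HA HB'.
split=> //; apply: (le_trans bd); rewrite fnE gnE.
have -> : Ca * K * Nf * (Cb * K * Ng) = Ca * K * (Cb * K) * Nf * Ng by ring.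
by rewrite sqrtrM ?sqrtrM ?mulr_ge0// !mulrA.
Qed.

Lemma coder_form_sesquilinear a b :
  (forall f g, fock f -> fock g -> cintegrable mu (coder_integrand a b f g)) ->
  fock_sesquilinear (coder_form mu a b).
Proof.
move=> ci; split.
- move=> c f1 f2 g ff1 ff2 fg; rewrite /coder_form.
  rewrite (_ : coder_integrand a b (fun z => c * f1 z + f2 z) g =
    fun p => c * coder_integrand a b f1 g p + coder_integrand a b f2 g p); last first.
    apply/funext => p; rewrite /coder_integrand (cderiv_comb a c ff1.1 ff2.1); ring.
  by rewrite cintegral_linear; [ring|exact: ci|exact: ci].
- move=> c f g1 g2 ff fg1 fg2; rewrite /coder_form.
  rewrite (_ : coder_integrand a b f (fun z => c * g1 z + g2 z) =
    fun p => c^* * coder_integrand a b f g1 p + coder_integrand a b f g2 p); last first.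
    apply/funext => p; rewrite /coder_integrand (cderiv_comb b c fg1.1 fg2.1).
    by rewrite rmorphD rmorphM/=; ring.
  by rewrite cintegral_linear; [ring|exact: ci|exact: ci].
Qed.

(** The infimum defining the constant is attained, since the inequality is
    closed in the constant.  The factor 1 / pi of the weight is discarded. *)
Lemma FC_const_le j (r N : R) f : FC_const j mu = r%:E -> fock f -> fock_norm2 f = N%:E -> 0 <= N ->
  (\int[cvariation mu]_p (deriv_density j f p)%:E <= (r * N)%:E)%E.
Proof.
move=> rE ff NE N0.
have L c : FC_bound mu j c -> (\int[cvariation mu]_p (deriv_density j f p)%:E <= (c * N)%:E)%E.
  move=> /(_ f ff); rewrite NE -EFinM; have [V VE] := cvariation_measure mu; rewrite -VE.
  apply: le_trans; apply: ge0_le_integral => //.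
  - by move=> p _; rewrite lee_fin deriv_density_ge0.
  - by apply/measurable_EFinP; exact: measurable_deriv_density ff.1.
  - apply/measurable_EFinP; apply: measurable_funM; last exact: measurable_gauss.
    apply: measurable_funX; apply: measurable_cabs_toC.
    exact: entire_eps_cont (@entire_cderiv _ j f ff.1).
  move=> p _; rewrite lee_fin; apply: ler_wpM2l; first exact: sqr_ge0.
  rewrite /fock_weight ler_piMl ?expR_ge0// invf_le1 ?pi_gt0//.
  by apply: le_trans (pi_ge2 R); rewrite ler1n.
apply/lee_addgt0Pr => e e0.
have N1 : 0 < N + 1 by rewrite ltr_wpDl.
have : (FC_const j mu < (r + e / (N + 1))%:E)%E by rewrite rE lte_fin ltrDl divr_gt0.
move=> /ereal_inf_lt[_ [c [_ /L FC] <-]]; rewrite lte_fin => cr.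
apply: (le_trans FC); rewrite -EFinD lee_fin.
apply: (@le_trans _ _ ((r + e / (N + 1)) * N)); first by rewrite ler_wpM2r// ltW.
rewrite mulrDl lerD2l mulrAC ler_pdivrMr// ler_pM2l// lerDl//.
Qed.

Lemma coder_form_FC_const (k : R) a b f g : FC_measure k mu -> (a + b)%:R = 2 * k ->
  fock f -> fock g ->
  ((cabs (coder_form mu a b f g))%:E <=
    8%:E * poweR (FC_const a mu * FC_const b mu) 2^-1 * (fock_norm f)%:E * (fock_norm g)%:E)%E.
Proof.
move=> FC abk ff fg.
have [Nf Nf0 [NfE fnE]] := fock_normE ff.
have [Ng Ng0 [NgE gnE]] := fock_normE fg.
have fn0 : 0 <= fock_norm f by rewrite fnE sqrtr_ge0.
have gn0 : 0 <= fock_norm g by rewrite gnE sqrtr_ge0.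
have [M HM] := FC_form_bound FC abk; have [ci bd] := HM f g ff fg.
have A0 := FC_const_ge0 mu a; have B0 := FC_const_ge0 mu b.
have RHS0 : (0 <= 8%:E * poweR (FC_const a mu * FC_const b mu) 2^-1 * (fock_norm f)%:E * (fock_norm g)%:E)%E.
  by rewrite !mule_ge0 ?lee_fin// poweR_ge0.
have [m1 m2 m3] := measurable_coder a b ff.1 fg.1.
have zero : (\int[cvariation mu]_p (cabs (coder_integrand a b f g p))%:E = 0)%E ->
    ((cabs (coder_form mu a b f g))%:E <= 0)%E.
  move=> I0; have := @cintegrableP R mu _ m1 m2 m3; rewrite I0 => /(_ (ltry _))[_].
  by rewrite mule0 cabs_coder_form.
(* A constant equal to 0 makes the right-hand side 0, even if the other one is
   +oo. *)
have [A_0|A_0] := eqVneq (FC_const a mu) 0%E.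
  by apply: le_trans RHS0; apply: zero; apply: (FC_const0 A_0) => // p; exact: cabs_ge0.
have [B_0|B_0] := eqVneq (FC_const b mu) 0%E.
  by apply: le_trans RHS0; apply: zero; apply: (FC_const0 B_0) => // p; exact: cabs_ge0.
have Ap : (0 < FC_const a mu)%E by rewrite lt_def A_0.
have Bp : (0 < FC_const b mu)%E by rewrite lt_def B_0.
have infinite : (FC_const a mu * FC_const b mu = +oo)%E ->
    ((cabs (coder_form mu a b f g))%:E <= 8%:E * poweR (FC_const a mu * FC_const b mu) 2^-1 * (fock_norm f)%:E * (fock_norm g)%:E)%E.
  move=> E; have [n0|n0] := eqVneq (fock_norm f * fock_norm g) 0.
    apply: le_trans RHS0; rewrite lee_fin; apply: (le_trans bd).
    by rewrite -mulrA n0 mulr0.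
  move: n0; rewrite mulf_eq0 negb_or => /andP[n1 n2].
  have p1 : 0 < fock_norm f by rewrite lt_def n1.
  have p2 : 0 < fock_norm g by rewrite lt_def n2.
  rewrite E poweRyr ?invr_eq0// gt0_muley ?lte_fin// gt0_mulye ?lte_fin// gt0_mulye ?lte_fin//.
  exact: leey.
case AE : (FC_const a mu) => [A| |]; last 2 first.
- by rewrite -AE; apply: infinite; rewrite AE gt0_mulye.
- by move: A0; rewrite AE.
case BE : (FC_const b mu) => [B| |]; last 2 first.
- by rewrite -AE -BE; apply: infinite; rewrite BE gt0_muley.
- by move: B0; rewrite BE.
have HA := FC_const_le AE ff NfE Nf0; have HB := FC_const_le BE fg NgE Ng0.
move: A0 B0; rewrite AE BE !lee_fin => A0 B0.
have HA' : (\int[cvariation mu]_p (1 * deriv_density a f p)%:E <= (A * Nf)%:E)%E.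
  have -> : (fun p => (1 * deriv_density a f p)%:E) = (fun p => (deriv_density a f p)%:E).
    by apply/funext => p; rewrite mul1r.
  exact: HA.
have HB' : (\int[cvariation mu]_p (1^-1 * deriv_density b g p)%:E <= (B * Ng)%:E)%E.
  have -> : (fun p => (1^-1 * deriv_density b g p)%:E) = (fun p => (deriv_density b g p)%:E).
    by apply/funext => p; rewrite invr1 mul1r.
  exact: HB.
have m1c : measurable_fun setT (fun _ : T => 1 : R) by exact: measurable_cst.
have m1c' : measurable_fun setT (fun _ : T => 1^-1 : R) by exact: measurable_cst.
have [_ bd'] := coder_form_cauchy_schwarz ff.1 fg.1 (fun=> ltr01) m1c m1c'
  (mulr_ge0 A0 Nf0) (mulr_ge0 B0 Ng0) HA' HB'.
apply: (le_trans bd').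
rewrite powR12_sqrt ?mulr_ge0// fnE gnE.
have -> : A * Nf * (B * Ng) = A * B * Nf * Ng by ring.
by rewrite sqrtrM ?mulr_ge0// sqrtrM ?mulr_ge0// !mulrA.
Qed.

End Conclusion.

Theorem proposition6p4 (R : realType) :
  exists2 C : R, 0 < C &
  forall (k : R) (mu : lf_complex_measure R) (alpha beta : nat),
    FC_measure k mu -> (alpha + beta)%:R = 2 * k ->
    [/\ forall f g : R[i] -> R[i], fock f -> fock g ->
          cintegrable mu (coder_integrand alpha beta f g),
        fock_sesquilinear (coder_form mu alpha beta),
        fock_bounded (coder_form mu alpha beta) &
        forall f g : R[i] -> R[i], fock f -> fock g ->
          ((cabs (coder_form mu alpha beta f g))%:E <=
           C%:E * poweR (FC_const alpha mu * FC_const beta mu) 2^-1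
             * (fock_norm f)%:E * (fock_norm g)%:E)%E].
Proof.
exists 8 => // k mu a b FC abk.
have [M HM] := FC_form_bound FC abk.
have ci f g : fock f -> fock g -> cintegrable mu (coder_integrand a b f g).
  by move=> ff fg; have [] := HM f g ff fg.
split=> //.
- exact: coder_form_sesquilinear.
- by exists M => f g ff fg; have [] := HM f g ff fg.
- by move=> f g; exact: (coder_form_FC_const FC abk).
Qed.
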